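(* Let $\Gamma$ be a Dynkin quiver. The simplicial cones $\mathbb R_{\geq0}C\subset Q_{\mathbb R}=Q\otimes\mathbb R$ generated by all $\Gamma$-compatible subsets $C\subset\Phi_{\geq-1}$ (the maximal ones being those generated by $\Gamma$-clusters) form a smooth complete simplicial fan $\Delta_\Gamma$ in $Q_{\mathbb R}$: each such cone is simplicial with generators $C$, the faces of a cone are the cones of subsets of $C$, any two cones intersect in a common face, every maximal cone is generated by a $\mathbb Z$-basis of $Q$, and the union of all the cones is $Q_{\mathbb R}$.
   Context: A Dynkin quiver $\Gamma$ is a quiver with finite vertex set $I$ whose underlying unoriented graph is a disjoint union of Dynkin diagrams of types $A_n,D_n,E_6,E_7,E_8$. Fix an algebraically closed field $k$; $\mathrm{rep}\,\Gamma$ is the category of finite-dimensional $k$-representations. Let $\Phi$ be the root system of the underlying graph, with simple roots $\alpha_i$, root lattice $Q=\bigoplus_i\mathbb Z\alpha_i$, positive roots $\Phi_{>0}$ and almost positive roots $\Phi_{\geq-1}=\Phi_{>0}\cup\{-\alpha_i:i\in I\}$. A decorated representation of $\Gamma$ is a pair $M=M^+\oplus V$ where $M^+\in\mathrm{rep}\,\Gamma$ and $V=(V_i)_{i\in I}$ is a finite-dimensional $I$-graded vector space; morphisms are pairs (morphism of representations, graded linear map). The signed dimension vector is $\underline{\mathrm{sdim}}(M)=\sum_i(\dim M_i-\dim V_i)\alpha_i$; it induces a bijection between $\Phi_{\geq-1}$ and isoclasses of indecomposable decorated representations, and $U^\Gamma_\alpha$ denotes the one with $\underline{\mathrm{sdim}}=\alpha$.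 $E_\Gamma(M^+\oplus V,N^+\oplus W)=\mathrm{Ext}^1_\Gamma(M^+,N^+)\oplus\mathrm{Ext}^1_\Gamma(N^+,M^+)^*\oplus\bigoplus_i\mathrm{Hom}_k(M_i,W_i)\oplus\bigoplus_i\mathrm{Hom}_k(V_i,N_i)$, and $(\alpha\|\beta)_\Gamma=\dim E_\Gamma(U^\Gamma_\alpha,U^\Gamma_\beta)$. A subset $C\subset\Phi_{\geq-1}$ is $\Gamma$-compatible if $(\alpha\|\beta)_\Gamma=0$ for all $\alpha,\beta\in C$; a $\Gamma$-cluster is a maximal (by inclusion) $\Gamma$-compatible subset. *)

(* Defs.v *)
From mathcomp Require Import all_boot all_order all_algebra reals.
Set Implicit Arguments. Unset Strict Implicit. Unset Printing Implicit Defensive.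
Import Order.TTheory GRing.Theory Num.Theory.
Local Open Scope ring_scope.

Inductive dynkin_type := TA of nat (* A_{n+1} *) | TD of nat (* D_{n+4} *)
                       | TE6 | TE7 | TE8.

Definition dt_size (d : dynkin_type) : nat :=
  match d with TA n => n.+1 | TD n => n + 4 | TE6 => 6 | TE7 => 7 | TE8 => 8 end.

(* Standard labelling of the vertices 0..N-1:
   A_N : path 0-1-...-(N-1)
   D_N : path 0-...-(N-2), plus edge (N-3)-(N-1)
   E_N : path 0-...-(N-2), plus edge 2-(N-1)                                  *)
Definition dt_edge (d : dynkin_type) (a b : nat) : bool :=
  let N := dt_size d in
  match d with
  | TA _ => (b == a.+1) && (b < N)%N
  | TD _ => ((b == a.+1) && (b <= N - 2)%N) || ((a == N - 3) && (b == N - 1))%N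
  | _ => ((b == a.+1) && (b <= N - 2)%N) || ((a == 2) && (b == N - 1))%N
  end.

Definition dt_adj (d : dynkin_type) (a b : nat) : bool := dt_edge d a b || dt_edge d b a.

Section Quiver.
Variables (I A : finType) (s t : A -> I).

Definition qadj (i j : I) : bool :=
  [exists a, ((s a == i) && (t a == j)) || ((s a == j) && (t a == i))].

(* The underlying graph is a (simple) graph which is a disjoint union of
   Dynkin diagrams of types A, D, E: there is a finite family (kind j)_{j in J}
   of Dynkin types and a bijection phi from I onto the disjoint union of the
   vertex sets {(j, n) | n < dt_size (kind j)} identifying the graphs. *)
Definition dynkin_quiver : Prop :=
  (forall a, s a != t a) /\
  (forall a b, ((s a == s b) && (t a == t b)) || ((s a == t b) && (t a == s b)) -> a = b) /\
  exists (J : finType) (kind : J -> dynkin_type) (phi : I -> (J * nat)%type),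
    injective phi /\
    (forall j n, (n < dt_size (kind j))%N <-> exists i, phi i = (j, n)) /\
    (forall i i', qadj i i' =
        ((phi i).1 == (phi i').1) && dt_adj (kind (phi i).1) (phi i).2 (phi i').2).

Definition simple_root (i : I) : {ffun I -> int} := [ffun j => (i == j)%:Z].

Definition cartan (i j : I) : int :=
  if i == j then 2 else
  - (#|[set a | ((s a == i) && (t a == j)) || ((s a == j) && (t a == i))]|)%:Z.

Definition cform (v w : {ffun I -> int}) : int := \sum_(i : I) \sum_(j : I) v i * w j * cartan i j.

Definition reflect_root (i : I) (v : {ffun I -> int}) : {ffun I -> int} :=
  [ffun j => v j - cform v (simple_root i) * simple_root i j].

Definition is_root (v : {ffun I -> int}) : Prop :=
  exists (l : seq I) (i : I), v = foldr reflect_root (simple_root i) l.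

Definition is_pos_root (v : {ffun I -> int}) : Prop := is_root v /\ forall i, 0 <= v i.

Definition almost_pos_root (v : {ffun I -> int}) : Prop :=
  is_pos_root v \/ exists i, v = - simple_root i.

Variable k : fieldType.

(* A representation: total space k^n (row vectors), each basis vector p lying at
   vertex rvert p; the arrow a acts by right multiplication by rmap a, which is
   graded (maps the part at s a to the part at t a, and kills the rest).     *)
Record rep := Rep {
  rdim : nat;
  rvert : 'I_rdim -> I;
  rmap : A -> 'M[k]_rdim;
  rmap_graded : forall a p q, rmap a p q != 0 -> rvert p = s a /\ rvert q = t a }.
Arguments rvert : clear implicits.
Arguments rmap : clear implicits.
Arguments rdim : clear implicits.

Definition dimv (M : rep) (i : I) : nat := #|[pred p | rvert M p == i]|.

Definition vproj (M : rep) (i : I) : 'M[k]_(rdim M) :=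
  \matrix_(p, q) ((p == q) && (rvert M p == i))%:R.

Definition subrep (M : rep) (U : 'M[k]_(rdim M)) : bool :=
  (U == \sum_(i : I) (U :&: vproj M i))%MS && [forall a, (U *m rmap M a <= U)%MS].

(* Ext^1(M, N) as the cokernel of the standard map
   delta : (+)_i Hom_k(M_i, N_i) -> (+)_a Hom_k(M_{s a}, N_{t a}),
   f |-> (M_a f - f N_a)_a.
   Domain: graded n x m matrices.  Codomain: n x (|A| m) matrices, the block of
   columns of arrow a (columns mxvec_index (enum_rank a) q) being graded from
   vertex s a to vertex t a.                                                  *)
Section Ext.
Variables M N : rep.
Let n := rdim M.
Let m := rdim N.

Definition hom_mask (f : 'M[k]_(n, m)) : 'M[k]_(n, m) :=
  \matrix_(p, q) (if rvert M p == rvert N q then 0 else f p q).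

Definition arrow_block (a : A) : 'M[k]_(m, #|A| * m) :=
  \matrix_(q, c) (c == mxvec_index (enum_rank a) q)%:R.

Definition ext_delta (f : 'M[k]_(n, m)) : 'M[k]_(n, #|A| * m) :=
  \sum_(a : A) (rmap M a *m f - f *m rmap N a) *m arrow_block a.

Definition cod_good (p : 'I_n) (c : 'I_(#|A| * m)) : bool :=
  [exists a, exists q, (c == mxvec_index (enum_rank a) q)
      && (rvert M p == s a) && (rvert N q == t a)].

Definition cod_mask (g : 'M[k]_(n, #|A| * m)) : 'M[k]_(n, #|A| * m) :=
  \matrix_(p, c) (if cod_good p c then 0 else g p c).

Definition ext_dom := kermx (lin_mx hom_mask).
Definition ext_cod := kermx (lin_mx cod_mask).

Definition dim_ext1 : nat := (\rank ext_cod - \rank (ext_dom *m lin_mx ext_delta))%N.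
End Ext.

(* M^+ (+) V, the I-graded space V being given (up to iso) by its dimensions. *)
Record decrep := DecRep { drep : rep; ddec : I -> nat }.

Definition decrep_nonzero (X : decrep) : Prop :=
  rdim (drep X) <> 0%N \/ exists i, ddec X i <> 0%N.

Definition decrep_decomposable (X : decrep) : Prop :=
  exists (U U' : 'M[k]_(rdim (drep X))) (v1 v2 : I -> nat),
    subrep U /\ subrep U' /\ (U + U' == 1%:M)%MS /\ \rank (U :&: U')%MS = 0%N /\
    (forall i, ddec X i = (v1 i + v2 i)%N) /\
    (\rank U <> 0%N \/ exists i, v1 i <> 0%N) /\
    (\rank U' <> 0%N \/ exists i, v2 i <> 0%N).

Definition decrep_indecomposable (X : decrep) : Prop :=
  decrep_nonzero X /\ ~ decrep_decomposable X.

Definition sdim (X : decrep) : {ffun I -> int} :=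
  [ffun i => (dimv (drep X) i)%:Z - (ddec X i)%:Z].

(* dim E_Gamma(M^+ (+) V, N^+ (+) W); dim Ext^1(N^+,M^+)^* = dim Ext^1(N^+,M^+) *)
Definition dimE (X Y : decrep) : nat :=
  (dim_ext1 (drep X) (drep Y) + dim_ext1 (drep Y) (drep X)
   + \sum_(i : I) dimv (drep X) i * ddec Y i + \sum_(i : I) ddec X i * dimv (drep Y) i)%N.

(* (alpha || beta)_Gamma = 0, where U_alpha, U_beta are the (unique up to iso)
   indecomposable decorated representations of signed dimension alpha, beta *)
Definition compat_pair (al be : {ffun I -> int}) : Prop :=
  forall X Y : decrep, decrep_indecomposable X -> decrep_indecomposable Y ->
    sdim X = al -> sdim Y = be -> dimE X Y = 0%N.

Definition compatible (C : seq {ffun I -> int}) : Prop :=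
  uniq C /\ (forall c, c \in C -> almost_pos_root c) /\
  (forall c d, c \in C -> d \in C -> compat_pair c d).

Definition cluster (C : seq {ffun I -> int}) : Prop :=
  compatible C /\
  forall C', compatible C' -> {subset C <= C'} -> {subset C' <= C}.

Variable R : realType.

Definition cone (C : seq {ffun I -> int}) (x : I -> R) : Prop :=
  exists lam : {ffun I -> int} -> R,
    (forall c, c \in C -> 0 <= lam c) /\
    forall i, x i = \sum_(c <- C) lam c * (c i)%:~R.

Definition lin_indep_R (C : seq {ffun I -> int}) : Prop :=
  forall lam : {ffun I -> int} -> R,
    (forall i, \sum_(c <- C) lam c * (c i)%:~R = 0) -> forall c, c \in C -> lam c = 0.

Definition is_face (K F : (I -> R) -> Prop) : Prop :=
  exists ell : I -> R,
    (forall x, K x -> 0 <= \sum_(i : I) ell i * x i) /\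
    (forall x, F x <-> K x /\ \sum_(i : I) ell i * x i = 0).

(* Z-basis of Q (given linear independence, spanning Q over Z) *)
Definition Z_spans (C : seq {ffun I -> int}) : Prop :=
  forall v : {ffun I -> int}, exists z : {ffun I -> int} -> int,
    forall i, v i = \sum_(c <- C) z c * c i.

End Quiver.
Arguments cone [I] R C x.
Arguments is_face [I] R K F.

(* Main.v *)
Require Import Defs.
From HB Require Import structures.
From mathcomp Require Import all_boot all_order all_algebra reals.
From mathcomp Require Import boolp fingroup perm zify ring lra.
From Stdlib Require Import Permutation.
Import Defs.
Set Implicit Arguments. Unset Strict Implicit. Unset Printing Implicit Defensive.
Import Order.TTheory GRing.Theory Num.Theory.
Local Open Scope ring_scope.

(** Every dimension vector carries a rigid representation (one without self-extensions): among
    all direct sums of indecomposables of that dimension, one with endomorphism ring of minimal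
    dimension has no extensions between different summands, since a nonsplit extension would
    have fewer endomorphisms, and the indecomposables themselves are rigid bricks by an
    argument of Ringel, because the Tits form is positive. Two rigid representations of
    the same dimension are isomorphic: both are isomorphic to a general point of the line
    joining them. So every lattice point is, in exactly one way, a nonnegative integral
    combination of a compatible set, its negative coordinates being provided by the negative
    simple roots. Uniqueness passes to real combinations because a positive real solution of
    an integral linear system can be replaced by a positive integral one; this gives linear
    independence and intersection in common faces. There are finitely many cones and they
    are closed, so density of the rational points gives completeness, and a similar
    argument near an interior point of a maximal cone gives the lattice basis. *)

(** * Morphisms, cocycles and the Euler form *)

(** [compat_pair] quantifies over all indecomposables of the given signed dimensions, so it would
    hold vacuously at an almost positive root that had none. Gabriel's theorem is therefore obtained
    on the way: existence, because a rigid representation whose dimension has Tits form 1 has only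
    scalar endomorphisms and so a single summand; uniqueness, because rigid representations are
    determined by their dimension. Extension spaces are controlled by one identity, dim Hom - dim
    Ext^1 = Euler form of the dimensions, so additivity and isomorphism invariance of dim Ext^1 are
    inherited from Hom. Krull-Schmidt uniqueness is replaced by a statement on bricks: one that
    splits off a sum of bricks is isomorphic to one of the summands. Algebraic closure enters twice:
    an eigenvalue makes the endomorphisms of an indecomposable scalar, and some point of a line
    avoids the zeros of two polynomials. The passage from real to integral coefficients handles one
    linear relation with strictly positive coefficients. This is why uniqueness is first proved for
    disjoint sets; the general case follows by cancelling common parts. *)

Section Basics.
Variables (I A : finType) (s t : A -> I) (k : fieldType).
Notation rp := (rep s t k).
Implicit Types M N L X : rp.

(** Degree zero is expressed by commutation with the vertex idempotents, so that it can be handled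
    by matrix algebra; [gradedP] is the entrywise form. *)
Definition graded M N (f : 'M[k]_(rdim M, rdim N)) :=
  forall i, vproj M i *m f = f *m vproj N i.

Definition morph M N (f : 'M[k]_(rdim M, rdim N)) :=
  graded f /\ forall a, rmap M a *m f = f *m rmap N a.

Lemma vproj_mulE M i n (f : 'M[k]_(rdim M, n)) p q :
  (vproj M i *m f) p q = if rvert p == i then f p q else 0.
Proof.
rewrite mxE (bigD1 p) //= big1 ?addr0 => [|r rp].
  by rewrite mxE eqxx /=; case: ifP; rewrite ?mul1r ?mul0r.
by rewrite mxE eq_sym (negbTE rp) mul0r.
Qed.

Lemma mul_vprojE N i n (f : 'M[k]_(n, rdim N)) p q :
  (f *m vproj N i) p q = if rvert q == i then f p q else 0.
Proof.
rewrite mxE (bigD1 q) //= big1 ?addr0 => [|r rq].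
  by rewrite mxE eqxx /=; case: ifP; rewrite ?mulr1 ?mulr0.
by rewrite mxE (negbTE rq) mulr0.
Qed.

Lemma gradedP M N (f : 'M[k]_(rdim M, rdim N)) :
  graded f <-> forall p q, f p q != 0 -> rvert p = rvert q.
Proof.
split=> [gf p q | H i].
  apply: contraNeq => pq; have /matrixP/(_ p q) := gf (rvert p).
  by rewrite vproj_mulE mul_vprojE eqxx eq_sym (negbTE pq) => ->.
apply/matrixP=> p q; rewrite vproj_mulE mul_vprojE.
by have [->|/H ->//] := eqVneq (f p q) 0; rewrite !if_same.
Qed.

Lemma vproj_idem M i : vproj M i *m vproj M i = vproj M i.
Proof. by apply/matrixP=> p q; rewrite vproj_mulE !mxE; case: eqP; rewrite ?andbF. Qed.

Lemma vproj_sum M : \sum_i vproj M i = 1%:M.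
Proof.
apply/matrixP=> p q; rewrite summxE (bigD1 (rvert p)) //= big1 ?addr0.
  by rewrite !mxE eqxx andbT.
by move=> i ip; rewrite mxE [rvert p == _]eq_sym (negbTE ip) andbF.
Qed.

Lemma vproj_orth M i j : i != j -> vproj M i *m vproj M j = 0.
Proof.
move=> ij; apply/matrixP=> p q; rewrite vproj_mulE !mxE; case: eqP => // pi.
by case: (eqVneq p q) => //= pq; rewrite pi (negbTE ij).
Qed.

Lemma vproj_rmap M a : vproj M (s a) *m rmap M a = rmap M a.
Proof.
apply/matrixP=> p q; rewrite vproj_mulE.
have [->|/rmap_graded[-> _]] := eqVneq (rmap M a p q) 0; by rewrite ?if_same ?eqxx.
Qed.

Lemma rmap_vproj M a : rmap M a *m vproj M (t a) = rmap M a.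
Proof.
apply/matrixP=> p q; rewrite mul_vprojE.
have [->|/rmap_graded[_ ->]] := eqVneq (rmap M a p q) 0; by rewrite ?if_same ?eqxx.
Qed.

Lemma graded1 M : graded (1%:M : 'M_(rdim M)).
Proof. by move=> i; rewrite mulmx1 mul1mx. Qed.

Lemma gradedM L M N (f : 'M_(rdim L, rdim M)) (g : 'M_(rdim M, rdim N)) :
  graded f -> graded g -> graded (f *m g).
Proof. by move=> gf gg i; rewrite mulmxA gf -mulmxA gg mulmxA. Qed.

Lemma gradedD M N (f g : 'M_(rdim M, rdim N)) :
  graded f -> graded g -> graded (f + g).
Proof. by move=> gf gg i; rewrite mulmxDr mulmxDl gf gg. Qed.

Lemma gradedN M N (f : 'M_(rdim M, rdim N)) : graded f -> graded (- f).
Proof. by move=> gf i; rewrite mulmxN mulNmx gf. Qed.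

Lemma gradedZ M N c (f : 'M_(rdim M, rdim N)) : graded f -> graded (c *: f).
Proof. by move=> gf i; rewrite -scalemxAr -scalemxAl gf. Qed.

Lemma graded0 M N : graded (0 : 'M_(rdim M, rdim N)).
Proof. by move=> i; rewrite mulmx0 mul0mx. Qed.

(** Degree-zero part of a matrix. It repairs maps built with [pinvmx], which ignores the grading. *)
Definition gproj M N (f : 'M[k]_(rdim M, rdim N)) : 'M[k]_(rdim M, rdim N) :=
  \sum_i vproj M i *m f *m vproj N i.

Lemma gproj_graded M N (f : 'M_(rdim M, rdim N)) : graded (gproj f).
Proof.
move=> i; rewrite /gproj mulmx_sumr mulmx_suml; apply: eq_bigr => j _.
have [->|ij] := eqVneq i j; first by rewrite !mulmxA vproj_idem -[RHS]mulmxA vproj_idem.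
by rewrite !mulmxA vproj_orth // !mul0mx -mulmxA vproj_orth 1?eq_sym // mulmx0.
Qed.

Lemma gproj_mull L M N (g : 'M_(rdim L, rdim M)) (f : 'M_(rdim M, rdim N)) :
  graded g -> g *m gproj f = gproj (g *m f).
Proof.
move=> gg; rewrite /gproj mulmx_sumr; apply: eq_bigr => i _.
by rewrite !mulmxA -gg.
Qed.

Lemma gproj_id M N (f : 'M_(rdim M, rdim N)) : graded f -> gproj f = f.
Proof.
move=> gf; rewrite /gproj -[RHS]mul1mx -vproj_sum mulmx_suml; apply: eq_bigr => i _.
by rewrite gf -mulmxA vproj_idem.
Qed.

Lemma morph1 M : morph (1%:M : 'M_(rdim M)).
Proof. by split; [exact: graded1 | move=> a; rewrite mulmx1 mul1mx]. Qed.

Lemma morph0 M N : morph (0 : 'M_(rdim M, rdim N)).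
Proof. by split; [exact: graded0 | move=> a; rewrite mulmx0 mul0mx]. Qed.

Lemma morphM L M N (f : 'M_(rdim L, rdim M)) (g : 'M_(rdim M, rdim N)) :
  morph f -> morph g -> morph (f *m g).
Proof.
case=> gf Hf [gg Hg]; split=> [|a]; first exact: gradedM.
by rewrite mulmxA Hf -mulmxA Hg mulmxA.
Qed.

Lemma morphD M N (f g : 'M_(rdim M, rdim N)) : morph f -> morph g -> morph (f + g).
Proof.
case=> gf Hf [gg Hg]; split=> [|a]; first exact: gradedD.
by rewrite mulmxDr mulmxDl Hf Hg.
Qed.

Lemma morphZ M N c (f : 'M_(rdim M, rdim N)) : morph f -> morph (c *: f).
Proof.
case=> gf Hf; split=> [|a]; first exact: gradedZ.
by rewrite -scalemxAr -scalemxAl Hf.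
Qed.

(** A quiver without relations imposes only the degree condition on a cocycle. Hence cocycles can be
    extended and restricted freely, which is the hereditary property used later. *)
Definition cocycle M N (g : A -> 'M[k]_(rdim M, rdim N)) :=
  forall a, vproj M (s a) *m g a *m vproj N (t a) = g a.

Definition cobound M N (g : A -> 'M[k]_(rdim M, rdim N)) :=
  exists2 f, graded f & forall a, g a = rmap M a *m f - f *m rmap N a.

Lemma cocycleP M N (g : A -> 'M[k]_(rdim M, rdim N)) :
  cocycle g <-> forall a p q, g a p q != 0 -> rvert p = s a /\ rvert q = t a.
Proof.
split=> [cg a p q|H a].
  rewrite -(cg a) mul_vprojE vproj_mulE.
  by case: (rvert q =P t a) => [->|_]; case: (rvert p =P s a) => [->|_]; rewrite ?eqxx.
apply/matrixP=> p q; rewrite mul_vprojE vproj_mulE.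
by have [->|/H[-> ->]] := eqVneq (g a p q) 0; rewrite ?if_same ?eqxx.
Qed.

Lemma cocycle_proj M N (g : A -> 'M_(rdim M, rdim N)) :
  cocycle (fun a => vproj M (s a) *m g a *m vproj N (t a)).
Proof. by move=> a; rewrite !mulmxA vproj_idem -[LHS]mulmxA vproj_idem. Qed.

Lemma cocycle_delta M N (f : 'M_(rdim M, rdim N)) : graded f ->
  cocycle (fun a => rmap M a *m f - f *m rmap N a).
Proof.
move=> gf a; rewrite mulmxBr mulmxBl !mulmxA vproj_rmap -(mulmxA (rmap M a)).
by rewrite -gf mulmxA rmap_vproj gf -!mulmxA rmap_vproj vproj_rmap.
Qed.

Lemma hom_mask_eq0 M N (f : 'M_(rdim M, rdim N)) : hom_mask f = 0 <-> graded f.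
Proof.
rewrite gradedP; split=> [/matrixP H p q|H].
  by apply: contraNeq => pq; have := H p q; rewrite !mxE (negbTE pq) => ->.
apply/matrixP=> p q; rewrite !mxE; case: eqP => // pq.
by apply/eqP; apply/negPn; apply/negP => /H.
Qed.

Lemma hom_mask_is_linear M N : linear (@hom_mask _ _ _ _ _ M N).
Proof. by move=> c f g; apply/matrixP=> p q; rewrite !mxE; case: eqP; rewrite ?mulr0 ?addr0. Qed.
Lemma cod_mask_is_linear M N : linear (@cod_mask _ _ _ _ _ M N).
Proof. by move=> c f g; apply/matrixP=> p q; rewrite !mxE; case: ifP; rewrite ?mulr0 ?addr0. Qed.
Lemma ext_delta_is_linear M N : linear (@ext_delta _ _ _ _ _ M N).
Proof.
move=> c f g; rewrite /ext_delta scaler_sumr -big_split; apply: eq_bigr => a _ /=.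
rewrite mulmxDr [(_ + g) *m rmap _ _]mulmxDl -scalemxAr -[c *: f *m _]scalemxAl.
by rewrite opprD addrACA -scalerBr [LHS]mulmxDl scalemxAl.
Qed.
End Basics.

HB.instance Definition _ I A s t k M N := GRing.isLinear.Build _ _ _ _ _ (@hom_mask_is_linear I A s t k M N).
HB.instance Definition _ I A s t k M N := GRing.isLinear.Build _ _ _ _ _ (@cod_mask_is_linear I A s t k M N).
HB.instance Definition _ I A s t k M N := GRing.isLinear.Build _ _ _ _ _ (@ext_delta_is_linear I A s t k M N).

Section Euler.
Variables (I A : finType) (s t : A -> I) (k : fieldType).
Notation rp := (rep s t k).
Implicit Types M N L X : rp.

Lemma mxvec_index_eq m n (i i' : 'I_m) (j j' : 'I_n) :
  (mxvec_index i j == mxvec_index i' j') = (i == i') && (j == j').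
Proof.
apply/eqP/andP=> [|[/eqP-> /eqP->] //].
by move=> /cast_ord_inj /enum_rank_inj [-> ->].
Qed.

Lemma arrow_block_mul M N a (g : 'M[k]_(rdim M, rdim N)) p b q :
  (g *m arrow_block N a) p (mxvec_index (enum_rank b) q) = if a == b then g p q else 0.
Proof.
rewrite mxE (bigD1 q) //= big1 ?addr0 => [|r rq].
  rewrite mxE mxvec_index_eq eqxx andbT (inj_eq enum_rank_inj) eq_sym.
  by case: eqP; rewrite ?mulr1 ?mulr0.
by rewrite mxE mxvec_index_eq [q == _]eq_sym (negbTE rq) andbF mulr0.
Qed.

(** Dictionary between families indexed by arrows, used in all arguments, and the wide matrices on
    which [ext_delta] and its ranks are defined. *)
Definition blocks M N (g : A -> 'M[k]_(rdim M, rdim N)) : 'M[k]_(rdim M, #|A| * rdim N) :=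
  \sum_a g a *m arrow_block N a.

Lemma blocksE M N (g : A -> 'M[k]_(rdim M, rdim N)) p b q :
  blocks g p (mxvec_index (enum_rank b) q) = g b p q.
Proof.
rewrite summxE (bigD1 b) //= big1 ?addr0 => [|a ab].
  by rewrite arrow_block_mul eqxx.
by rewrite arrow_block_mul (negbTE ab).
Qed.

Lemma blocks_inj M N (g g' : A -> 'M[k]_(rdim M, rdim N)) :
  blocks g = blocks g' -> forall a, g a = g' a.
Proof. by move=> /matrixP H a; apply/matrixP=> p q; rewrite -!blocksE H. Qed.

Lemma blocks_surj M N (G : 'M[k]_(rdim M, #|A| * rdim N)) :
  exists g : A -> 'M[k]_(rdim M, rdim N), blocks g = G.
Proof.
exists (fun a => \matrix_(p, q) G p (mxvec_index (enum_rank a) q)).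
apply/matrixP=> p c; case/mxvec_indexP: c => b q.
by rewrite -[b]enum_valK blocksE mxE.
Qed.

Lemma ext_deltaE M N (f : 'M[k]_(rdim M, rdim N)) :
  ext_delta f = blocks (fun a => rmap M a *m f - f *m rmap N a).
Proof. by []. Qed.

Lemma cod_goodE M N p b q : cod_good (M := M) (N := N) p (mxvec_index (enum_rank b) q) =
  (rvert p == s b) && (rvert q == t b).
Proof.
apply/existsP/idP => [[a /existsP[r]]|H].
  by rewrite mxvec_index_eq (inj_eq enum_rank_inj) => /andP[/andP[/andP[/eqP-> /eqP->] -> ->]].
by exists b; apply/existsP; exists q; rewrite eqxx.
Qed.

Lemma cod_mask_eq0 M N (g : A -> 'M[k]_(rdim M, rdim N)) :
  cod_mask (blocks g) = 0 <-> cocycle g.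
Proof.
rewrite cocycleP; split=> [/matrixP H a p q|H].
  move=> nz; have := H p (mxvec_index (enum_rank a) q).
  rewrite !mxE cod_goodE blocksE; case: ifP => [/andP[/eqP-> /eqP->] //|_] E.
  by rewrite E eqxx in nz.
apply/matrixP=> p c; case/mxvec_indexP: c => b q; rewrite -[b]enum_valK mxE [RHS]mxE cod_goodE blocksE.
case: ifP => // nb; apply/eqP; apply: contraFT nb => /H[-> ->]; by rewrite !eqxx.
Qed.

Lemma mem_ext_dom M N (f : 'M[k]_(rdim M, rdim N)) :
  (mxvec f <= ext_dom M N)%MS <-> graded f.
Proof.
rewrite sub_kermx mul_vec_lin /= -hom_mask_eq0; split=> [/eqP|->]; last by rewrite linear0.
by move/(congr1 vec_mx); rewrite mxvecK linear0.
Qed.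

Lemma mem_ext_cod M N (g : A -> 'M[k]_(rdim M, rdim N)) :
  (mxvec (blocks g) <= ext_cod M N)%MS <-> cocycle g.
Proof.
rewrite sub_kermx mul_vec_lin /= -cod_mask_eq0; split=> [/eqP|->]; last by rewrite linear0.
by move/(congr1 vec_mx); rewrite mxvecK linear0.
Qed.

Definition homS M N := (ext_dom M N :&: kermx (lin_mx (@ext_delta _ _ _ _ _ M N)))%MS.

Definition hom M N : nat := \rank (homS M N).

Lemma mem_hom M N (f : 'M[k]_(rdim M, rdim N)) :
  (mxvec f <= homS M N)%MS <-> morph f.
Proof.
rewrite sub_capmx; split=> [/andP[/mem_ext_dom gf]|[gf Hf]].
  rewrite sub_kermx mul_vec_lin => /eqP /(congr1 vec_mx); rewrite mxvecK linear0 => H.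
  split=> // a; apply/eqP; rewrite -subr_eq0; apply/eqP.
  apply: (@blocks_inj _ _ (fun a => rmap M a *m f - f *m rmap N a) (fun=> 0) _ a); rewrite -ext_deltaE H.
  by rewrite /blocks big1 // => b _; rewrite mul0mx.
apply/andP; split; first exact/mem_ext_dom.
rewrite sub_kermx mul_vec_lin /=; apply/eqP; rewrite -[RHS](linear0 mxvec); congr (mxvec _).
by rewrite /ext_delta big1 // => a _; rewrite Hf subrr mul0mx.
Qed.

Definition extB M N := (ext_dom M N *m lin_mx (@ext_delta _ _ _ _ _ M N)).

Lemma mem_extB M N (g : A -> 'M[k]_(rdim M, rdim N)) :
  (mxvec (blocks g) <= extB M N)%MS <-> cobound g.
Proof.
split=> [/submxP[v]|[f gf Hg]].
  rewrite mulmxA -[v *m _]vec_mxK mul_vec_lin => /(congr1 vec_mx); rewrite !mxvecK => Hg.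
  exists (vec_mx (v *m ext_dom M N)); last exact: blocks_inj.
  by apply/mem_ext_dom; rewrite vec_mxK submxMl.
have -> : blocks g = ext_delta f by rewrite ext_deltaE; apply: eq_bigr => a _; rewrite Hg.
by rewrite -mul_vec_lin submxMr //; apply/mem_ext_dom.
Qed.

Lemma extB_cod M N : (extB M N <= ext_cod M N)%MS.
Proof.
apply/row_subP=> i; rewrite /extB row_mul -[row i _]vec_mxK mul_vec_lin /= ext_deltaE.
by apply/mem_ext_cod/cocycle_delta/mem_ext_dom; rewrite vec_mxK row_sub.
Qed.

(** The truncated difference vanishes as soon as the cocycles have rank at most that of the
    coboundaries; since the latter are contained in the former, the two spaces then coincide. *)
Lemma ext0P M N : dim_ext1 M N = 0%N <->
  forall g : A -> 'M[k]_(rdim M, rdim N), cocycle g -> cobound g.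
Proof.
split=> [/eqP|H].
  rewrite subn_eq0 => le g /mem_ext_cod cg; apply/mem_extB; apply: submx_trans cg _.
  have := extB_cod M N; rewrite -/(extB M N) in le *.
  move=> sub; have := mxrank_leqif_sup sub; rewrite /mxrank_leqif_sup => -[_ <-].
  by rewrite eqn_leq le (mxrankS sub).
apply/eqP; rewrite subn_eq0; apply: mxrankS.
apply/row_subP=> i; have [g gE] := blocks_surj (vec_mx (row i (ext_cod M N))).
have rE : row i (ext_cod M N) = mxvec (blocks g) by rewrite gE vec_mxK.
by rewrite rE; apply/mem_extB/H/mem_ext_cod; rewrite -rE row_sub.
Qed.

(** Graded maps and cocycles form coordinate subspaces, cut out by the vanishing of the entries of
    wrong degree, so their dimensions are obtained by counting entries. *)
Lemma rank_coord_kernel m (P : pred 'I_m) (B : 'M[k]_m) :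
  (forall (v : 'rV_m), (v <= B)%MS <-> forall i, ~~ P i -> v 0 i = 0) ->
  \rank B = #|P|.
Proof.
move=> H; have BE : (B :=: \sum_(i | P i) <<(delta_mx 0 i : 'rV[k]_m)>>)%MS.
  apply/eqmxP/andP; split; last first.
    apply/sumsmx_subP=> i Pi; rewrite genmxE; apply/H => j nPj; rewrite mxE eqxx /=.
    by case: eqP => // ji; rewrite ji Pi in nPj.
  apply/row_subP=> r; have := row_sub r B; move/H => rH.
  rewrite [row r B]row_sum_delta; apply: summx_sub => i _.
  have [Pi|/rH ->] := boolP (P i); last by rewrite scale0r sub0mx.
  by apply: scalemx_sub; rewrite (sumsmx_sup i) // genmxE.
rewrite BE; have /mxdirectP/= -> : mxdirect (\sum_(i | P i) <<(delta_mx 0 i : 'rV[k]_m)>>).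
  by apply: (@mxdirect_delta k _ P m id) => ? ? ? ?.
rewrite -sum1_card; apply: eq_bigr => i _; by rewrite genmxE mxrank_delta.
Qed.

Lemma card_mxvec_index m n (P : 'I_(m * n) -> bool) :
  #|P| = (\sum_(i < m) \sum_(j < n) P (mxvec_index i j))%N.
Proof.
rewrite pair_big /= -sum1_card big_mkcond /=.
rewrite (reindex (fun x : 'I_m * 'I_n => mxvec_index x.1 x.2)) /=.
  by apply: eq_bigr => x _; rewrite unfold_in; case: P.
have [g h1 h2] := curry_mxvec_bij m n; exists g => x; first by case: x => i j _; exact: (h1 (i, j)).
by move=> xi; have := h2 x xi; rewrite /uncurry; case: (g x).
Qed.

Lemma rank_mask m n (b : 'I_m -> 'I_n -> bool) (B : 'M[k]_(m * n)) :
  (forall f : 'M_(m, n), (mxvec f <= B)%MS <-> forall p q, ~~ b p q -> f p q = 0) ->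
  \rank B = (\sum_p \sum_q b p q)%N.
Proof.
move=> H; rewrite (rank_coord_kernel (P := fun c => mxvec (\matrix_(p, q) b p q) 0 c)).
  by rewrite card_mxvec_index; apply: eq_bigr => p _; apply: eq_bigr => q _; rewrite mxvecE mxE.
move=> v; rewrite -[v]vec_mxK H; split=> [Hv c|Hv p q nb].
  by case/mxvec_indexP: c => p q; rewrite !mxvecE mxE => /Hv.
by have := Hv (mxvec_index p q); rewrite !mxvecE mxE => /(_ nb).
Qed.

Notation dv := Defs.dimv.

Lemma dimvE M i : dv M i = (\sum_(p < rdim M) (rvert p == i))%N.
Proof. by rewrite /dv -sum1_card big_mkcond. Qed.

Lemma rank_ext_dom M N : \rank (ext_dom M N) = (\sum_i dv M i * dv N i)%N.
Proof.
rewrite (@rank_mask _ _ (fun p q => rvert p == rvert q)); last first.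
  move=> f; rewrite mem_ext_dom gradedP; split=> H p q.
    by move=> pq; apply: contraNeq pq => /H ->.
  by move=> nz; apply/eqP; apply: contraNT nz => /H ->.
transitivity (\sum_p \sum_q \sum_i (rvert (r := M) p == i) * (rvert (r := N) q == i))%N.
  apply: eq_bigr => p _; apply: eq_bigr => q _.
  rewrite (bigD1 (rvert p)) //= eqxx mul1n eq_sym big1 ?addn0 // => i.
  by rewrite eq_sym => /negbTE ->.
under eq_bigr do rewrite exchange_big /=.
rewrite exchange_big /=; apply: eq_bigr => i _.
rewrite !dimvE big_distrl /=; apply: eq_bigr => p _.
by rewrite big_distrr.
Qed.

Lemma rank_ext_cod M N : \rank (ext_cod M N) = (\sum_a dv M (s a) * dv N (t a))%N.
Proof.
pose b (p : 'I_(rdim M)) (c : 'I_(#|A| * rdim N)) := cod_good (M := M) (N := N) p c.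
rewrite (@rank_mask _ _ b); last first.
  move=> G; rewrite sub_kermx mul_vec_lin; split=> [/eqP /(congr1 vec_mx)|H].
    rewrite mxvecK linear0 => /matrixP H p c nb; have := H p c.
    by rewrite !mxE -/(b p c) (negbTE nb).
  apply/eqP; rewrite -[RHS](linear0 mxvec); congr mxvec; apply/matrixP=> p c; rewrite !mxE.
  by case: ifP => // /negbT /H.
transitivity (\sum_(p < rdim M) \sum_a \sum_(q < rdim N) (rvert p == s a) * (rvert q == t a))%N.
  apply: eq_bigr => p _; under eq_bigl => c do rewrite -[true]/(c \in predT).
  rewrite (reindex (fun x : 'I_#|A| * 'I_(rdim N) => mxvec_index x.1 x.2)) /=; last first.
    have [g h1 h2] := curry_mxvec_bij #|A| (rdim N).
    exists g => x; first by case: x => i j _; exact: (h1 (i, j)).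
    by move=> xi; have := h2 x xi; rewrite /uncurry; case: (g x).
  rewrite -(pair_bigA _ (fun x y => nat_of_bool (b p (mxvec_index x y)))) /=.
  rewrite (reindex (@enum_rank A)) /=; last exact/onW_bij/enum_rank_bij.
  apply: eq_bigr => a _; apply: eq_bigr => q _.
  by rewrite /b cod_goodE mulnb.
rewrite exchange_big /=; apply: eq_bigr => a _.
rewrite !dimvE big_distrl /=; apply: eq_bigr => p _.
by rewrite big_distrr.
Qed.

(** Rank-nullity for the standard map, whose kernel is Hom and whose cokernel is Ext^1. The additive
    form avoids truncated subtraction. *)
Theorem euler_form M N :
  (hom M N + \sum_a dv M (s a) * dv N (t a) = dim_ext1 M N + \sum_i dv M i * dv N i)%N.
Proof.
have rk := mxrank_mul_ker (ext_dom M N) (lin_mx (@ext_delta _ _ _ _ _ M N)).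
have le := mxrankS (extB_cod M N).
rewrite -rank_ext_dom -rank_ext_cod -rk /dim_ext1 /hom /homS -/(extB M N).
by rewrite addnA subnK // addnC.
Qed.
End Euler.

(** * Dimensions of Hom spaces and isomorphisms *)

Section HomDim.
Variables (I A : finType) (s t : A -> I) (k : fieldType).
Notation rp := (rep s t k).
Notation dv := Defs.dimv.
Implicit Types M N L X Y : rp.

Lemma mem_homE M N (v : 'rV[k]_(rdim M * rdim N)) :
  (v <= homS M N)%MS <-> morph (vec_mx v : 'M_(rdim M, rdim N)).
Proof. by rewrite -mem_hom vec_mxK. Qed.

Section Exact.
Variables (X Y X1 Y1 X2 Y2 : rp).
Variables (F : {linear 'M[k]_(rdim X, rdim Y) -> 'M[k]_(rdim X1, rdim Y1)}).
Variables (G : {linear 'M[k]_(rdim X, rdim Y) -> 'M[k]_(rdim X2, rdim Y2)}).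
Hypothesis FM : forall f, morph f -> morph (F f).
Hypothesis GM : forall f, morph f -> F f = 0 -> morph (G f).
Hypothesis FG0 : forall f, morph f -> F f = 0 -> G f = 0 -> f = 0.

Let lF := lin_mx F.
Let lG := lin_mx G.
Let V := homS X Y.

Let VF : (V *m lF <= homS X1 Y1)%MS.
Proof.
apply/row_subP=> i; rewrite row_mul -[row i V]vec_mxK mul_vec_lin.
by apply/mem_hom/FM/mem_homE/row_sub.
Qed.

Let mem_VK v : (v <= V :&: kermx lF)%MS -> morph (vec_mx v : 'M_(rdim X, rdim Y)) /\ F (vec_mx v) = 0.
Proof.
rewrite sub_capmx sub_kermx => /andP[/mem_homE mv]; rewrite -{1}[v]vec_mxK mul_vec_lin.
by move=> /eqP /(congr1 vec_mx); rewrite mxvecK linear0.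
Qed.

Let rVK : (\rank (V :&: kermx lF) <= hom X2 Y2)%N.
Proof.
rewrite -(mxrank_mul_ker _ lG) -[X in (_ <= X)%N]addn0; apply: leq_add.
  apply: mxrankS; apply/row_subP=> i; rewrite row_mul -[row i _]vec_mxK mul_vec_lin.
  by have [m0 F0] := mem_VK (row_sub i (V :&: kermx lF)%MS); apply/mem_hom/GM.
rewrite leqn0 mxrank_eq0; apply/eqP/row_matrixP=> i.
set W := (_ :&: kermx lG)%MS; have := row_sub i W; move: (row i W) => v.
rewrite sub_capmx => /andP[/mem_VK[mv Fv]]; rewrite sub_kermx -{1}[v]vec_mxK mul_vec_lin.
move=> /eqP /(congr1 vec_mx); rewrite mxvecK linear0 => Gv.
by rewrite -[v]vec_mxK (FG0 mv Fv Gv) linear0 row0.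
Qed.

(** Left exactness of Hom on a short exact sequence, in numbers: [F] is the component at one end,
    and the component [G] at the other end is a morphism only once [F] vanishes. *)
Lemma hom_le_add : (hom X Y <= hom X1 Y1 + hom X2 Y2)%N.
Proof. by rewrite {1}/hom -(mxrank_mul_ker _ lF) leq_add // mxrankS. Qed.

Lemma hom_lt_add h : morph h -> (forall f, morph f -> F f <> h) ->
  (hom X Y < hom X1 Y1 + hom X2 Y2)%N.
Proof.
move=> mh nh; rewrite {1}/hom -(mxrank_mul_ker _ lF) -addSn leq_add //.
apply: rank_ltmx.
rewrite ltmxE VF; apply/negP => /(submx_trans (iffRL (mem_hom _) mh)) /submxP[v].
rewrite mulmxA -[v *m V]vec_mxK mul_vec_lin => /(congr1 vec_mx); rewrite !mxvecK => /esym.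
by apply: nh; apply/mem_homE/submxMl.
Qed.

Variables (F' : 'M[k]_(rdim X1, rdim Y1) -> 'M[k]_(rdim X, rdim Y)).
Variables (G' : {linear 'M[k]_(rdim X2, rdim Y2) -> 'M[k]_(rdim X, rdim Y)}).
Hypothesis F'M : forall f, morph f -> morph (F' f) /\ F (F' f) = f.
Hypothesis G'M : forall f, morph f -> morph (G' f) /\ F (G' f) = 0.
Hypothesis G'0 : forall f, G' f = 0 -> f = 0.

(** The split case: [F'] makes [F] surjective on morphisms, and [G'] embeds the other Hom space into
    the kernel of [F]. *)
Lemma hom_ge_add : (hom X1 Y1 + hom X2 Y2 <= hom X Y)%N.
Proof.
rewrite [X in (_ <= X)%N]/hom -(mxrank_mul_ker _ lF); apply: leq_add.
  apply: mxrankS; apply/row_subP=> i.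
  have /mem_homE/F'M[mf ff] := row_sub i (homS X1 Y1).
  rewrite -[row i _]vec_mxK -ff -mul_vec_lin submxMr //; exact/mem_hom.
have inj : row_free (lin_mx G').
  rewrite -kermx_eq0; apply/eqP/row_matrixP=> i; rewrite row0.
  have := row_sub i (kermx (lin_mx G')); move: (row i _) => v.
  rewrite sub_kermx -{1}[v]vec_mxK mul_vec_lin => /eqP /(congr1 vec_mx).
  by rewrite mxvecK linear0 => /G'0 v0; rewrite -[v]vec_mxK v0 linear0.
rewrite /hom -(mxrankMfree _ inj); apply: mxrankS; apply/row_subP=> i.
rewrite row_mul -[row i _]vec_mxK mul_vec_lin.
have /mem_homE/G'M[mf ff] := row_sub i (homS X2 Y2).
rewrite sub_capmx sub_kermx mul_vec_lin ff linear0 eqxx andbT; exact/mem_hom.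
Qed.
End Exact.

Definition rep_iso M N := exists (f : 'M[k]_(rdim M, rdim N)) (g : 'M[k]_(rdim N, rdim M)),
  [/\ morph f, morph g, f *m g = 1%:M & g *m f = 1%:M].

Lemma rep_iso_refl M : rep_iso M M.
Proof. by exists 1%:M, 1%:M; rewrite mulmx1; split=> //; exact: morph1. Qed.

Lemma rep_iso_sym M N : rep_iso M N -> rep_iso N M.
Proof. by case=> f [g [? ? ? ?]]; exists g, f. Qed.

Lemma rep_iso_trans L M N : rep_iso L M -> rep_iso M N -> rep_iso L N.
Proof.
case=> f [g [mf mg fg gf]] [f' [g' [mf' mg' fg' gf']]].
exists (f *m f'), (g' *m g); split; try exact: morphM.
  by rewrite mulmxA -(mulmxA f) fg' mulmx1.
by rewrite mulmxA -(mulmxA g') gf mulmx1.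
Qed.

Lemma hom_le_inj X Y X1 Y1 (F : {linear 'M[k]_(rdim X, rdim Y) -> 'M[k]_(rdim X1, rdim Y1)}) :
  (forall f, morph f -> morph (F f)) -> (forall f, morph f -> F f = 0 -> f = 0) ->
  (hom X Y <= hom X1 Y1)%N.
Proof.
move=> FM F0; rewrite /hom -(mxrank_mul_ker _ (lin_mx F)) -[X in (_ <= X)%N]addn0.
apply: leq_add.
  apply: mxrankS; apply/row_subP=> i; rewrite row_mul -[row i _]vec_mxK mul_vec_lin.
  by apply/mem_hom/FM/mem_homE/row_sub.
rewrite leqn0 mxrank_eq0; apply/eqP/row_matrixP=> i; rewrite row0.
set W := (_ :&: kermx _)%MS; have := row_sub i W; move: (row i W) => v.
rewrite sub_capmx => /andP[/mem_homE mv]; rewrite sub_kermx -{1}[v]vec_mxK mul_vec_lin.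
move=> /eqP /(congr1 vec_mx); rewrite mxvecK linear0 => Fv.
by rewrite -[v]vec_mxK (F0 _ mv Fv) linear0.
Qed.

Lemma hom_iso_l M M' N : rep_iso M M' -> hom M N = hom M' N.
Proof.
have le L L' : rep_iso L L' -> (hom L N <= hom L' N)%N.
  case=> f [g [mf mg fg gf]]; apply: (@hom_le_inj _ _ _ _ (mulmx g)) => h mh /=.
    exact: morphM.
  by move/(congr1 (mulmx f)); rewrite mulmxA fg mul1mx mulmx0.
by move=> i; apply/eqP; rewrite eqn_leq !le //; exact: rep_iso_sym.
Qed.

Lemma hom_iso_r M N N' : rep_iso N N' -> hom M N = hom M N'.
Proof.
have le L L' : rep_iso L L' -> (hom M L <= hom M L')%N.
  case=> f [g [mf mg fg gf]]; apply: (@hom_le_inj _ _ _ _ (mulmxr f)) => h mh /=.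
    exact: morphM.
  by move/(congr1 (mulmx^~ g)); rewrite -mulmxA fg mulmx1 mul0mx.
by move=> i; apply/eqP; rewrite eqn_leq !le //; exact: rep_iso_sym.
Qed.

Lemma dimv_rank M i : dv M i = \rank (vproj M i).
Proof.
rewrite (@rank_coord_kernel k _ (fun p => rvert p == i)) // => v; split.
  by move=> /submxP[w ->] p np; rewrite mul_vprojE (negbTE np).
move=> H; apply/submxP; exists v; apply/rowP => p; rewrite mul_vprojE.
by case: ifP => // /negbT /H.
Qed.

Lemma dimv_iso M N i : rep_iso M N -> dv M i = dv N i.
Proof.
have le L L' : rep_iso L L' -> (dv L i <= dv L' i)%N.
  case=> f [g [[gf _] _ fg _]]; rewrite !dimv_rank.
  have -> : vproj L i = f *m vproj L' i *m g by rewrite -gf -mulmxA fg mulmx1.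
  by apply: leq_trans (mxrankM_maxl _ _) (mxrankM_maxr _ _).
by move=> h; apply/eqP; rewrite eqn_leq !le //; exact: rep_iso_sym.
Qed.

Lemma rdim_sum M : rdim M = (\sum_i dv M i)%N.
Proof.
rewrite -[LHS]card_ord -sum1_card.
under eq_bigr => p _ do rewrite -[1%N]/(nat_of_bool true) -(eqxx (rvert p)).
under [RHS]eq_bigr do rewrite dimvE.
rewrite exchange_big /=; apply: eq_bigr => p _.
by rewrite [RHS](bigD1 (rvert p)) //= big1 ?addn0 // => i; rewrite eq_sym => /negbTE ->.
Qed.

Lemma graded_inv M N (f : 'M[k]_(rdim M, rdim N)) g :
  graded f -> f *m g = 1%:M -> g *m f = 1%:M -> graded g.
Proof.
move=> gf fg gf1 i; rewrite -[vproj N i]mul1mx -gf1 -!mulmxA (mulmxA f) -gf.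
by rewrite -mulmxA fg mulmx1.
Qed.

Lemma iso_of_morph M N (f : 'M[k]_(rdim M, rdim N)) g :
  morph f -> f *m g = 1%:M -> g *m f = 1%:M -> rep_iso M N.
Proof.
case=> gf hf fg gf1; exists f, g; split=> //; split=> [|a]; first exact: graded_inv gf fg gf1.
by rewrite -[rmap N a]mul1mx -gf1 -!mulmxA (mulmxA f) -hf -mulmxA fg mulmx1.
Qed.

Lemma iso_of_free_full M N (f : 'M[k]_(rdim M, rdim N)) :
  morph f -> row_free f -> row_full f -> rep_iso M N.
Proof.
move=> mf fr fu; apply: (@iso_of_morph _ _ f (pinvmx f)) => //.
  exact: mulmxVp.
exact: mulVpmx.
Qed.
End HomDim.

(** * Extensions and direct sums *)

Section Extensions.
Variables (I A : finType) (s t : A -> I) (k : fieldType).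
Notation rp := (rep s t k).
Notation dv := Defs.dimv.
Implicit Types M N L X Y : rp.

Section Ext.
Variables (M N : rp) (g : A -> 'M[k]_(rdim M, rdim N)) (cg : cocycle g).

Definition ext_vert (p : 'I_(rdim M + rdim N)) : I :=
  match split p with inl q => rvert q | inr q => rvert q end.

Definition ext_map a : 'M[k]_(rdim M + rdim N) :=
  block_mx (rmap M a) (g a) 0 (rmap N a).

Lemma ext_graded a p q : ext_map a p q != 0 -> ext_vert p = s a /\ ext_vert q = t a.
Proof.
rewrite /ext_vert -[p]splitK -[q]splitK !unsplitK.
case: (split p) (split q) => [p' [] q'|p' [] q'] /=.
- by rewrite block_mxEul => /rmap_graded.
- by rewrite block_mxEur; move/cocycleP: cg => cg'; apply: cg'.
- by rewrite block_mxEdl mxE eqxx.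
- by rewrite block_mxEdr => /rmap_graded.
Qed.

(** Middle term of 0 -> N -> E -> M -> 0 with class [g]. Matrices act on row vectors, so N is the
    subobject and M the quotient; [ext_inl] and [ext_prr] are only graded, and [g] measures their
    failure to be morphisms. *)
Definition ext_rep : rp := Rep ext_graded.

Definition ext_inr : 'M[k]_(rdim N, rdim ext_rep) := row_mx 0 1%:M.
Definition ext_prl : 'M[k]_(rdim ext_rep, rdim M) := col_mx 1%:M 0.
Definition ext_inl : 'M[k]_(rdim M, rdim ext_rep) := row_mx 1%:M 0.
Definition ext_prr : 'M[k]_(rdim ext_rep, rdim N) := col_mx 0 1%:M.

Lemma ext_inl_prl : ext_inl *m ext_prl = 1%:M.
Proof. by rewrite mul_row_col !(mulmx0,mul0mx,mulmx1,mul1mx,addr0,add0r). Qed.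
Lemma ext_inr_prr : ext_inr *m ext_prr = 1%:M.
Proof. by rewrite mul_row_col !(mulmx0,mul0mx,mulmx1,mul1mx,addr0,add0r). Qed.
Lemma ext_inl_prr : ext_inl *m ext_prr = 0.
Proof. by rewrite mul_row_col !(mulmx0,mul0mx,mulmx1,mul1mx,addr0,add0r). Qed.
Lemma ext_inr_prl : ext_inr *m ext_prl = 0.
Proof. by rewrite mul_row_col !(mulmx0,mul0mx,mulmx1,mul1mx,addr0,add0r). Qed.
Lemma ext_pr_in : ext_prl *m ext_inl + ext_prr *m ext_inr = 1%:M.
Proof.
rewrite !mul_col_row add_block_mx !(mulmx0,mul0mx,mulmx1,mul1mx,addr0,add0r).
by rewrite -scalar_mx_block.
Qed.

Lemma vproj_ext i : vproj ext_rep i = block_mx (vproj M i) 0 0 (vproj N i).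
Proof.
apply/matrixP=> p q; rewrite -[p]splitK -[q]splitK.
case: (split p) (split q) => [p' [] q'|p' [] q'] /=.
- by rewrite block_mxEul !mxE /rvert /= /ext_vert (unsplitK (inl p')) (inj_eq (@lshift_inj _ _)).
- by rewrite block_mxEur !mxE eq_lrshift.
- by rewrite block_mxEdl !mxE eq_rlshift.
- by rewrite block_mxEdr !mxE /rvert /= /ext_vert (unsplitK (inr p')) (inj_eq (@rshift_inj _ _)).
Qed.

Lemma ext_inl_graded : graded ext_inl.
Proof. by move=> i; rewrite vproj_ext mul_mx_row mul_row_block !(mulmx0,mul0mx,mulmx1,mul1mx,addr0,add0r). Qed.
Lemma ext_inr_graded : graded ext_inr.
Proof. by move=> i; rewrite vproj_ext mul_mx_row mul_row_block !(mulmx0,mul0mx,mulmx1,mul1mx,addr0,add0r). Qed.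
Lemma ext_prl_graded : graded ext_prl.
Proof. by move=> i; rewrite vproj_ext /ext_prl /ext_prr mul_block_col mul_col_mx !(mulmx0,mul0mx,mulmx1,mul1mx,addr0,add0r). Qed.
Lemma ext_prr_graded : graded ext_prr.
Proof. by move=> i; rewrite vproj_ext /ext_prl /ext_prr mul_block_col mul_col_mx !(mulmx0,mul0mx,mulmx1,mul1mx,addr0,add0r). Qed.

Lemma ext_inr_morph : morph ext_inr.
Proof.
split=> [|a]; first exact: ext_inr_graded.
by rewrite /ext_inr /rmap /= mul_mx_row mul_row_block !(mulmx0,mul0mx,mulmx1,mul1mx,addr0,add0r).
Qed.
Lemma ext_prl_morph : morph ext_prl.
Proof.
split=> [|a]; first exact: ext_prl_graded.
by rewrite /ext_prl /rmap /= mul_block_col mul_col_mx !(mulmx0,mul0mx,mulmx1,mul1mx,addr0,add0r).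
Qed.
Lemma ext_inl_map a : ext_inl *m rmap ext_rep a = rmap M a *m ext_inl + g a *m ext_inr.
Proof.
rewrite /ext_inl /ext_inr /rmap /= !mul_mx_row mul_row_block add_row_mx.
by rewrite !(mulmx0,mul0mx,mulmx1,mul1mx) !(addr0,add0r).
Qed.
Lemma ext_map_prr a : rmap ext_rep a *m ext_prr = ext_prl *m g a + ext_prr *m rmap N a.
Proof.
rewrite /ext_prl /ext_prr /rmap /= mul_block_col !mul_col_mx add_col_mx.
by rewrite !(mulmx0,mul0mx,mulmx1,mul1mx,addr0,add0r).
Qed.

Lemma ext_pr0 X (f : 'M[k]_(rdim X, rdim ext_rep)) :
  f *m ext_prl = 0 -> f *m ext_prr = 0 -> f = 0.
Proof. by move=> fl fr; rewrite -[f]mulmx1 -ext_pr_in mulmxDr !mulmxA fl fr !mul0mx addr0. Qed.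

Lemma ext_in0 X (f : 'M[k]_(rdim ext_rep, rdim X)) :
  ext_inr *m f = 0 -> ext_inl *m f = 0 -> f = 0.
Proof. by move=> fl fr; rewrite -[f]mul1mx -ext_pr_in mulmxDl -!mulmxA fl fr !mulmx0 addr0. Qed.

Let prr_morph X (f : 'M[k]_(rdim X, rdim ext_rep)) :
  morph f -> f *m ext_prl = 0 -> morph (f *m ext_prr).
Proof.
case=> gf hf f0; split=> [|a]; first exact: gradedM ext_prr_graded.
by rewrite mulmxA hf -mulmxA ext_map_prr mulmxDr !mulmxA f0 mul0mx add0r.
Qed.

Let inl_morph X (f : 'M[k]_(rdim ext_rep, rdim X)) :
  morph f -> ext_inr *m f = 0 -> morph (ext_inl *m f).
Proof.
case=> gf hf f0; split=> [|a]; first exact: gradedM ext_inl_graded _.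
have -> : rmap M a *m (ext_inl *m f) = ext_inl *m rmap ext_rep a *m f.
  by rewrite ext_inl_map mulmxDl -!mulmxA f0 mulmx0 addr0.
by rewrite -mulmxA hf mulmxA.
Qed.

Lemma hom_ext_r X : (hom X ext_rep <= hom X M + hom X N)%N.
Proof.
apply: (@hom_le_add _ _ _ _ _ X ext_rep X M X N (mulmxr ext_prl) (mulmxr ext_prr)) => f mf /=.
- exact: morphM mf ext_prl_morph.
- exact: prr_morph.
- exact: ext_pr0.
Qed.

Lemma hom_ext_l X : (hom ext_rep X <= hom M X + hom N X)%N.
Proof.
rewrite addnC.
apply: (@hom_le_add _ _ _ _ _ ext_rep X N X M X (mulmx ext_inr) (mulmx ext_inl)) => f mf /=.
- exact: morphM ext_inr_morph mf.
- exact: inl_morph.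
- exact: ext_in0.
Qed.

(* If the identity of M lifted to the extension, the lift would split it. *)
Lemma hom_ext_nonsplit : ~ cobound g -> (hom M ext_rep < hom M M + hom M N)%N.
Proof.
move=> ng.
apply: (@hom_lt_add _ _ _ _ _ M ext_rep M M M N (mulmxr ext_prl) (mulmxr ext_prr)
  _ _ _ 1%:M) => [f mf|f mf|f mf||f mf] /=.
- exact: morphM mf ext_prl_morph.
- exact: prr_morph.
- exact: ext_pr0.
- exact: morph1.
move=> f1; apply: ng; exists (f *m ext_prr); first exact: gradedM mf.1 ext_prr_graded.
move=> a; rewrite mulmxA mf.2 -!mulmxA ext_map_prr mulmxDr !mulmxA f1 mul1mx.
by rewrite addrK.
Qed.

Lemma dimv_ext i : dv ext_rep i = (dv M i + dv N i)%N.
Proof. by rewrite !dimv_rank vproj_ext rank_diag_block_mx. Qed.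
End Ext.

Lemma cocycle0 M N : cocycle (fun=> 0 : 'M[k]_(rdim M, rdim N)).
Proof. by move=> a; rewrite mulmx0 mul0mx. Qed.

Definition dsum M N : rp := ext_rep (@cocycle0 M N).

Lemma dsum_inl_morph M N : morph (ext_inl (@cocycle0 M N)).
Proof.
split=> [|a]; first exact: ext_inl_graded.
by rewrite ext_inl_map mul0mx addr0.
Qed.
Lemma dsum_prr_morph M N : morph (ext_prr (@cocycle0 M N)).
Proof.
split=> [|a]; first exact: ext_prr_graded.
by rewrite ext_map_prr mulmx0 add0r.
Qed.

Lemma hom_dsum_r X M N : hom X (dsum M N) = (hom X M + hom X N)%N.
Proof.
apply/eqP; rewrite eqn_leq hom_ext_r /=.
apply: (@hom_ge_add _ _ _ _ _ X (dsum M N) X M X N (mulmxr (ext_prl (@cocycle0 M N)))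
   (fun f => f *m ext_inl (@cocycle0 M N)) (mulmxr (ext_inr (@cocycle0 M N)))) => f mf /=.
- by split; [exact: morphM mf (@dsum_inl_morph M N) | rewrite -mulmxA ext_inl_prl mulmx1].
- by split; [exact: morphM mf (ext_inr_morph _) | rewrite -mulmxA ext_inr_prl mulmx0].
- by move: mf => /= mf; rewrite -[f]mulmx1 -(ext_inr_prr (@cocycle0 M N)) mulmxA mf mul0mx.
Qed.

Lemma hom_dsum_l X M N : hom (dsum M N) X = (hom M X + hom N X)%N.
Proof.
apply/eqP; rewrite eqn_leq hom_ext_l /= addnC.
apply: (@hom_ge_add _ _ _ _ _ (dsum M N) X N X M X (mulmx (ext_inr (@cocycle0 M N)))
   (fun f => ext_prr (@cocycle0 M N) *m f) (mulmx (ext_prl (@cocycle0 M N)))) => f mf /=.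
- by split; [exact: morphM (@dsum_prr_morph M N) mf | rewrite mulmxA ext_inr_prr mul1mx].
- by split; [exact: morphM (ext_prl_morph _) mf | rewrite mulmxA ext_inr_prl mul0mx].
- by move: mf => /= mf; rewrite -[f]mul1mx -(ext_inl_prl (@cocycle0 M N)) -mulmxA mf mulmx0.
Qed.

Definition zero_map : A -> 'M[k]_0 := fun=> 0.
Lemma zero_graded (v : 'I_0 -> I) a p q : zero_map a p q != 0 -> v p = s a /\ v q = t a.
Proof. by case: p. Qed.
Definition zero_vert (p : 'I_0) : I := let: Ordinal _ h := p in False_rect I (notF h).
Definition zero_rep : rp := Rep (@zero_graded zero_vert).

Definition bigsum (l : seq rp) : rp := foldr dsum zero_rep l.

Lemma hom_rdim0 M N : (rdim M = 0 \/ rdim N = 0)%N -> hom M N = 0%N.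
Proof.
move=> H; apply/eqP; rewrite -leqn0 (leq_trans (rank_leq_col _)) //.
by case: H => ->; rewrite ?muln0.
Qed.

Lemma hom_bigsum_r X l : hom X (bigsum l) = (\sum_(M <- l) hom X M)%N.
Proof.
elim: l => [|M l IH]; first by rewrite big_nil hom_rdim0 //; right.
by rewrite big_cons -IH -hom_dsum_r.
Qed.

Lemma hom_bigsum_l X l : hom (bigsum l) X = (\sum_(M <- l) hom M X)%N.
Proof.
elim: l => [|M l IH]; first by rewrite big_nil hom_rdim0 //; left.
by rewrite big_cons -IH -hom_dsum_l.
Qed.

Lemma dimv_bigsum l i : dv (bigsum l) i = (\sum_(M <- l) dv M i)%N.
Proof.
elim: l => [|M l IH]; last by rewrite big_cons -IH; exact: dimv_ext.
by rewrite big_nil dimvE /= big_ord0.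
Qed.
End Extensions.

(** * Subrepresentations and indecomposables *)

Section Subreps.
Variables (I A : finType) (s t : A -> I) (k : fieldType).
Notation rp := (rep s t k).
Notation dv := Defs.dimv.
Implicit Types M N L X Y : rp.

Lemma sub_vprojP M i m (v : 'M[k]_(m, rdim M)) : (v <= vproj M i)%MS -> v *m vproj M i = v.
Proof. by case/submxP=> w ->; rewrite -mulmxA vproj_idem. Qed.

(** A subspace is the sum of its vertex parts exactly when the vertex idempotents preserve it; this
    form is stable under images and kernels. *)
Lemma subrepP M (U : 'M[k]_(rdim M)) :
  subrep U <-> (forall i, (U *m vproj M i <= U)%MS) /\ forall a, (U *m rmap M a <= U)%MS.
Proof.
rewrite /subrep; split=> [/andP[/andP[e _] /forallP]|[H1 H2]].
  split=> // i; apply: submx_trans (submxMr _ e) _; rewrite sumsmxMr.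
  apply/sumsmx_subP=> j _; have [->|ij] := eqVneq j i.
    by rewrite sub_vprojP ?capmxSr // capmxSl.
  have /submxP[w ->] := capmxSr U (vproj M j).
  by rewrite -mulmxA vproj_orth // mulmx0 sub0mx.
apply/andP; split; last exact/forallP.
apply/andP; split; last by apply/sumsmx_subP=> i _; exact: capmxSl.
rewrite -{1}[U]mulmx1 -vproj_sum mulmx_sumr; apply: summx_sub => i _.
by rewrite (sumsmx_sup i) // sub_capmx H1 submxMl.
Qed.

Lemma subrep_image L M (f : 'M[k]_(rdim L, rdim M)) : morph f -> subrep <<f>>%MS.
Proof.
case=> gf hf; apply/subrepP; split=> [i|a]; rewrite genmxE.
  by rewrite (eqmxMr _ (genmxE f)) -gf submxMl.
by rewrite (eqmxMr _ (genmxE f)) -hf submxMl.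
Qed.

Lemma subrep_ker M N (f : 'M[k]_(rdim M, rdim N)) : morph f -> subrep (kermx f).
Proof.
case=> gf hf; apply/subrepP; split=> [i|a]; apply/sub_kermxP.
  by rewrite -mulmxA gf mulmxA mulmx_ker mul0mx.
by rewrite -mulmxA hf mulmxA mulmx_ker mul0mx.
Qed.

Section SubRep.
Variables (M : rp) (U : 'M[k]_(rdim M)).
Hypothesis sU : subrep U.

Let r i := \rank (U :&: vproj M i)%MS.
Let B i := row_base (U :&: vproj M i)%MS.
Let T := {i : I & 'I_(r i)}.
Let vert (p : 'I_#|{: T}|) : I := tag (enum_val p).
Let j : 'M[k]_(#|{: T}|, rdim M) :=
  \matrix_p row (tagged (enum_val p)) (B (tag (enum_val p))).

Let BU i : (B i <= U)%MS.
Proof. by rewrite eq_row_base capmxSl. Qed.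
Let Be i : B i *m vproj M i = B i.
Proof. by rewrite sub_vprojP // eq_row_base capmxSr. Qed.

Let jsum (c : 'rV[k]_#|{: T}|) :
  c *m j = \sum_i (\row_(q < r i) c 0 (enum_rank (Tagged (fun i => 'I_(r i)) q))) *m B i.
Proof.
rewrite mulmx_sum_row (reindex (@enum_rank _)) /=; last exact/onW_bij/enum_rank_bij.
under [RHS]eq_bigr do rewrite mulmx_sum_row.
rewrite (sig_big_dep _ (fun i q => true)) /=; apply: eq_bigr => -[i q] _.
by rewrite rowK enum_rankK mxE.
Qed.

Let j_free : row_free j.
Proof.
rewrite -kermx_eq0; apply/eqP/row_matrixP=> i; rewrite row0.
have := row_sub i (kermx j); move: (row i _) => c /sub_kermxP.
rewrite jsum => c0; apply/rowP=> p; rewrite mxE -[p]enum_valK.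
case: (enum_val p) => i0 q; have /(congr1 (mulmx^~ (vproj M i0))) := c0.
rewrite mulmx_suml mul0mx (bigD1 i0) //= big1 ?addr0 => [|i' ni].
  rewrite -mulmxA Be => /eqP; rewrite -sub_kermx.
  have /eqP-> : kermx (B i0) == 0 by rewrite kermx_eq0 row_base_free.
  by rewrite submx0 => /eqP/rowP/(_ q); rewrite !mxE.
by rewrite -(Be i') -!mulmxA vproj_orth // !mulmx0.
Qed.

Let j_eq : (j :=: U)%MS.
Proof.
apply/eqmxP/andP; split.
  by apply/row_subP=> p; rewrite rowK (submx_trans (row_sub _ _)).
case/andP: sU => /andP[e _] _; apply: submx_trans e _.
apply/sumsmx_subP=> i _; rewrite -(eq_row_base (U :&: _)%MS).
apply/row_subP=> q; have -> : row q (row_base (U :&: vproj M i)%MS)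
    = row (enum_rank (Tagged (fun i => 'I_(r i)) q)) j by rewrite rowK enum_rankK.
exact: row_sub.
Qed.

(** Every basis vector of a representation sits at a vertex, so the basis of U is assembled from
    bases [B i] of its vertex parts. The arrows are carried back through a one-sided inverse of the
    inclusion [j]. *)
Lemma subrep_rep : exists L (f : 'M[k]_(rdim L, rdim M)),
  [/\ morph f, row_free f & (f :=: U)%MS].
Proof.
pose x a := j *m rmap M a *m pinvmx j.
have xj a : x a *m j = j *m rmap M a.
  rewrite mulmxKpV // j_eq (submx_trans (submxMr _ (_ : (j <= U)%MS))) ?j_eq //.
  by case/subrepP: sU => _; apply.
have je p i : row p j *m vproj M i = if vert p == i then row p j else 0.
  rewrite rowK /vert; case: (enum_val p) => i0 q /=; rewrite -row_mul.
  case: eqP => [<-|/eqP ni]; first by rewrite Be.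
  by rewrite -(Be i0) -mulmxA vproj_orth // mulmx0 row0.
(* An auxiliary representation with zero arrows gives access to the vertex idempotents before the
   arrows [x] are known to be graded. *)
have z a p q : (fun=> 0 : 'M[k]_#|{: T}|) a p q != 0 -> vert p = s a /\ vert q = t a.
  by rewrite mxE eqxx.
pose L0 : rp := Rep z; pose e i : 'M[k]_#|{: T}| := vproj L0 i.
have ej i : e i *m j = j *m vproj M i.
  apply/row_matrixP=> p; rewrite (row_mul p j) je; apply/rowP=> q.
  by rewrite mxE (@vproj_mulE _ _ _ _ _ L0); case: ifP; rewrite !mxE.
have gx a p q : x a p q != 0 -> vert p = s a /\ vert q = t a.
  have ex : e (s a) *m x a *m e (t a) = x a.
    apply: (row_free_inj j_free); rewrite -mulmxA ej mulmxA -(mulmxA _ _ j) xj.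
    by rewrite !mulmxA ej -!mulmxA rmap_vproj mulmxA -(mulmxA j) vproj_rmap.
  rewrite -ex (@mul_vprojE _ _ _ _ _ L0) (@vproj_mulE _ _ _ _ _ L0).
  rewrite /L0 /rvert /= -/vert.
  by case: (vert q =P t a) => [->|_]; case: (vert p =P s a) => [->|_]; rewrite ?eqxx.
by exists (Rep gx), j; split=> //; split=> [i|a]; rewrite -?xj //; exact: ej.
Qed.
End SubRep.

Definition indec M := rdim M <> 0%N /\
  ~ exists U U' : 'M[k]_(rdim M), [/\ subrep U, subrep U', (U + U' == 1%:M)%MS,
      \rank (U :&: U')%MS = 0%N & \rank U <> 0%N /\ \rank U' <> 0%N].

Lemma subrep_decomp M (U U' : 'M[k]_(rdim M)) : subrep U -> subrep U' ->
  (U + U' == 1%:M)%MS -> \rank (U :&: U')%MS = 0%N ->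
  exists L L', [/\ rdim L = \rank U, rdim L' = \rank U' & rep_iso (dsum L L') M].
Proof.
move=> sU sU' sum cap.
have [L [f [mf ff fU]]] := subrep_rep sU; have [L' [f' [mf' ff' fU']]] := subrep_rep sU'.
have rL : rdim L = \rank U by rewrite -fU; apply/esym/eqP.
have rL' : rdim L' = \rank U' by rewrite -fU'; apply/esym/eqP.
exists L, L'; split=> //.
pose h : 'M[k]_(rdim (dsum L L'), rdim M) := ext_prl (cocycle0 L L') *m f + ext_prr (cocycle0 L L') *m f'.
have hE : h = col_mx f f' :> 'M_(rdim L + rdim L', rdim M).
  by rewrite /h /ext_prl /ext_prr !mul_col_mx add_col_mx !(mulmx0,mul0mx,mulmx1,mul1mx) !(addr0,add0r).
have mh : morph h.
  by apply: morphD; apply: morphM => //; [exact: ext_prl_morph | exact: dsum_prr_morph].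
have rk : \rank (col_mx f f') = (rdim L + rdim L')%N.
  by rewrite -addsmxE (adds_eqmx fU fU') [RHS](f_equal2 addn rL rL') -mxrank_sum_cap cap addn0.
have rn : \rank (col_mx f f') = rdim M.
  by rewrite -addsmxE (adds_eqmx fU fU') (eqmxP sum) mxrank1.
apply: (iso_of_free_full mh); first by rewrite /row_free hE; apply/eqP.
by rewrite /row_full hE; apply/eqP.
Qed.

(** The two projections assemble into a morphism, and the inverse of a bijective morphism is
    automatically a morphism. *)
Lemma biproduct_iso E L N (i1 : 'M[k]_(rdim L, rdim E)) (p1 : 'M[k]_(rdim E, rdim L))
    (i2 : 'M[k]_(rdim N, rdim E)) (p2 : 'M[k]_(rdim E, rdim N)) :
  morph p1 -> morph p2 ->
  i1 *m p1 = 1%:M -> i2 *m p2 = 1%:M -> i1 *m p2 = 0 -> i2 *m p1 = 0 ->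
  p1 *m i1 + p2 *m i2 = 1%:M -> rep_iso E (dsum L N).
Proof.
move=> m1 m2 e11 e22 e12 e21 es; pose c := cocycle0 L N.
apply: (@iso_of_morph _ _ _ _ _ _ _ (p1 *m ext_inl c + p2 *m ext_inr c)
  (ext_prl c *m i1 + ext_prr c *m i2)).
- by apply: morphD; apply: morphM => //; [exact: dsum_inl_morph | exact: ext_inr_morph].
- rewrite mulmxDl !mulmxDr !mulmxA -!(mulmxA p1) -!(mulmxA p2).
  by rewrite ext_inl_prl ext_inl_prr ext_inr_prl ext_inr_prr !(mulmx0,mul0mx,mulmx1,mul1mx) !(addr0,add0r).
rewrite mulmxDl !mulmxDr !mulmxA -!(mulmxA (ext_prl c)) -!(mulmxA (ext_prr c)).
by rewrite e11 e12 e21 e22 !(mulmx0,mul0mx,mulmx1,mul1mx) !(addr0,add0r) ext_pr_in.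
Qed.

Lemma dsum_iso L L' N N' : rep_iso L L' -> rep_iso N N' -> rep_iso (dsum L N) (dsum L' N').
Proof.
case=> f [g [mf mg fg gf]] [f' [g' [mf' mg' fg' gf']]].
pose c := cocycle0 L N.
apply: (@biproduct_iso _ _ _ (g *m ext_inl c) (ext_prl c *m f) (g' *m ext_inr c) (ext_prr c *m f')).
- exact: morphM (ext_prl_morph _) mf.
- exact: morphM (dsum_prr_morph _ _) mf'.
- by rewrite mulmxA -(mulmxA g) ext_inl_prl mulmx1.
- by rewrite mulmxA -(mulmxA g') ext_inr_prr mulmx1.
- by rewrite mulmxA -(mulmxA g) ext_inl_prr mulmx0 mul0mx.
- by rewrite mulmxA -(mulmxA g') ext_inr_prl mulmx0 mul0mx.
rewrite !mulmxA -(mulmxA _ f) fg mulmx1 -(mulmxA _ f') fg' mulmx1; exact: ext_pr_in.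
Qed.

Lemma dsum_assoc L M N : rep_iso (dsum (dsum L M) N) (dsum L (dsum M N)).
Proof.
pose c := cocycle0 (dsum L M) N; pose d := cocycle0 L M; pose e := cocycle0 M N.
have sub : (@ext_inl _ _ _ _ _ _ _ _ c *m ext_prl c = 1%:M) /\ (ext_inl c *m ext_prr c = 0) /\
   (ext_inr c *m ext_prl c = 0) /\ (ext_inr c *m ext_prr c = 1%:M).
  by rewrite ext_inl_prl ext_inl_prr ext_inr_prl ext_inr_prr.
case: sub => c11 [c12 [c21 c22]].
have [d11 d12 d21 d22] : [/\ ext_inl d *m ext_prl d = 1%:M, ext_inl d *m ext_prr d = 0,
   ext_inr d *m ext_prl d = 0 & ext_inr d *m ext_prr d = 1%:M].
  by rewrite ext_inl_prl ext_inl_prr ext_inr_prl ext_inr_prr.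
have [e11 e12 e21 e22] : [/\ ext_inl e *m ext_prl e = 1%:M, ext_inl e *m ext_prr e = 0,
   ext_inr e *m ext_prl e = 0 & ext_inr e *m ext_prr e = 1%:M].
  by rewrite ext_inl_prl ext_inl_prr ext_inr_prl ext_inr_prr.
have cs := ext_pr_in c; have ds := ext_pr_in d; have es := ext_pr_in e.
have := dsum_inl_morph (dsum L M) N; have := dsum_prr_morph (dsum L M) N.
have := ext_prl_morph c; have := ext_inr_morph c.
have := dsum_inl_morph M N; have := dsum_prr_morph M N.
have := ext_prl_morph e; have := ext_inr_morph e.
have := dsum_inl_morph L M; have := dsum_prr_morph L M.
have := ext_prl_morph d; have := ext_inr_morph d.
rewrite -/c -/d -/e in cs ds es *.
(* With the structure maps generalized, only the biproduct identities remain and the calculation is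
   purely formal. *)
move: (ext_inl c) (ext_prl c) (ext_inr c) (ext_prr c) c11 c12 c21 c22 cs => il pl ir pr c11 c12 c21 c22 cs.
move: (ext_inl d) (ext_prl d) (ext_inr d) (ext_prr d) d11 d12 d21 d22 ds => jl ql jr qr d11 d12 d21 d22 ds.
move: (ext_inl e) (ext_prl e) (ext_inr e) (ext_prr e) e11 e12 e21 e22 es => kl rl kr rr e11 e12 e21 e22 es.
move=> mjr mql mqr mjl mkr mrl mrr mkl mir mpl mpr mil.
apply: (@biproduct_iso (dsum (dsum L M) N) L (dsum M N) (jl *m il) (pl *m ql)
  (rl *m jr *m il + rr *m ir) (pl *m qr *m kl + pr *m kr)).
- exact: morphM.
- by apply: morphD; do ?apply: morphM.
- by rewrite mulmxA -(mulmxA jl) c11 mulmx1.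
- rewrite mulmxDl !mulmxDr !mulmxA -!(mulmxA _ il) -!(mulmxA _ ir) c11 c12 c21 c22.
  by rewrite !mulmx0 !mul0mx !mulmx1 -(mulmxA rl) d22 mulmx1 addr0 add0r.
- by rewrite mulmxDr !mulmxA -!(mulmxA _ il) c11 c12 mulmx1 d12 mulmx0 !mul0mx addr0.
- by rewrite mulmxDl !mulmxA -!(mulmxA _ il) -!(mulmxA _ ir) c11 c21 mulmx1 -(mulmxA rl) d21 !(mulmx0,mul0mx) !(addr0,add0r).
rewrite mulmxDl !mulmxDr !mulmxA -!(mulmxA _ kl) -!(mulmxA _ kr) e11 e12 e21 e22.
rewrite !(mulmx0,mul0mx,mulmx1,mul1mx) !(addr0,add0r) addrA -!(mulmxA pl) -mulmxDr -mulmxDl.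
by rewrite ds mul1mx.
Qed.

Lemma rdim_iso M N : rep_iso M N -> rdim M = rdim N.
Proof. by move=> i; rewrite !rdim_sum; apply: eq_bigr => j _; exact: dimv_iso. Qed.

Lemma rep_iso_rdim0 M N : rdim M = 0%N -> rdim N = 0%N -> rep_iso M N.
Proof.
move=> M0 N0; exists 0, 0; split; try exact: morph0.
  by apply/matrixP=> -[p hp]; move: (hp); rewrite M0.
by apply/matrixP=> -[p hp]; move: (hp); rewrite N0.
Qed.

Lemma dsum0l N L : rdim L = 0%N -> rep_iso N (dsum L N).
Proof.
move=> L0; apply: (@biproduct_iso N L N 0 0 1%:M 1%:M); rewrite ?mulmx1 ?mul0mx ?mulmx0 ?add0r //.
- exact: morph0.
- exact: morph1.
- by apply/matrixP=> -[p hp]; move: (hp); rewrite L0.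
Qed.

Lemma bigsum_cat (l l' : seq rp) : rep_iso (dsum (bigsum l) (bigsum l')) (bigsum (l ++ l')).
Proof.
elim: l => [|M l IH] /=; first exact/rep_iso_sym/dsum0l.
exact: rep_iso_trans (dsum_assoc _ _ _) (dsum_iso (rep_iso_refl _) IH).
Qed.

(** Induction on the dimension. Since [rep] is not an [eqType], membership in lists of
    representations is [List.In] and rearrangement is [Permutation]. *)
Lemma krull_decomp M : exists l : seq rp,
  (forall L, List.In L l -> indec L) /\ rep_iso M (bigsum l).
Proof.
have [n le] := ubnP (rdim M); elim: n M le => // n IH M le.
have [M0|M0] := eqVneq (rdim M) 0%N.
  by exists [::]; split=> //; exact: rep_iso_rdim0.
have [iM|nM] := EM (indec M).
  exists [:: M]; split=> [L [<-|//] //|] /=.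
  apply: (@biproduct_iso M M (zero_rep s t k) 1%:M 1%:M 0 0); rewrite ?mulmx1 ?mul0mx ?mulmx0 ?addr0 //.
  - exact: morph1.
  - exact: morph0.
  - by apply/matrixP=> -[].
have [U [U' [sU sU' sum cap [rU rU']]]] : exists U U' : 'M[k]_(rdim M),
   [/\ subrep U, subrep U', (U + U' == 1%:M)%MS,
      \rank (U :&: U')%MS = 0%N & \rank U <> 0%N /\ \rank U' <> 0%N].
  by apply: contrapT => H; apply: nM; split=> //; apply/eqP.
have [L [L' [rL rL' iso]]] := subrep_decomp sU sU' sum cap.
have tot : rdim M = (rdim L + rdim L')%N by rewrite -(rdim_iso iso).
have [l [il sl]] : exists l : seq rp, (forall L, List.In L l -> indec L) /\ rep_iso L (bigsum l).
  by apply: IH; lia.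
have [l' [il' sl']] : exists l : seq rp, (forall L, List.In L l -> indec L) /\ rep_iso L' (bigsum l).
  by apply: IH; lia.
exists (l ++ l'); split=> [N /List.in_app_iff[]|]; [exact: il | exact: il' |].
apply: rep_iso_trans (rep_iso_sym iso) _.
exact: rep_iso_trans (dsum_iso sl sl') (bigsum_cat _ _).
Qed.

(** The image of [i] and the kernel of [p] are complementary subrepresentations, and the two
    dimension conditions make both nonzero. *)
Lemma indec_split L M (i : 'M[k]_(rdim L, rdim M)) (p : 'M[k]_(rdim M, rdim L)) :
  morph i -> morph p -> i *m p = 1%:M -> rdim L <> 0%N -> (rdim L < rdim M)%N -> ~ indec M.
Proof.
move=> mi mp ip L0 LM [_]; apply; exists <<i>>%MS, (kermx p).
have ri : \rank i = rdim L by apply/eqP; apply/row_freeP; exists p.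
have rp : \rank p = rdim L by apply/eqP; apply/row_fullP; exists i.
have rk := mxrank_ker p; rewrite rp in rk.
have cap : \rank (<<i>> :&: kermx p)%MS = 0%N.
  have := mxrank_mul_ker i p; rewrite ip mxrank1 ri (cap_eqmx (genmxE i) (eqmx_refl _)); lia.
split=> //; [exact: subrep_image | exact: subrep_ker | |].
  rewrite -[(_ == _)%MS]/((_ <= _)%MS && (_ <= _)%MS) submx1 /= -mxrank_leqif_sup ?submx1 //.
  by have := mxrank_sum_cap <<i>>%MS (kermx p); rewrite cap mxrank_gen ri rk mxrank1; lia.
by rewrite mxrank_gen ri rk; split=> //; lia.
Qed.
End Subreps.

(** * Indecomposables are bricks *)

Section Brick.
Variables (I A : finType) (s t : A -> I) (k : closedFieldType).
Notation rp := (rep s t k).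
Notation dv := Defs.dimv.
Implicit Types M N L X Y : rp.

Hypothesis tits_pos : forall d : I -> nat, (exists i, d i <> 0%N) ->
  (\sum_a d (s a) * d (t a) < \sum_i d i * d i)%N.

Lemma tits_pos_rep M : rdim M <> 0%N ->
  (\sum_a dv M (s a) * dv M (t a) < \sum_i dv M i * dv M i)%N.
Proof.
move=> M0; apply: tits_pos; apply: contrapT => H; apply: M0.
rewrite rdim_sum big1 // => i _; apply: contrapT => H'; apply: H; by exists i.
Qed.

Definition brick M := rdim M <> 0%N /\
  forall f : 'M[k]_(rdim M), morph (f : 'M_(rdim M, rdim M)) -> exists c, f = c%:M.

Lemma scalar1_neq0 n : n <> 0%N -> (1%:M : 'M[k]_n) != 0.
Proof. by case: n => // n _; rewrite -mxrank_eq0 mxrank1. Qed.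

Lemma hom_gt0 M N (f : 'M[k]_(rdim M, rdim N)) : morph f -> f != 0 -> (0 < hom M N)%N.
Proof.
move=> /mem_hom mf f0; rewrite lt0n mxrank_eq0; apply: contra f0 => /eqP H.
by rewrite H submx0 in mf; rewrite -[f]mxvecK (eqP mf) linear0.
Qed.

Lemma brick_hom M : brick M -> hom M M = 1%N.
Proof.
case=> M0 bM; apply/eqP; rewrite eqn_leq; apply/andP; split; last first.
  exact: hom_gt0 (morph1 M) (scalar1_neq0 M0).
apply: leq_trans (rank_leq_row (mxvec (1%:M : 'M[k]_(rdim M)))).
apply: mxrankS; apply/row_subP=> i; have /mem_homE/bM[c vE] := row_sub i (homS M M).
rewrite -[row i _]vec_mxK vE -[c%:M]scalemx1 linearZ /=.
by apply: scalemx_sub; exact: submx_refl.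
Qed.

(** The Tits form of the dimension is 1 - dim Ext^1 for a brick, and it is at least 1. *)
Lemma brick_rigid M : brick M -> dim_ext1 M M = 0%N.
Proof.
move=> bM; have := euler_form M M; rewrite brick_hom //.
have := tits_pos_rep bM.1; lia.
Qed.

Lemma bigsum_component M l (f : 'M[k]_(rdim M, rdim (bigsum l))) : morph f -> f != 0 ->
  exists L (b : 'M[k]_(rdim L, rdim (bigsum l))) (a : 'M[k]_(rdim (bigsum l), rdim L)),
    [/\ List.In L l, morph b, morph a, b *m a = 1%:M & f *m a != 0].
Proof.
elim: l f => [|N l IH] f mf f0.
  by case/negP: f0; apply/eqP/matrixP => p [].
have [fl|fl] := eqVneq (f *m ext_prl (cocycle0 N (bigsum l))) 0; last first.
  exists N, (ext_inl _), (ext_prl (cocycle0 N (bigsum l))); split=> //; first by left.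
  - exact: dsum_inl_morph.
  - exact: ext_prl_morph.
  - exact: ext_inl_prl.
have fr : f *m ext_prr (cocycle0 N (bigsum l)) != 0.
  by apply: contra f0 => /eqP fr; apply/eqP; exact: ext_pr0 fl fr.
have [L [b [a [Ll mb ma ba fa]]]] := IH _ (morphM mf (dsum_prr_morph _ _)) fr.
exists L, (b *m ext_inr _), (ext_prr (cocycle0 N (bigsum l)) *m a); split.
- by right.
- exact: morphM mb (ext_inr_morph _).
- exact: morphM (dsum_prr_morph _ _) ma.
- by rewrite mulmxA -(mulmxA b) ext_inr_prr mulmx1.
- by rewrite mulmxA.
Qed.

(* If an indecomposable M has a nonzero singular endomorphism, take one, phi, of minimal rank;
   then phi^2 = 0 and the kernel K of phi has an indecomposable summand L on which the
   image of phi projects injectively. By induction L is a brick, hence rigid, so that the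
   projection K -> L extends to M and L splits off from M. *)
Section Ringel.
Variables (M : rp) (iM : indec M).
Hypothesis IH : forall L, (rdim L < rdim M)%N -> indec L -> brick L.
Variables (phi : 'M[k]_(rdim M, rdim M)).
Hypotheses (mphi : morph phi) (phi0 : phi != 0) (phiS : (\rank phi < rdim M)%N).
Hypothesis phi_min : forall f : 'M[k]_(rdim M, rdim M), morph f -> f != 0 ->
  (\rank f < rdim M)%N -> (\rank phi <= \rank f)%N.

(** If phi^2 were nonzero, minimality would give it the rank of [phi]; the image of [phi] would then
    meet its kernel trivially and M would decompose. *)
Lemma minimal_endo_sqr : phi *m phi = 0.
Proof.
apply/eqP; apply: contraT => n0; exfalso.
have le : (\rank (phi *m phi) <= \rank phi)%N by exact: mxrankM_maxl.
have ge := phi_min (morphM mphi mphi) n0 (leq_ltn_trans le phiS).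
have := mxrank_mul_ker phi phi => rk.
have cap : \rank (phi :&: kermx phi)%MS = 0%N by lia.
have rp : \rank phi <> 0%N by apply/eqP; rewrite mxrank_eq0.
have rK := mxrank_ker phi.
case: iM => _; apply; exists <<phi>>%MS, (kermx phi).
have cap' : \rank (<<phi>> :&: kermx phi)%MS = 0%N.
  by rewrite (cap_eqmx (genmxE phi) (eqmx_refl _)).
split=> //; [exact: subrep_image | exact: subrep_ker | |].
  rewrite -[(_ == _)%MS]/((_ <= _)%MS && (_ <= _)%MS) submx1 /= -mxrank_leqif_sup ?submx1 //.
  by have := mxrank_sum_cap <<phi>>%MS (kermx phi); rewrite cap' mxrank_gen rK mxrank1; lia.
by rewrite mxrank_gen rK; split=> //; lia.
Qed.

Lemma minimal_endo_false : False.
Proof.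
have phi2 := minimal_endo_sqr.
have [K [j [mj fj jK]]] := subrep_rep (subrep_ker mphi).
have j0 : j *m phi = 0 by apply/sub_kermxP; rewrite jK.
have rK : rdim K = (rdim M - \rank phi)%N by rewrite -mxrank_ker -jK; apply/esym/eqP.
have rp : \rank phi <> 0%N by apply/eqP; rewrite mxrank_eq0.
(* Since phi^2 = 0, [phi] takes its values in K; this is its corestriction. *)
pose phi' := phi *m pinvmx j.
have phi'j : phi' *m j = phi.
  by rewrite mulmxKpV // jK; apply/sub_kermxP.
have mphi' : morph phi'.
  split=> [i|a]; apply: (row_free_inj fj).
    by rewrite -mulmxA phi'j -mulmxA mj.1 mulmxA phi'j mphi.1.
  by rewrite -mulmxA phi'j -mulmxA mj.2 mulmxA phi'j mphi.2.
have [l [il [u [v [mu mv uv vu]]]]] := krull_decomp K.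
have phi'u0 : phi' *m u != 0.
  apply: contra phi0 => /eqP H; rewrite -phi'j -[phi']mulmx1 -uv !mulmxA H.
  by rewrite !mul0mx.
have [L [b [a [Ll mb ma ba pa]]]] := bigsum_component (morphM mphi' mu) phi'u0.
pose bK := b *m v; pose aL := u *m a.
have mbK : morph bK by exact: morphM.
have maL : morph aL by exact: morphM.
have baL : bK *m aL = 1%:M by rewrite mulmxA -(mulmxA b) vu mulmx1.
have LK : (rdim L <= rdim K)%N.
  have := mxrank1 k (rdim L); rewrite -baL => <-.
  by apply: leq_trans (mxrankM_maxl _ _) (rank_leq_col _).
have bL : brick L by apply: IH (il _ Ll); lia.
pose psi := phi' *m aL.
have mpsi : morph psi by exact: morphM.
have psi0 : psi != 0 by rewrite /psi mulmxA.
have bKf : row_free bK by apply/row_freeP; exists aL.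
(* Following [psi] by L -> K -> M gives a nonzero singular endomorphism, so minimality applies to
   it. Therefore [psi] has the same kernel as [phi], namely K. *)
have rpsi : (\rank phi <= \rank psi)%N.
  have m1 : morph (psi *m (bK *m j)) by do 2!apply: morphM => //.
  have r1 : \rank (psi *m (bK *m j)) = \rank psi.
    by rewrite mulmxA (mxrankMfree _ fj) (mxrankMfree _ bKf).
  rewrite -r1; apply: phi_min => //; first by rewrite -mxrank_eq0 r1 mxrank_eq0.
  rewrite r1 (leq_ltn_trans (mxrankM_maxl _ _)) // -(mxrankMfree _ fj) phi'j //.
have kpsi : (kermx psi <= j)%MS.
  have sub : (kermx phi <= kermx psi)%MS.
    apply/sub_kermxP; rewrite mulmxA; have -> : kermx phi *m phi' = 0; last by rewrite mul0mx.
    by apply: (row_free_inj fj); rewrite -mulmxA phi'j mulmx_ker mul0mx.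
  rewrite jK; have := mxrank_leqif_sup sub; rewrite /leqif => -[_ <-].
  rewrite !mxrank_ker; apply/eqP; have := mxrankS sub; rewrite !mxrank_ker; lia.
(* A degree-zero extension of K -> L to M. Its failure [g] to be a morphism vanishes on K, so it
   factors through [psi]. *)
pose f0 := gproj (pinvmx j *m aL : 'M_(rdim M, rdim L)).
have jf0 : j *m f0 = aL.
  by rewrite (gproj_mull _ mj.1) mulmxA mulmxVp // mul1mx gproj_id //; case: maL.
have gf0 : graded f0 by exact: gproj_graded.
pose g x := f0 *m rmap L x - rmap M x *m f0.
have jg x : j *m g x = 0.
  by rewrite mulmxBr !mulmxA jf0 -maL.2 -mj.2 -(mulmxA _ j) jf0 subrr.
have psig x : psi *m (pinvmx psi *m g x) = g x.
  apply/eqP; rewrite -subr_eq0 mulmxA -{2}[g x]mul1mx -mulmxBl; apply/eqP.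
  have : (psi *m pinvmx psi - 1%:M <= j)%MS.
    apply: submx_trans kpsi; apply/sub_kermxP.
    by rewrite mulmxBl mulmxKpV ?submx_refl // mul1mx subrr.
  by case/submxP=> w ->; rewrite -mulmxA jg mulmx0.
have cg : cocycle (fun x => - g x).
  by move=> x; rewrite /g opprB; exact: cocycle_delta.
(* The obstruction, an extension class of psi(M) by L, is lifted to a class of L by L: here one only
   has to extend a matrix and restore its degree. Rigidity of L makes [h] a coboundary, and
   [psi *m f'] corrects [f0] into a morphism. *)
pose h x := vproj L (s x) *m (pinvmx psi *m g x) *m vproj L (t x).
have psih x : psi *m h x = g x.
  rewrite /h !mulmxA -mpsi.1 -!mulmxA; have := cg x.
  by rewrite mulmxN mulNmx => /oppr_inj; rewrite -{1}psig !mulmxA.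
have [f' gf' hf'] : cobound h by apply/(ext0P L L).1 => //; [exact: brick_rigid | exact: cocycle_proj].
pose rho := f0 + psi *m f'.
have mrho : morph rho.
  split=> [|x]; first by apply: gradedD => //; apply: gradedM => //; exact: mpsi.1.
  rewrite mulmxDr mulmxDl mulmxA mpsi.2.
  have -> : rmap M x *m f0 = f0 *m rmap L x - psi *m h x by rewrite psih /g subKr.
  by rewrite hf' mulmxBr !mulmxA opprB addrA subrK.
have brho : (bK *m j) *m rho = 1%:M.
  have jr : j *m rho = aL by rewrite mulmxDr jf0 /psi !mulmxA j0 !mul0mx addr0.
  by rewrite -(mulmxA bK j) jr.
apply: (indec_split (morphM mbK mj) mrho brho bL.1 _ iM).
by lia.
Qed.
End Ringel.

Theorem indec_brick M : indec M -> brick M.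
Proof.
have [n le] := ubnP (rdim M); elim: n M le => // n IH M le iM.
split=> [|f mf]; first by case: iM.
have IH' L : (rdim L < rdim M)%N -> indec L -> brick L by move=> ?; apply: IH; lia.
have n0 : (0 < rdim M)%N by case: iM => /eqP; rewrite lt0n.
(* Subtracting an eigenvalue makes the endomorphism singular. If the difference is nonzero, a
   nonzero singular endomorphism of minimal rank exists, which is impossible. *)
have [c rc] : exists c, root (char_poly f) c.
  by apply/closed_rootP; rewrite size_char_poly; lia.
pose phi := f - c%:M.
have mphi : morph (phi : 'M_(rdim M, rdim M)).
  rewrite /phi -scalemx1 -scaleNr; apply: morphD => //; apply: morphZ; exact: morph1.
have phiS : (\rank phi < rdim M)%N.
  move: rc; rewrite -eigenvalue_root_char /eigenvalue /eigenspace -mxrank_eq0 mxrank_ker -lt0n -/phi.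
  by rewrite subn_gt0.
have [/eqP|p0] := eqVneq phi 0; first by rewrite subr_eq0 => /eqP; exists c.
pose P r := exists f : 'M[k]_(rdim M, rdim M),
  [/\ morph f, f != 0, (\rank f < rdim M)%N & \rank f = r].
have [r [[g [mg g0 gS gr]] min]] : exists r, P r /\ forall r', P r' -> (r <= r')%N.
  have exP : exists r, `[< P r >] by exists (\rank phi); apply/asboolP; exists phi.
  exists (ex_minn exP); case: ex_minnP => m /asboolP Pm H; split=> // r' Pr'.
  by apply: H; apply/asboolP.
exfalso; apply: (@minimal_endo_false M iM IH' g mg g0 gS) => h mh h0 hS.
by rewrite gr; apply: min; exists h.
Qed.
End Brick.

(** * Rigid representations are determined by their dimension *)

(** If p is not constant, a root of p - 1 is a point where p takes the value 1. *)
Lemma closed_field_nonroot (k : closedFieldType) (p : {poly k}) : p != 0 -> exists c, p.[c] != 0.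
Proof.
move=> p0; have [/eqP/size_poly1P[c c0 ->]|s1] := eqVneq (size p) 1%N.
  by exists 0; rewrite hornerC.
have sp : size (p - 1) = size p.
  rewrite size_polyDl // size_polyN size_poly1 ltn_neqAle eq_sym s1 lt0n size_poly_eq0 //.
have /closed_rootP[c] : size (p - 1) != 1%N by rewrite sp.
rewrite /root !hornerE subr_eq0 => /eqP pc; exists c; by rewrite pc oner_eq0.
Qed.

Section Pencil.
Variables (I A : finType) (s t : A -> I) (k : fieldType).
Notation rp := (rep s t k).
Notation dv := Defs.dimv.
Implicit Types M N L X Y : rp.

Section Deform.
Variables (M : rp) (B : A -> 'M[k]_(rdim M, rdim M)).
Hypotheses (rM : dim_ext1 M M = 0%N) (cB : cocycle B).

(* An isomorphism from M to its deformation M + u B is sought in the form 1 - c S, where S is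
   a right inverse of the coboundary map; it exists as soon as c (1 - u T) = - u b0, and
   this equation has a solution c depending rationally on u, with c = 0 at u = 0. *)
Let n := rdim M.
Let S : 'M[k]_(n * (#|A| * n), n * n) := pinvmx (extB M M) *m ext_dom M M.
Let gam (f : 'M[k]_n) : 'M[k]_(n, #|A| * n) := blocks (M := M) (N := M) (fun a => f *m B a).
Let gam_linear : linear gam.
Proof.
move=> c f g; apply/matrixP=> p q; case/mxvec_indexP: q => b q; rewrite -[b]enum_valK.
by rewrite [RHS]mxE [X in _ = X + _]mxE !blocksE mulmxDl -scalemxAl !mxE.
Qed.
HB.instance Definition _ := GRing.isLinear.Build _ _ _ _ gam gam_linear.
Let T := S *m lin_mx gam.
Let b0 := mxvec (blocks (M := M) (N := M) B).

Let deform (u : k) (c : 'rV[k]_(n * (#|A| * n))) : c *m (1%:M - u *: T) = - u *: b0 ->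
  let f : 'M[k]_n := 1%:M - vec_mx (c *m S) in
  graded (f : 'M_(rdim M, rdim M)) /\ forall a, rmap M a *m f = f *m (rmap M a + u *: B a).
Proof.
move=> hc f; set r : 'M[k]_n := vec_mx (c *m S) in f *.
have gr : graded (r : 'M_(rdim M, rdim M)).
  by apply/mem_ext_dom; rewrite vec_mxK mulmxA submxMl.
have cE : c = mxvec (blocks (M := M) (N := M) (fun a => u *: (r *m B a) - u *: B a)).
  have -> : mxvec (blocks (M := M) (N := M) (fun a => u *: (r *m B a) - u *: B a)) = u *: mxvec (gam r) - u *: b0.
    have -> : blocks (M := M) (N := M) (fun a => u *: (r *m B a) - u *: B a) = u *: gam r - u *: blocks (M := M) (N := M) B.
      apply/matrixP=> p q; case/mxvec_indexP: q => b q.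
      by rewrite -[b]enum_valK [RHS]mxE [X in X + _]mxE [X in _ + X]mxE [X in _ - X]mxE !blocksE !mxE.
    by rewrite linearB /= !linearZ.
  rewrite -mul_vec_lin vec_mxK -mulmxA -/T -scaleNr -hc mulmxBr mulmx1.
  by rewrite scalemxAr addrC subrK.
(* The equation exhibits [c] as a cocycle, hence as a coboundary because M is rigid. Only then does
   [S] give a genuine preimage, so that the coboundary of [r] is [c]. *)
have cc : (c <= extB M M)%MS.
  rewrite cE; apply/mem_extB/(ext0P M M).1 => // a.
  rewrite mulmxBr mulmxBl -!scalemxAr -!scalemxAl cB !mulmxA; congr (u *: _ - _).
  by rewrite gr -!mulmxA mulmxA [in RHS](esym (cB a)) !mulmxA.
have dr : ext_delta (M := M) (N := M) r = vec_mx c.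
  rewrite -[ext_delta _]mxvecK; congr vec_mx; rewrite -mul_vec_lin vec_mxK.
  by rewrite /S (mulmxA c) -(mulmxA _ (ext_dom M M)) mulmxKpV.
have dra a : rmap M a *m r - r *m rmap M a = u *: (r *m B a) - u *: B a.
  by move: a; apply: blocks_inj; rewrite -ext_deltaE dr cE mxvecK.
split; first by apply: gradedD; [exact: graded1 | exact: gradedN].
move=> a; rewrite /f mulmxBr mulmx1 mulmxBl mul1mx mulmxDr -scalemxAr.
have -> : rmap M a *m r = r *m rmap M a + (u *: (r *m B a) - u *: B a) by rewrite -dra addrC subrK.
by rewrite addrA opprB addrA.
Qed.

Lemma rigid_deform : exists2 p : {poly k}, p != 0 &
  forall u, p.[u] != 0 -> exists f : 'M[k]_(rdim M),
    [/\ f \in unitmx, graded (f : 'M_(rdim M, rdim M)) &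
        forall a, rmap M a *m f = f *m (rmap M a + u *: B a)].
Proof.
(* The equation is solved over k[X] with the adjugate in place of the inverse, so that [Q] is the
   isomorphism sought multiplied by det [PT]. *)
pose PT : 'M[{poly k}]_(n * (#|A| * n)) := 1%:M - 'X *: map_mx polyC T.
pose c : 'rV[{poly k}]_(n * (#|A| * n)) := (- 'X *: map_mx polyC b0) *m \adj PT.
pose Q : 'M[{poly k}]_n := \det PT *: 1%:M - vec_mx (c *m map_mx polyC S).
have evC m1 m2 (Z : 'M[k]_(m1, m2)) u : map_mx (horner_eval u) (map_mx polyC Z) = Z.
  by apply/matrixP=> i j; rewrite !mxE /= /horner_eval hornerC.
have evPT u : map_mx (horner_eval u) PT = 1%:M - u *: T.
  rewrite map_mxB map_mx1 map_mxZ evC; by rewrite /= /horner_eval hornerX.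
have evdet u : (\det PT).[u] = \det (1%:M - u *: T).
  by rewrite -evPT det_map_mx.
have evQ u : map_mx (horner_eval u) Q =
    (\det PT).[u] *: 1%:M - vec_mx ((- u *: b0) *m \adj (1%:M - u *: T) *m S).
  rewrite map_mxB map_mxZ map_mx1 map_vec_mx !map_mxM map_mxZ map_mx_adj !evC evPT.
  by rewrite /= /horner_eval hornerN hornerX.
exists (\det PT * \det Q).
  (* At u = 0 the solution is c = 0 and both determinants are 1, so their product is a nonzero
     polynomial. *)
  have : (\det PT * \det Q).[0] = 1.
    rewrite hornerM evdet scale0r subr0 det1 mul1r.
    have -> : (\det Q).[0] = \det (map_mx (horner_eval 0) Q) by rewrite det_map_mx.
    by rewrite evQ evdet scale0r subr0 det1 scale1r oppr0 scale0r !mul0mx linear0 subr0 det1.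
  by move=> H; apply/eqP => H0; move: H; rewrite H0 horner0 => /esym/eqP; rewrite oner_eq0.
move=> u; rewrite hornerM mulf_eq0 negb_or => /andP[d0 q0].
have uD : (1%:M - u *: T) \in unitmx by rewrite unitmxE unitfE -evdet.
pose cu := (- u *: b0) *m invmx (1%:M - u *: T).
have hc : cu *m (1%:M - u *: T) = - u *: b0 by rewrite mulmxKV.
have [gf hf] := deform hc.
exists (1%:M - vec_mx (cu *m S)); split=> //.
have QE : map_mx (horner_eval u) Q = (\det PT).[u] *: (1%:M - vec_mx (cu *m S)).
  rewrite evQ scalerBr; congr (_ - _); rewrite -[RHS]linearZ /=; congr (vec_mx _).
  rewrite [RHS]scalemxAl; congr (_ *m _); rewrite /cu /invmx uD -scalemxAr scalerA.
  by rewrite evdet divrr ?scale1r // -unitmxE.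
have : map_mx (horner_eval u) Q \in unitmx.
  by rewrite unitmxE det_map_mx unitfE.
by rewrite QE unitmxZ ?unitfE.
Qed.
End Deform.

Lemma same_dim_bij M N : (forall i, dv M i = dv N i) ->
  exists (u : 'I_(rdim M) -> 'I_(rdim N)), bijective u /\ forall p, rvert (u p) = rvert p.
Proof.
move=> e; have en : rdim M = rdim N by rewrite !rdim_sum; apply: eq_bigr.
have : perm_eq [tuple rvert p | p < rdim M] [tuple rvert (cast_ord en p) | p < rdim M].
  have cnt (f : 'I_(rdim M) -> I) i : count_mem i [tuple f p | p < rdim M] = (\sum_p (f p == i))%N.
    rewrite /= count_map -sum1_count big_mkcond /= big_enum /=; apply: eq_bigr => p _; by case: eqP.
  apply/allP=> i _ /=; rewrite !cnt -dimvE e dimvE.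
  rewrite (reindex (cast_ord en)) //; exists (cast_ord (esym en)) => p _; by rewrite ?cast_ordK ?cast_ordKV.
case/tuple_permP=> pi H.
exists (fun p => cast_ord en (pi p)); split.
  exists (fun q => (pi^-1)%g (cast_ord (esym en) q)) => q.
    by rewrite cast_ordK permK.
  by rewrite permKV cast_ordKV.
move=> p; have := congr1 (fun x : seq I => nth (rvert p) x p) H.
rewrite -!tnth_nth !tnth_mktuple => ->. by [].
Qed.
End Pencil.

Section RigidIso.
Variables (I A : finType) (s t : A -> I) (k : closedFieldType).
Notation rp := (rep s t k).
Notation dv := Defs.dimv.
Implicit Types M N L X Y : rp.

Lemma rigid_iso M N : dim_ext1 M M = 0%N -> dim_ext1 N N = 0%N ->
  (forall i, dv M i = dv N i) -> rep_iso M N.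
Proof.
move=> rM rN dMN.
have [u [[v uv vu] hu]] := same_dim_bij dMN.
(* N is rewritten on the labelled basis of M, so that both representations become points of one
   matrix space and can be joined by a line. *)
pose x a : 'M[k]_(rdim M) := \matrix_(p, q) rmap N a (u p) (u q).
have gx a p q : x a p q != 0 -> rvert p = s a /\ rvert q = t a.
  by rewrite mxE => /rmap_graded; rewrite !hu.
pose N' : rp := Rep gx.
have iN : rep_iso N' N.
  pose P : 'M[k]_(rdim M, rdim N) := \matrix_(p, q) (u p == q)%:R.
  pose P' : 'M[k]_(rdim N, rdim M) := \matrix_(p, q) (v p == q)%:R.
  have PE m (Z : 'M[k]_(rdim N, m)) p q : (P *m Z) p q = Z (u p) q.
    rewrite mxE (bigD1 (u p)) //= big1 ?addr0 => [|r nr]; first by rewrite mxE eqxx mul1r.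
    by rewrite mxE eq_sym (negbTE nr) mul0r.
  have PE' m (Z : 'M[k]_(m, rdim M)) p q : (Z *m P) p q = Z p (v q).
    rewrite mxE (bigD1 (v q)) //= big1 ?addr0 => [|r nr]; first by rewrite mxE vu eqxx mulr1.
    by rewrite mxE -(inj_eq (can_inj vu)) uv (negbTE nr) mulr0.
  apply: (@iso_of_morph _ _ _ _ _ N' N P P').
  - split=> [|a].
      apply/gradedP=> p q; rewrite mxE; case: (u p =P q) => [<- _|_]; last by rewrite eqxx.
      by rewrite hu.
    by apply/matrixP=> p q; rewrite PE' PE mxE vu.
  - by apply/matrixP=> p q; rewrite PE !mxE uv.
  - by apply/matrixP=> p q; rewrite PE' !mxE (inj_eq (can_inj vu)).
have rN' : dim_ext1 N' N' = 0%N.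
  have := euler_form N' N'; rewrite (hom_iso_l _ iN) (hom_iso_r _ iN).
  have := euler_form N N; rewrite rN.
  under [X in _ -> _ = (_ + X)%N -> _]eq_bigr do rewrite !(dimv_iso _ iN).
  under [X in _ -> (_ + X = _)%N -> _]eq_bigr do rewrite !(dimv_iso _ iN).
  lia.
apply: rep_iso_trans iN.
pose B a : 'M[k]_(rdim M) := x a - rmap M a.
have cB : cocycle (M := M) (N := M) B.
  by move=> a; rewrite mulmxBr mulmxBl vproj_rmap rmap_vproj (vproj_rmap N') (rmap_vproj N').
have cB' : cocycle (M := N') (N := N') (fun a => - B a).
  move=> a; have := cB a; rewrite mulmxN mulNmx => {2}<-. by [].
have [p p0 hp] := rigid_deform rM cB.
have [p' p'0 hp'] := rigid_deform rN' cB'.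
(* The point at parameter c is the deformation of M by c and also that of [N'] by 1 - c in the
   opposite direction; hence the substitution of 1 - X in the second polynomial. *)
have [c] : exists c, (p * (p' \Po (1 - 'X))).[c] != 0.
  apply: closed_field_nonroot; rewrite mulf_neq0 //.
  have s2 : size (1 - 'X : {poly k}) = 2 by rewrite -opprB size_polyN size_XsubC.
  by rewrite comp_poly_eq0 ?s2.
rewrite hornerM mulf_eq0 negb_or horner_comp !hornerE => /andP[/hp[f [uf gf hf]] /hp'[h [uh gh hh]]].
have e a : x a + (1 - c) *: - B a = rmap M a + c *: B a.
  rewrite scalerN scalerBl scale1r opprB addrA [LHS]addrAC {1}/B subKr. by [].
apply: (@iso_of_morph _ _ _ _ _ M N' (f *m invmx h) (h *m invmx f)).
- split=> [i|a].
    have gi : vproj M i *m invmx h = invmx h *m vproj M i.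
      have := gh i; rewrite -[vproj N' i]/(vproj M i) => gh'.
      by rewrite -[LHS]mul1mx -(mulVmx uh) -!mulmxA (mulmxA h) -gh' -!mulmxA mulmxV // mulmx1.
    by rewrite -[vproj N' i]/(vproj M i) mulmxA gf -!mulmxA gi.
  rewrite mulmxA hf -!mulmxA; congr (f *m _).
  have := hh a; rewrite e -[rmap N' a]/(x a) => hha.
  by rewrite -[LHS]mul1mx -(mulVmx uh) -!mulmxA (mulmxA h) -hha -!mulmxA mulmxV // mulmx1.
- by rewrite mulmxA mulmxKV // mulmxV.
- by rewrite mulmxA mulmxKV // mulmxV.
Qed.
End RigidIso.

(** * Rigid decompositions *)

Section Generic.
Variables (I A : finType) (s t : A -> I) (k : closedFieldType).
Notation rp := (rep s t k).
Notation dv := Defs.dimv.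
Implicit Types M N L X Y : rp.

(** By the Euler identity dim Ext^1 is a function of dim Hom and the dimension vectors, and both are
    isomorphism invariants. *)
Lemma ext_iso_l M M' N : rep_iso M M' -> dim_ext1 M N = dim_ext1 M' N.
Proof.
move=> i; have := euler_form M N; have := euler_form M' N.
under [X in _ -> (_ + X = _)%N -> _]eq_bigr do rewrite (dimv_iso _ i).
under [X in _ -> (_ = _ + X)%N -> _]eq_bigr do rewrite (dimv_iso _ i).
rewrite (hom_iso_l _ i); lia.
Qed.

Lemma ext_iso_r M N N' : rep_iso N N' -> dim_ext1 M N = dim_ext1 M N'.
Proof.
move=> i; have := euler_form M N; have := euler_form M N'.
under [X in _ -> (_ + X = _)%N -> _]eq_bigr do rewrite (dimv_iso _ i).
under [X in _ -> (_ = _ + X)%N -> _]eq_bigr do rewrite (dimv_iso _ i).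
rewrite (hom_iso_r _ i); lia.
Qed.

Lemma ext_dsum_l M N X : dim_ext1 (dsum M N) X = (dim_ext1 M X + dim_ext1 N X)%N.
Proof.
have := euler_form (dsum M N) X; have := euler_form M X; have := euler_form N X.
under [X in _ -> _ -> (_ + X = _)%N -> _]eq_bigr do rewrite dimv_ext mulnDl.
under [X in _ -> _ -> (_ = _ + X)%N -> _]eq_bigr do rewrite dimv_ext mulnDl.
rewrite !big_split hom_dsum_l /=; lia.
Qed.

Lemma ext_dsum_r X M N : dim_ext1 X (dsum M N) = (dim_ext1 X M + dim_ext1 X N)%N.
Proof.
have := euler_form X (dsum M N); have := euler_form X M; have := euler_form X N.
under [X in _ -> _ -> (_ + X = _)%N -> _]eq_bigr do rewrite dimv_ext mulnDr.
under [X in _ -> _ -> (_ = _ + X)%N -> _]eq_bigr do rewrite dimv_ext mulnDr.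
rewrite !big_split hom_dsum_r /=; lia.
Qed.

Lemma ext_rdim0 M N : (rdim M = 0 \/ rdim N = 0)%N -> dim_ext1 M N = 0%N.
Proof.
move=> H; apply/eqP; rewrite -leqn0 (leq_trans (leq_subr _ _)) //.
apply: leq_trans (rank_leq_col _) _.
by case: H => ->; rewrite ?mul0n ?muln0 //= muln0.
Qed.

Lemma ext_bigsum_l l X : (forall M, List.In M l -> dim_ext1 M X = 0%N) -> dim_ext1 (bigsum l) X = 0%N.
Proof.
elim: l => [|M l IH] H; first by rewrite ext_rdim0 //; left.
by rewrite [bigsum _]/= ext_dsum_l H ?IH //=; [move=> N Nl; apply: H; right | left].
Qed.

Lemma ext_bigsum_r l X : (forall M, List.In M l -> dim_ext1 X M = 0%N) -> dim_ext1 X (bigsum l) = 0%N.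
Proof.
elim: l => [|M l IH] H; first by rewrite ext_rdim0 //; right.
by rewrite [bigsum _]/= ext_dsum_r H ?IH //=; [move=> N Nl; apply: H; right | left].
Qed.

Definition rigid_list (l : seq rp) :=
  (forall M, List.In M l -> indec M) /\
  forall M N, List.In M l -> List.In N l -> dim_ext1 M N = 0%N.

Lemma rigid_list_bigsum l : rigid_list l -> dim_ext1 (bigsum l) (bigsum l) = 0%N.
Proof.
case=> _ H; apply: ext_bigsum_l => M Ml; apply: ext_bigsum_r => N Nl; exact: H.
Qed.

Lemma bigsum_incl l L : List.In L l ->
  exists (b : 'M[k]_(rdim L, rdim (bigsum l))) (a : 'M[k]_(rdim (bigsum l), rdim L)),
    [/\ morph b, morph a & b *m a = 1%:M].
Proof.
elim: l => // N l IH /= [->|/IH[b [a [mb ma ba]]]].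
  exists (ext_inl (cocycle0 L (bigsum l))), (ext_prl (cocycle0 L (bigsum l))); split.
  - exact: dsum_inl_morph.
  - exact: ext_prl_morph.
  - exact: ext_inl_prl.
exists (b *m ext_inr (cocycle0 N (bigsum l))), (ext_prr (cocycle0 N (bigsum l)) *m a); split.
- exact: morphM mb (ext_inr_morph _).
- exact: morphM (dsum_prr_morph _ _) ma.
- by rewrite mulmxA -(mulmxA b) ext_inr_prr mulmx1.
Qed.

Lemma bigsum_through l L (a : 'M[k]_(rdim L, rdim (bigsum l))) (b : 'M[k]_(rdim (bigsum l), rdim L)) :
  morph a -> morph b -> a *m b != 0 ->
  exists N (a' : 'M[k]_(rdim L, rdim N)) (b' : 'M[k]_(rdim N, rdim L)),
    [/\ List.In N l, morph a', morph b' & a' *m b' != 0].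
Proof.
elim: l a b => [|N l IH] a b ma mb ab.
  by case/negP: ab; apply/eqP/matrixP => p q; rewrite !mxE big_ord0.
pose c := cocycle0 N (bigsum l).
have [H|H] := eqVneq ((a *m ext_prl c) *m (ext_inl c *m b)) 0; last first.
  exists N, (a *m ext_prl c), (ext_inl c *m b); split=> //; first by left.
  - exact: morphM ma (ext_prl_morph _).
  - exact: morphM (dsum_inl_morph _ _) mb.
have [|N' [a' [b' [N'l ma' mb' ab']]]] := IH (a *m ext_prr c) (ext_inr c *m b)
   (morphM ma (dsum_prr_morph _ _)) (morphM (ext_inr_morph _) mb).
  apply: contra ab => /eqP H'; apply/eqP; rewrite -[a]mulmx1 -(ext_pr_in c).
  by rewrite mulmxDr mulmxDl !mulmxA in H H' *; rewrite H H' addr0.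
by exists N', a', b'; split=> //; right.
Qed.

Lemma sum_perm (T : Type) (F : T -> nat) l l' : Permutation l l' ->
  (\sum_(x <- l) F x = \sum_(x <- l') F x)%N.
Proof.
elim=> [|x m m' _ IH|x y m|m1 m2 m3 _ H1 _ H2].
- by [].
- by rewrite !big_cons IH.
- by rewrite !big_cons addnCA.
- by rewrite H1.
Qed.

(** Brings two summands with a nonsplit extension to the front of the list. The alternative x = y is
    settled by rigidity of indecomposables. *)
Lemma in_pair_perm (T : Type) (x y : T) l : List.In x l -> List.In y l ->
  x = y \/ exists r, Permutation l (x :: y :: r).
Proof.
move=> xl; have [l1 [l2 ->]] := List.in_split _ _ xl.
case/List.in_app_iff=> [yl|[|yl]].
- have [l3 [l4 ->]] := List.in_split _ _ yl; right; exists (l3 ++ l4 ++ l2).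
  apply: Permutation_trans (Permutation_sym (Permutation_middle _ _ _)) _; apply: perm_skip.
  rewrite -List.app_assoc /=; exact/Permutation_sym/Permutation_middle.
- by left.
have [l3 [l4 ->]] := List.in_split _ _ yl; right; exists (l1 ++ l3 ++ l4).
apply: Permutation_trans (Permutation_sym (Permutation_middle _ _ _)) _; apply: perm_skip.
rewrite List.app_assoc catA; exact/Permutation_sym/Permutation_middle.
Qed.

Lemma exists_dim (d : I -> nat) : exists M, forall i, dv M i = d i.
Proof.
pose T := {i : I & 'I_(d i)}.
pose vert (p : 'I_#|{: T}|) : I := tag (enum_val p).
have z a p q : (fun=> 0 : 'M[k]_#|{: T}|) a p q != 0 -> vert p = s a /\ vert q = t a.
  by rewrite mxE eqxx.
exists (Rep z) => i; rewrite dimvE /= (reindex (@enum_rank _)) /=; last exact/onW_bij/enum_rank_bij.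
under eq_bigr do rewrite /vert enum_rankK.
transitivity (\sum_j \sum_(q < d j) (j == i))%N; first by rewrite (sig_big_dep _ (fun i q => true)).
rewrite (bigD1 i) //= eqxx sum_nat_const card_ord muln1 big1 ?addn0 //.
by move=> j /negbTE ->; rewrite big1.
Qed.

Hypothesis tits_pos : forall d : I -> nat, (exists i, d i <> 0%N) ->
  (\sum_a d (s a) * d (t a) < \sum_i d i * d i)%N.

Lemma indec_rigid M : indec M -> dim_ext1 M M = 0%N.
Proof. by move/(indec_brick tits_pos)/(brick_rigid tits_pos). Qed.

Lemma indec_hom1 M : indec M -> hom M M = 1%N.
Proof. by move/(indec_brick tits_pos)/brick_hom. Qed.

Lemma indec_iso M N : indec M -> indec N -> (forall i, dv M i = dv N i) -> rep_iso M N.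
Proof. by move=> iM iN; apply: rigid_iso; exact: indec_rigid. Qed.

Definition homl (l : seq rp) := (\sum_(M <- l) \sum_(N <- l) hom M N)%N.

Lemma homl_perm l l' : Permutation l l' -> homl l = homl l'.
Proof.
move=> pl; rewrite /homl (sum_perm _ pl); apply: eq_bigr => M _; exact: sum_perm.
Qed.

Lemma homl_bigsum l : homl l = hom (bigsum l) (bigsum l).
Proof. by rewrite hom_bigsum_l; apply: eq_bigr => M _; rewrite hom_bigsum_r. Qed.

(* l' lists the indecomposable summands of a nonsplit extension of M by N. *)
Lemma homl_exchange M N r : dim_ext1 M N <> 0%N ->
  exists l', [/\ forall L, List.In L l' -> indec L,
    forall i, (\sum_(L <- l') dv L i = dv M i + dv N i)%N &
    (homl (l' ++ r) < homl (M :: N :: r))%N].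
Proof.
move=> ne; have [g cg ng] : exists2 g : A -> 'M[k]_(rdim M, rdim N), cocycle g & ~ cobound g.
  by apply: contrapT => H; apply/ne/ext0P => g cg; apply: contrapT => ng; apply: H; exists g.
have [l' [il' iso]] := krull_decomp (ext_rep cg); exists l'; split=> //.
  by move=> i; rewrite -dimv_bigsum -(dimv_iso _ iso) dimv_ext.
set E := ext_rep cg in iso; set R := bigsum r.
have i1 : rep_iso (dsum E R) (bigsum (l' ++ r)).
  exact: rep_iso_trans (dsum_iso iso (rep_iso_refl _)) (bigsum_cat _ _).
rewrite !homl_bigsum -(hom_iso_l _ i1) -(hom_iso_r _ i1).
rewrite [bigsum (M :: N :: r)]/= -/R !(hom_dsum_l, hom_dsum_r).
(* The strict drop is in hom M E; it reaches the total through hom E E <= hom M E + hom N E. Every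
   other term is at most its value for the direct sum of M and N. *)
have := hom_ext_nonsplit cg ng; rewrite -/E.
have := hom_ext_l cg E; have := hom_ext_r cg N; have := hom_ext_r cg R; have := hom_ext_l cg R.
rewrite -/E; lia.
Qed.

Theorem rigid_decomposition (d : I -> nat) :
  exists l, rigid_list l /\ forall i, (\sum_(L <- l) dv L i = d i)%N.
Proof.
pose P h := exists l : seq rp, [/\ forall L, List.In L l -> indec L,
   forall i, (\sum_(L <- l) dv L i = d i)%N & homl l = h].
have [h [[l [il dl hl]] min]] : exists h, P h /\ forall h', P h' -> (h <= h')%N.
  have exP : exists h, `[< P h >].
    have [M dM] := exists_dim d; have [l [il iso]] := krull_decomp M.
    exists (homl l); apply/asboolP; exists l; split=> // i.
    by rewrite -dimv_bigsum -(dimv_iso _ iso).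
  exists (ex_minn exP); case: ex_minnP => m /asboolP Pm H; split=> // r' Pr'.
  by apply: H; apply/asboolP.
exists l; split=> //; split=> // M N Ml Nl; apply: contrapT => ne.
case: (in_pair_perm Ml Nl) => [MN|[r pl]].
  by apply: ne; rewrite -MN; apply: indec_rigid; exact: il.
have [l' [il' dl' lt]] := homl_exchange r ne.
have : (h <= homl (l' ++ r))%N.
  apply: min; exists (l' ++ r); split=> // [L|i].
    case/List.in_app_iff; first exact: il'.
    move=> Lr; apply: il; apply: (Permutation_in _ (Permutation_sym pl)); by right; right.
  by rewrite big_cat /= dl' -dl (sum_perm _ pl) !big_cons addnA.
by rewrite leqNgt -hl (homl_perm pl) lt.
Qed.

(** For a rigid representation the dimension of the endomorphism ring equals the Tits form, here 1,
    whereas each summand already contributes its own identity. So there is only one summand. *)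
Lemma unit_form_indec (d : I -> nat) : (\sum_i d i * d i = (\sum_a d (s a) * d (t a)).+1)%N ->
  exists M, indec M /\ forall i, dv M i = d i.
Proof.
move=> q1; have [l [[il rl] dl]] := rigid_decomposition d.
have := euler_form (bigsum l) (bigsum l); rewrite rigid_list_bigsum // -homl_bigsum.
under eq_bigr do rewrite !dimv_bigsum !dl; under [X in _ = (_ + X)%N -> _]eq_bigr do rewrite !dimv_bigsum !dl.
rewrite q1 => h1; have {}h1 : homl l = 1%N by lia.
case: l il rl dl h1 => [|M [|N r]] il rl dl; rewrite /homl.
- by rewrite big_nil.
- by move=> _; exists M; split=> [|i]; [apply: il; left | rewrite -dl big_seq1].
rewrite !big_cons (indec_hom1 (il M _)); last by left.
by rewrite (indec_hom1 (il N _)) /=; [lia | right; left].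
Qed.

Lemma indec_unit_form M : indec M ->
  (\sum_i dv M i * dv M i = (\sum_a dv M (s a) * dv M (t a)).+1)%N.
Proof.
by move=> iM; have := euler_form M M; rewrite indec_rigid // indec_hom1 //; lia.
Qed.

(** The two sums are isomorphic, so the identity of M factors through the sum of [l'] and some
    composite M -> N -> M is nonzero. M and N are bricks, which turns this composite into an
    isomorphism up to a scalar. *)
Lemma rigid_list_summand l l' : rigid_list l -> rigid_list l' ->
  (forall i, (\sum_(L <- l) dv L i = \sum_(L <- l') dv L i)%N) ->
  forall M, List.In M l -> exists2 N, List.In N l' & forall i, dv M i = dv N i.
Proof.
move=> rl rl' dl M Ml.
have [f [g [mf mg fg gf]]] : rep_iso (bigsum l) (bigsum l').
  by apply: rigid_iso; try exact: rigid_list_bigsum; move=> i; rewrite !dimv_bigsum.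
have [b [a [mb ma ba]]] := bigsum_incl Ml.
have bM := indec_brick tits_pos (rl.1 _ Ml).
have [|N [a' [b' [Nl ma' mb' ab]]]] := bigsum_through (morphM mb mf) (morphM mg ma).
  by rewrite mulmxA -(mulmxA b) fg mulmx1 ba; exact: scalar1_neq0 bM.1.
have bN := indec_brick tits_pos (rl'.1 _ Nl).
exists N => // i; apply: dimv_iso.
have [c cE] := bM.2 _ (morphM ma' mb'); have [c' cE'] := bN.2 _ (morphM mb' ma').
have c0 : c != 0 by apply: contra ab => /eqP c0; rewrite cE c0 raddf0.
(* The two composites are scalars c and c'; evaluating a' b' a' b' with either bracketing gives c c
   = c c'. *)
have cc : c' = c.
  apply: (mulfI c0); have : a' *m b' *m a' *m b' = (c * c)%:M by rewrite -mulmxA cE -scalar_mxM.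
  rewrite -(mulmxA a') cE' mul_mx_scalar -scalemxAl cE -mul_scalar_mx -scalar_mxM.
  move/eqP; rewrite -subr_eq0 -raddfB /= -scalemx1 scalemx_eq0 (negbTE (scalar1_neq0 k bM.1)) orbF subr_eq0.
  by rewrite mulrC => /eqP.
apply: (@iso_of_morph _ _ _ _ _ M N a' (c^-1 *: b')) => //.
  by rewrite -scalemxAr cE -[c%:M]scalemx1 scalerA mulVf // scale1r.
by rewrite -scalemxAl cE' cc -[c%:M]scalemx1 scalerA mulVf // scale1r.
Qed.
End Generic.

(** * Positivity of the Dynkin forms *)

(** Tits form of the chain with vertices 0, ..., m. *)
Fixpoint chain_form (m : nat) (x : nat -> int) : int :=
  if m is m'.+1 then chain_form m' x + x m * x m - x m' * x m else x 0%N * x 0%N.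

(* (m + 2) / (2 (m + 1)) is the minimum of the form of a chain on the vectors with x m = 1. *)
Lemma chain_form_ge m x : (m%:Z + 2) * (x m * x m) <= 2 * (m%:Z + 1) * chain_form m x.
Proof.
elim: m => [|m IH] /=; first by rewrite add0r mulr1.
have m0 : 0 < m%:Z + 1 by lia.
rewrite -subr_ge0 -(pmulr_rge0 _ m0).
have sq := sqr_ge0 ((m%:Z + 2) * x m - (m%:Z + 1) * x m.+1).
have e : (m%:Z + 1) * (2 * (m.+1%:Z + 1) * (chain_form m x + x m.+1 * x m.+1 - x m * x m.+1) - (m.+1%:Z + 2) * (x m.+1 * x m.+1))
  = (m%:Z + 2) * (2 * (m%:Z + 1) * chain_form m x - (m%:Z + 2) * (x m * x m)) + ((m%:Z + 2) * x m - (m%:Z + 1) * x m.+1) ^+ 2.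
  by rewrite -[m.+1]addn1 PoszD; ring.
by rewrite e addr_ge0 // mulr_ge0 // subr_ge0.
Qed.

Lemma sqr_le0_eq0 (y : int) : y * y <= 0 -> y = 0.
Proof. by move=> H; apply/eqP; rewrite -sqrf_eq0 eq_le sqr_ge0 expr2 H. Qed.

Lemma chain_form_eq0 m x : chain_form m x <= 0 -> forall n, (n <= m)%N -> x n = 0.
Proof.
elim: m => [|m IH] H n.
  by rewrite leqn0 => /eqP ->; apply: sqr_le0_eq0.
have xm : x m.+1 = 0.
  apply: sqr_le0_eq0; have := chain_form_ge m.+1 x.
  have m0 : 0 < m.+1%:Z + 2 by lia.
  move=> le; rewrite -(pmulr_rle0 _ m0) (le_trans le) //.
  by rewrite pmulr_rle0 //; lia.
rewrite leq_eqVlt => /orP[/eqP-> //|]; apply: IH.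
by move: H => /=; rewrite xm !mulr0 addr0 subr0.
Qed.

(* Twice the form is 2 c - X^2 + (2 Y - X)^2 / 2 + (2 Z - X)^2 / 2, where c is the form of the
   long arm up to the branching vertex and X, Y, Z are the values there and at the two tips. *)
Lemma D_form_eq0 n x (z : int) :
  chain_form n.+2 x + z * z - x n.+1 * z <= 0 -> (forall i, (i <= n.+2)%N -> x i = 0) /\ z = 0.
Proof.
move=> /= H; have ge := chain_form_ge n.+1 x; rewrite /= in ge.
move: H ge; set c := chain_form n x + _ - _ => H ge.
have s1 := sqr_ge0 (2 * x n.+2 - x n.+1); have s2 := sqr_ge0 (2 * z - x n.+1).
rewrite !expr2 in s1 s2.
have n1 : 0 < n.+1%:Z + 1 by lia.
have h2 : 2 * c - x n.+1 * x n.+1 <= 0 by lra.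
have hX : x n.+1 = 0.
  apply: sqr_le0_eq0; have := ler_wpM2l (ltW n1) h2; lra.
rewrite hX in s1 s2 H h2.
have hz : z = 0 by apply: sqr_le0_eq0; have := chain_form_ge n.+1 x; rewrite /= -/c hX; nra.
have hy : x n.+2 = 0 by apply: sqr_le0_eq0; have := chain_form_ge n.+1 x; rewrite /= -/c hX; nra.
split=> // i; rewrite leq_eqVlt => /orP[/eqP-> //|]; apply: (@chain_form_eq0 n.+1).
rewrite /= -/c; lra.
Qed.

(** Completing squares from the three tips towards the branching vertex produces the listed squares.
    Arms with 2, 4 and 1 vertices cost 1/3, 2/5 and 1/4 of x2^2, and 1 - 1/3 - 2/5 - 1/4 = 1/60
    remains. *)
Lemma E8_form_eq0 (x0 x1 x2 x3 x4 x5 x6 z : int) :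
  x0 * x0 + x1 * x1 - x0 * x1 + x2 * x2 - x1 * x2 + x3 * x3 - x2 * x3 + x4 * x4 - x3 * x4
   + x5 * x5 - x4 * x5 + x6 * x6 - x5 * x6 + z * z - x2 * z <= 0 ->
  [/\ x0 = 0, x1 = 0, x2 = 0 & x3 = 0] /\ [/\ x4 = 0, x5 = 0, x6 = 0 & z = 0].
Proof.
move=> H.
have s0 := sqr_ge0 (2 * x0 - x1); have s1 := sqr_ge0 (3 * x1 - 2 * x2).
have s6 := sqr_ge0 (2 * x6 - x5); have s5 := sqr_ge0 (3 * x5 - 2 * x4).
have s4 := sqr_ge0 (4 * x4 - 3 * x3); have s3 := sqr_ge0 (5 * x3 - 4 * x2).
have sz := sqr_ge0 (2 * z - x2).
have h2 : x2 = 0 by apply: sqr_le0_eq0; nra.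
rewrite h2 in H s1 s3 sz *.
have h1 : x1 = 0 by apply: sqr_le0_eq0; nra.
have h3 : x3 = 0 by apply: sqr_le0_eq0; nra.
have hz : z = 0 by apply: sqr_le0_eq0; nra.
rewrite h1 h3 hz in H s0 s4 *.
have h0 : x0 = 0 by apply: sqr_le0_eq0; nra.
have h4 : x4 = 0 by apply: sqr_le0_eq0; nra.
rewrite h0 h4 in H s5 *.
have h5 : x5 = 0 by apply: sqr_le0_eq0; nra.
rewrite h5 in H *.
have h6 : x6 = 0 by apply: sqr_le0_eq0; nra.
by split.
Qed.

Definition dt_form (d : dynkin_type) (x : nat -> int) : int :=
  \sum_(n < dt_size d) x n * x n
  - \sum_(b < dt_size d) \sum_(a < dt_size d) (dt_edge d a b)%:Z * (x a * x b).

Lemma chain_sum m (x : nat -> int) : \sum_(n < m.+1) x n * x n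
  - \sum_(b < m.+1) (if (b : nat) is b'.+1 then x b' * x b else 0) = chain_form m x.
Proof.
elim: m => [|m IH]; first by rewrite !big_ord_recr !big_ord0 /=; ring.
rewrite big_ord_recr [X in _ - X]big_ord_recr /= -IH; ring.
Qed.

Lemma pred_sum N b (x : nat -> int) : (b < N)%N -> \sum_(a < N) (b == a.+1)%:Z * (x a * x b)
  = if (b : nat) is b'.+1 then x b' * x b else 0 :> int.
Proof.
case: b => [|b] lt; first by rewrite big1 // => a _; rewrite mul0r.
rewrite (bigD1 (Ordinal (ltnW lt))) //= eqxx mul1r big1 ?addr0 // => a ab.
suff -> : (b.+1 == a.+1) = false by rewrite mul0r.
by apply: contraNF ab => /eqP[ba]; apply/eqP/val_inj.
Qed.

(** Types D and E share this shape: a chain 0, ..., M - 1 with one more vertex M attached to c. *)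
Lemma branched_sum M c (x : nat -> int) (e : nat -> nat -> bool) : (c < M)%N ->
  (forall a b, (a < M.+1)%N -> (b < M.+1)%N -> e a b = ((b == a.+1) && (b < M)%N) || ((a == c) && (b == M))) ->
  \sum_(n < M.+1) x n * x n - \sum_(b < M.+1) \sum_(a < M.+1) (e a b)%:Z * (x a * x b)
  = chain_form M.-1 x + x M * x M - x c * x M :> int.
Proof.
case: M => // M cM eE; rewrite big_ord_recr [X in _ - X]big_ord_recr /=.
have -> : \sum_(a < M.+2) (e a M.+1)%:Z * (x a * x M.+1) = x c * x M.+1.
  have cM2 : (c < M.+2)%N by lia.
  rewrite (bigD1 (Ordinal cM2)) //= eE // !eqxx orbT mul1r big1 ?addr0 // => a ac.
  rewrite eE // ltnn andbF /=; suff -> : (a == c :> nat) = false by rewrite mul0r.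
  by apply: contraNF ac => /eqP h; apply/eqP/val_inj.
have -> : \sum_(b < M.+1) \sum_(a < M.+2) (e a b)%:Z * (x a * x b) =
   \sum_(b < M.+1) (if (b : nat) is b'.+1 then x b' * x b else 0).
  apply: eq_bigr => b _; have lb := ltn_ord b; have lb2 : (b < M.+2)%N by lia.
  rewrite -(@pred_sum M.+2 b) //; apply: eq_bigr => a _; rewrite eE // lb andbT.
  by rewrite (_ : (b == M.+1 :> nat) = false) ?andbF ?orbF //; lia.
by rewrite -chain_sum; ring.
Qed.

Lemma dt_form_eq0 d x : dt_form d x <= 0 -> forall n, (n < dt_size d)%N -> x n = 0.
Proof.
case: d => [n|n| | |]; rewrite /dt_form [dt_size _]/=.
- have -> : \sum_(b < n.+1) \sum_(a < n.+1) (dt_edge (TA n) a b)%:Z * (x a * x b) =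
     \sum_(b < n.+1) (if (b : nat) is b'.+1 then x b' * x b else 0).
    apply: eq_bigr => b _; rewrite -(@pred_sum n.+1 b) //; apply: eq_bigr => a _.
    by rewrite /dt_edge /= ltn_ord andbT.
  by rewrite chain_sum => /chain_form_eq0 H m; rewrite ltnS => /H.
- rewrite addnC (@branched_sum n.+3 n.+1) //; last first.
    move=> a b la lb; rewrite /dt_edge /= addnC /= !subSS subn0 ltnS //.
  move=> /= /D_form_eq0[H1 H2] m; rewrite ltnS leq_eqVlt => /orP[/eqP-> //|]; rewrite ltnS; exact: H1.
(* E6 and E7 are treated as E8 with zeros at the end of its long arm. *)
- rewrite (@branched_sum 5 2) //= => H.
  have [|[h0 h1 h2 h3] [h4 _ _ h5]] := @E8_form_eq0 (x 0%N) (x 1%N) (x 2%N) (x 3%N) (x 4%N) 0 0 (x 5%N); first by lra.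
  by do 6?[case=> //].
- rewrite (@branched_sum 6 2) //= => H.
  have [|[h0 h1 h2 h3] [h4 h5 _ h6]] := @E8_form_eq0 (x 0%N) (x 1%N) (x 2%N) (x 3%N) (x 4%N) (x 5%N) 0 (x 6%N); first by lra.
  by do 7?[case=> //].
- rewrite (@branched_sum 7 2) //= => H.
  have [|[h0 h1 h2 h3] [h4 h5 h6 h7]] := @E8_form_eq0 (x 0%N) (x 1%N) (x 2%N) (x 3%N) (x 4%N) (x 5%N) (x 6%N) (x 7%N); first by lra.
  by do 8?[case=> //].
Qed.

(** * Roots *)

Section CartanForm.
Variables (I A : finType) (s t : A -> I).
Implicit Types v w : {ffun I -> int}.
Notation cf := (cform s t).
Notation sr := (@simple_root I).

Lemma cartan_sym i j : cartan s t i j = cartan s t j i.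
Proof.
rewrite /cartan eq_sym; case: eqP => // _; congr (- (_ %:Z)); apply: eq_card => a.
by rewrite !inE orbC.
Qed.

Lemma cform_sym v w : cf v w = cf w v.
Proof.
rewrite /cform exchange_big /=; apply: eq_bigr => i _; apply: eq_bigr => j _.
by rewrite cartan_sym [w i * _]mulrC.
Qed.

Lemma cformDl v v' w : cf (v + v') w = cf v w + cf v' w.
Proof.
rewrite /cform -big_split; apply: eq_bigr => i _; rewrite -big_split; apply: eq_bigr => j _.
by rewrite ffunE !mulrDl.
Qed.

Lemma cformNl v w : cf (- v) w = - cf v w.
Proof.
rewrite /cform -sumrN; apply: eq_bigr => i _; rewrite -sumrN; apply: eq_bigr => j _.
by rewrite ffunE !mulNr.
Qed.

Lemma cformDr v w w' : cf v (w + w') = cf v w + cf v w'.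
Proof. by rewrite cform_sym cformDl !(cform_sym v). Qed.

Lemma cformNr v w : cf v (- w) = - cf v w.
Proof. by rewrite cform_sym cformNl cform_sym. Qed.

Lemma cformZl v w c : cf [ffun j => c * v j] w = c * cf v w.
Proof.
rewrite /cform mulr_sumr; apply: eq_bigr => i _; rewrite mulr_sumr; apply: eq_bigr => j _.
by rewrite ffunE !mulrA.
Qed.

Lemma cformZr v w c : cf v [ffun j => c * w j] = c * cf v w.
Proof. by rewrite cform_sym cformZl cform_sym. Qed.

Lemma cform_simpler w i : cf w (sr i) = \sum_j w j * cartan s t j i.
Proof.
rewrite /cform; apply: eq_bigr => j _; rewrite (bigD1 i) //= ffunE eqxx mulr1 big1 ?addr0 //.
by move=> j' /negbTE; rewrite ffunE eq_sym => ->; rewrite mulr0 mul0r.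
Qed.

Lemma cform_expand w v : cf w v = \sum_i v i * cf w (sr i).
Proof.
under eq_bigr do rewrite cform_simpler mulr_sumr.
rewrite exchange_big; apply: eq_bigr => j _; apply: eq_bigr => i _.
by rewrite mulrCA mulrA.
Qed.

Lemma cform_simple i : cf (sr i) (sr i) = 2.
Proof.
rewrite cform_simpler (bigD1 i) //= ffunE eqxx mul1r /cartan eqxx big1 ?addr0 //.
by move=> j ji; rewrite ffunE eq_sym (negbTE ji) mul0r.
Qed.

Lemma reflect_rootE i v : reflect_root s t i v = v - [ffun j => cf v (sr i) * sr i j].
Proof. by apply/ffunP=> j; rewrite !ffunE. Qed.

(** Simple roots have norm 2 and reflections are isometries. *)
Lemma root_norm v : is_root s t v -> cf v v = 2.
Proof.
case=> l [i ->]; elim: l => [|j l IH] /=; first exact: cform_simple.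
move: (foldr _ _ _) IH => w IH; rewrite reflect_rootE.
rewrite !(cformDl, cformDr, cformNl, cformNr, cformZl, cformZr) cform_simple IH.
by rewrite [cf (sr j) w]cform_sym; ring.
Qed.

Lemma opp_simple_root i : is_root s t (- sr i).
Proof.
exists [:: i], i; rewrite /= reflect_rootE cform_simple; apply/ffunP=> j; rewrite !ffunE.
ring.
Qed.

Hypothesis cform_pos : forall v, cf v v <= 0 -> v = 0.

(** The norm of w - alpha_i is 4 - 2 (w, alpha_i). A pairing above 2 would make it negative, forcing
    w = alpha_i, whose pairing is exactly 2; the lower bound is this for -v. *)
Lemma norm2_pair v i : cf v v = 2 -> `|cf v (sr i)| <= 2.
Proof.
move=> v2; have key w : cf w w = 2 -> cf w (sr i) <= 2.
  move=> w2; rewrite leNgt; apply/negP => lt.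
  have e : cf (w - sr i) (w - sr i) = 4 - 2 * cf w (sr i).
    rewrite !(cformDl, cformDr, cformNl, cformNr) cform_simple w2 [cf (sr i) w]cform_sym; ring.
  have /eqP : w - sr i = 0 by apply: cform_pos; lia.
  by rewrite subr_eq0 => /eqP wE; move: lt; rewrite wE cform_simple.
rewrite ler_norml key // andbT; have := key (- v); rewrite !(cformNl, cformNr) opprK => /(_ v2).
lia.
Qed.

(** Induction on the height. Some i has v_i > 0 and (v, alpha_i) > 0, as otherwise the norm would be
    nonpositive. Unless v = alpha_i, positivity forces the pairing to be 1, so v - alpha_i is the
    reflection of v: still nonnegative, of norm 2, and lower. *)
Lemma norm2_pos_root v : (forall i, 0 <= v i) -> cf v v = 2 -> is_root s t v.
Proof.
have [n] := ubnP `|(\sum_i v i)%R|%N; elim: n v => // n IH v le v0 v2.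
have [i [vi ci]] : exists i, 0 < v i /\ 0 < cf v (sr i).
  apply: contrapT => H; have : cf v v <= 0; last by rewrite v2.
  rewrite [cf v v]cform_expand; apply: sumr_le0 => i _.
  have [vi|vi] := ltP 0 (v i).
    by apply: mulr_ge0_le0 => //; rewrite leNgt; apply/negP => ci; apply: H; exists i.
  by rewrite (_ : v i = 0) ?mul0r //; have := v0 i; lia.
have [->|vn] := eqVneq v (sr i); first by exists [::], i.
have e : cf (v - sr i) (v - sr i) = 4 - 2 * cf v (sr i).
  rewrite !(cformDl, cformDr, cformNl, cformNr) cform_simple v2 [cf (sr i) v]cform_sym; ring.
have c1 : cf v (sr i) = 1.
  have : ~ cf (v - sr i) (v - sr i) <= 0.
    by move/cform_pos/eqP; rewrite subr_eq0 (negbTE vn).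
  by rewrite e; lia.
have sE : \sum_j (v - sr i) j = \sum_j v j - 1.
  under eq_bigr do rewrite !ffunE.
  rewrite sumrB; congr (_ - _); rewrite (bigD1 i) //= eqxx big1 ?addr0 //.
  by move=> j; rewrite eq_sym => /negbTE ->.
have svi : 0 < \sum_j v j.
  by rewrite (bigD1 i) //=; apply: ltr_wpDr => //; apply: sumr_ge0.
have [|j||l [j lE]] := IH (v - sr i).
- by rewrite sE; lia.
- by rewrite !ffunE; case: eqP => [<-|_] /=; have := v0 i; have := v0 j; lia.
- by rewrite e c1.
exists (i :: l), j; rewrite /= -lE reflect_rootE.
have -> : cf (v - sr i) (sr i) = -1.
  by rewrite cformDl cformNl cform_simple c1.
by apply/ffunP=> x; rewrite !ffunE; ring.
Qed.

Lemma finite_by_code (T : finType) (X : eqType) (P : X -> Prop) (f : X -> T) :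
  (forall x y, P x -> P y -> f x = f y -> x = y) -> exists l : seq X, forall x, P x -> x \in l.
Proof.
move=> inj; have H (e : seq T) : exists l : seq X, forall x, P x -> f x \in e -> x \in l.
  elim: e => [|c e [l hl]]; first by exists [::].
  have [[x [Px fx]]|nx] := EM (exists x, P x /\ f x = c).
    exists (x :: l) => y Py; rewrite !inE => /orP[/eqP fy|/hl->]; rewrite ?orbT //.
    by rewrite (inj y x) ?eqxx // fx fy.
  exists l => y Py; rewrite inE => /orP[/eqP fy|]; last exact: hl.
  by case: nx; exists y.
have [l hl] := H (enum T); exists l => x Px; apply: hl => //; exact: mem_enum.
Qed.

(** A definite form makes a root determined by its pairings with the simple roots. These lie between
    -2 and 2, and the shift by 2 encodes them in five values. *)
Lemma finitely_many_roots : exists Phi : seq {ffun I -> int}, forall v, is_root s t v -> v \in Phi.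
Proof.
pose code v : {ffun I -> 'I_5} := [ffun i => inord `|(cf v (sr i) + 2)%R|%N].
apply: (@finite_by_code _ _ _ code) => v w /root_norm v2 /root_norm w2 /ffunP e.
apply/eqP; rewrite -subr_eq0; apply/eqP/cform_pos.
rewrite [cf _ _]cform_expand big1 // => i _.
have := e i; rewrite !ffunE => /(congr1 val) /=.
have := norm2_pair i v2; have := norm2_pair i w2; rewrite !ler_norml.
move=> h1 h2; rewrite !inordK; [|lia|lia] => h3.
by rewrite cformDl cformNl (_ : cf v (sr i) = cf w (sr i)) ?subrr ?mulr0 //; lia.
Qed.
End CartanForm.

(** * Positive definiteness of the Cartan form of a Dynkin quiver *)

Section Dynkin.
Variables (I A : finType) (s t : A -> I).
Implicit Types v w : {ffun I -> int}.
Notation cf := (cform s t).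
Hypothesis dyn : dynkin_quiver s t.

Lemma cform_arrows v : cf v v = 2 * (\sum_i v i * v i - \sum_a v (s a) * v (t a)).
Proof.
case: dyn => noloop _.
have e i j : cartan s t i j = (i == j)%:Z * 2 -
    \sum_a (((s a == i) && (t a == j))%:Z + ((s a == j) && (t a == i))%:Z).
  rewrite /cartan; have [<-|ij] := eqVneq i j.
    rewrite mul1r big1 ?subr0 // => a _; have := noloop a.
    by case: (s a =P i) => [->|_] //=; rewrite eq_sym => /negbTE ->.
  rewrite mul0r sub0r; congr (- _); rewrite -sum1_card big_mkcond /= (big_morph Posz PoszD (erefl _)).
  apply: eq_bigr => a _; rewrite !inE.
  have : ~~ (((s a == i) && (t a == j)) && ((s a == j) && (t a == i))).
    by apply/negP => /andP[/andP[/eqP h1 _] /andP[/eqP h2 _]]; rewrite -h1 h2 eqxx in ij.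
  by case: ((s a == i) && _); case: ((s a == j) && _).
rewrite /cform; under eq_bigr => i _ do under eq_bigr => j _ do rewrite e mulrBr.
under eq_bigr do rewrite sumrB; rewrite sumrB mulrBr; congr (_ - _).
  rewrite mulr_sumr; apply: eq_bigr => i _; rewrite (bigD1 i) //= eqxx mul1r big1 ?addr0; first by ring.
  by move=> j; rewrite eq_sym => /negbTE ->; rewrite mul0r mulr0.
have pick x y : \sum_i \sum_j v i * v j * ((x == i) && (y == j))%:Z = v x * v y.
  rewrite (bigD1 x) //= (bigD1 y) //= !eqxx mulr1 !big1 ?addr0 //.
    by move=> i; rewrite eq_sym => /negbTE ->; rewrite big1 // => j _; rewrite mulr0.
  by move=> j; rewrite eq_sym => /negbTE ->; rewrite mulr0.
under eq_bigr => i _ do under eq_bigr => j _ do rewrite mulr_sumr.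
under eq_bigr do rewrite exchange_big /=.
rewrite exchange_big /= mulr_sumr; apply: eq_bigr => a _.
under eq_bigr => i _ do under eq_bigr => j _ do rewrite mulrDr.
under eq_bigr do rewrite big_split /=; rewrite big_split /= pick.
under [X in _ + X]eq_bigr => i _ do under eq_bigr => j _ do rewrite andbC.
by rewrite pick; ring.
Qed.

(** Without loops and multiple edges, each adjacent ordered pair comes from exactly one arrow, and
    each arrow gives two such pairs. *)
Lemma arrows_adj v : 2 * (\sum_a v (s a) * v (t a)) =
  \sum_i \sum_j (qadj s t i j)%:Z * (v i * v j).
Proof.
case: (dyn) => noloop [nomulti _].
have e i j : (qadj s t i j)%:Z =
    \sum_a (((s a == i) && (t a == j))%:Z + ((s a == j) && (t a == i))%:Z).
  have [/existsP[a ha]|/existsPn H] := boolP (qadj s t i j); last first.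
    by rewrite big1 // => a _; have := H a; rewrite negb_or => /andP[/negbTE-> /negbTE->].
  rewrite (bigD1 a) //= big1 ?addr0.
    by have := noloop a; case/orP: ha => /andP[/eqP-> /eqP->] /negbTE ij; rewrite !eqxx ij.
  move=> b ba; case: (boolP (_ && _)) => h1; last case: (boolP (_ && _)) => h2 //.
    case/negP: ba; apply/eqP/nomulti; move: h1 ha => /andP[/eqP-> /eqP->].
    by rewrite !(eq_sym i) !(eq_sym j) => /orP[]/andP[-> ->]; rewrite ?orbT.
  case/negP: ba; apply/eqP/nomulti; move: h2 ha => /andP[/eqP-> /eqP->].
  by rewrite !(eq_sym i) !(eq_sym j) => /orP[]/andP[-> ->]; rewrite ?orbT.
have pick x y : \sum_i \sum_j ((x == i) && (y == j))%:Z * (v i * v j) = v x * v y.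
  rewrite (bigD1 x) //= (bigD1 y) //= !eqxx mul1r !big1 ?addr0 //.
    by move=> i; rewrite eq_sym => /negbTE ->; rewrite big1 // => j _; rewrite mul0r.
  by move=> j; rewrite eq_sym => /negbTE ->; rewrite mul0r.
under [RHS]eq_bigr => i _ do under eq_bigr => j _ do rewrite e mulr_suml.
under [RHS]eq_bigr do rewrite exchange_big /=.
rewrite [RHS]exchange_big /= mulr_sumr; apply: eq_bigr => a _.
under [RHS]eq_bigr => i _ do under eq_bigr => j _ do rewrite mulrDl.
under [RHS]eq_bigr do rewrite big_split /=; rewrite big_split /= pick.
under [X in _ = _ + X]eq_bigr => i _ do under eq_bigr => j _ do rewrite andbC.
by rewrite pick; ring.
Qed.

Lemma dt_adj_sum d (x : nat -> int) :
  \sum_(n < dt_size d) \sum_(m < dt_size d) (dt_adj d n m)%:Z * (x n * x m) =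
  2 * \sum_(b < dt_size d) \sum_(a < dt_size d) (dt_edge d a b)%:Z * (x a * x b).
Proof.
have disj a b : (dt_adj d a b)%:Z = (dt_edge d a b)%:Z + (dt_edge d b a)%:Z.
  suff : ~~ (dt_edge d a b && dt_edge d b a).
    by rewrite /dt_adj; case: (dt_edge d a b); case: (dt_edge d b a).
  by rewrite /dt_edge; case: d => [n|n| | |] /=; lia.
under eq_bigr => i _ do under eq_bigr => j _ do rewrite disj mulrDl.
under eq_bigr do rewrite big_split /=; rewrite big_split /= [X in X + _]exchange_big /=.
rewrite [RHS]mulr_sumr -big_split; apply: eq_bigr => b _ /=.
rewrite mulr_sumr -big_split; apply: eq_bigr => a _ /=; ring.
Qed.

Lemma cform_pos v : cf v v <= 0 -> v = 0.
Proof.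
rewrite cform_arrows mulrBr arrows_adj => le.
case: (dyn) => _ [_ [J [kind [phi [phi_inj [phi_im phi_adj]]]]]].
(* [phi] is onto only the pairs with n below the size of the diagram; over this dependent sum it
   becomes a bijection, along which sums over I split by components. *)
pose T := {j : J & 'I_(dt_size (kind j))}.
have ph i : ((phi i).2 < dt_size (kind (phi i).1))%N.
  by apply/phi_im; exists i; case: (phi i).
pose f i : T := Tagged (fun j => 'I_(dt_size (kind j))) (Ordinal (ph i)).
have ginv (x : T) : exists i, f i == x.
  case: x => j n; have /phi_im[i hi] := ltn_ord n; exists i; apply/eqP.
  by rewrite /f; move: (ph i); rewrite hi => h; congr (Tagged _ _); apply: val_inj.
pose g x := xchoose (ginv x).
have fg : cancel g f by move=> x; exact/eqP/(xchooseP (ginv x)).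
have f_inj : injective f.
  move=> i i' e; apply: phi_inj; rewrite [phi i]surjective_pairing [phi i']surjective_pairing.
  by have := congr1 (fun x : T => (tag x, val (tagged x))) e.
have gf : cancel f g by move=> i; apply: f_inj; rewrite fg.
have gphi x : phi (g x) = (tag x, val (tagged x)).
  have := congr1 (fun x : T => (tag x, val (tagged x))) (fg x); rewrite /f /= => <-; exact: surjective_pairing.
(* Coordinates of v on component j, extended by 0 because [dt_form] takes functions on all of
   nat. *)
pose y (j : J) (n : nat) : int := if insub n : option 'I_(dt_size (kind j)) is Some m then v (g (Tagged (fun j => 'I_(dt_size (kind j))) m)) else 0.
have yE j (m : 'I_(dt_size (kind j))) : y j m = v (g (Tagged (fun j => 'I_(dt_size (kind j))) m)).
  by rewrite /y valK.
have sumT (F : I -> int) : \sum_i F i = \sum_j \sum_(n < dt_size (kind j)) F (g (Tagged (fun j => 'I_(dt_size (kind j))) n)).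
  rewrite (reindex g) /=; last by exists f => ? _; rewrite ?fg ?gf.
  by rewrite (sig_big_dep _ (fun i q => true)) /=; apply: eq_bigr => -[].
have eq1 : \sum_i v i * v i = \sum_j \sum_(n < dt_size (kind j)) y j n * y j n.
  by rewrite sumT; apply: eq_bigr => j _; apply: eq_bigr => n _; rewrite yE.
have eq2 : \sum_i \sum_j (qadj s t i j)%:Z * (v i * v j) =
    \sum_j 2 * \sum_(b < dt_size (kind j)) \sum_(a < dt_size (kind j)) (dt_edge (kind j) a b)%:Z * (y j a * y j b).
  under eq_bigr do rewrite sumT.
  rewrite sumT; apply: eq_bigr => j _; rewrite -dt_adj_sum; apply: eq_bigr => n _.
  rewrite (bigD1 j) //= [X in _ + X]big1.
    by rewrite addr0; apply: eq_bigr => m _; rewrite phi_adj !gphi /= eqxx !yE.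
  move=> j' jj'; rewrite big1 // => m _; rewrite phi_adj !gphi /= eq_sym (negbTE jj') mul0r //.
have ge0 d x : 0 <= dt_form d x.
  rewrite leNgt; apply/negP => lt; have z := dt_form_eq0 (ltW lt); move: lt; rewrite /dt_form.
  rewrite !big1 ?subrr ?ltxx // => [b _|n _]; last by rewrite z ?mul0r.
  by rewrite big1 // => a _; rewrite [x a]z // mul0r mulr0.
(* The sum of the component forms is half of the Cartan form of v, so nonpositivity forces every
   term to vanish. *)
have le0 : \sum_j dt_form (kind j) (y j) <= 0.
  rewrite /dt_form sumrB -eq1 -(@pmulr_rle0 _ 2) // mulrBr mulr_sumr.
  by rewrite -mulr_sumr in eq2; rewrite -mulr_sumr -eq2.
have z j : dt_form (kind j) (y j) = 0.
  have /eqP : \sum_j dt_form (kind j) (y j) = 0 by apply/eqP; rewrite eq_le le0 sumr_ge0.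
  by rewrite psumr_eq0 // => /allP /(_ j (mem_index_enum _)) /= /eqP.
apply/ffunP=> i; rewrite ffunE -(gf i).
case: (f i) => j n; rewrite -yE; apply: (dt_form_eq0 _ (ltn_ord n)).
by rewrite z.
Qed.

Lemma cform_nat (d : I -> nat) : cf [ffun i => (d i)%:Z] [ffun i => (d i)%:Z] =
  2 * ((\sum_i d i * d i)%N%:Z - (\sum_a d (s a) * d (t a))%N%:Z).
Proof.
rewrite cform_arrows; congr (2 * (_ - _)); rewrite (big_morph Posz PoszD (erefl _)).
  by apply: eq_bigr => x _; rewrite !ffunE PoszM.
by apply: eq_bigr => x _; rewrite !ffunE PoszM.
Qed.

Lemma tits_pos (d : I -> nat) : (exists i, d i <> 0%N) ->
  (\sum_a d (s a) * d (t a) < \sum_i d i * d i)%N.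
Proof.
case=> i di; rewrite ltnNge; apply/negP => le.
have : cf [ffun i => (d i)%:Z] [ffun i => (d i)%:Z] <= 0 by rewrite cform_nat; lia.
by move/cform_pos/ffunP/(_ i); rewrite !ffunE => -[].
Qed.

Lemma cform_dims (d : I -> nat) : cf [ffun i => (d i)%:Z] [ffun i => (d i)%:Z] = 2 <->
  (\sum_i d i * d i = (\sum_a d (s a) * d (t a)).+1)%N.
Proof. rewrite cform_nat; split; lia. Qed.
End Dynkin.

(** * Compatible sets of almost positive roots *)

Section Bridge.
Variables (I A : finType) (s t : A -> I) (k : closedFieldType).
Notation rp := (rep s t k).
Notation dv := Defs.dimv.
Notation sr := (@simple_root I).
Implicit Types (M N L : rp) (X Y : decrep s t k).
Hypothesis dyn : dynkin_quiver s t.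

Definition dimvec M : {ffun I -> int} := [ffun i => (dv M i)%:Z].

Lemma subrep0 M : subrep (0 : 'M[k]_(rdim M)).
Proof. by apply/subrepP; split=> ?; rewrite mul0mx sub0mx. Qed.

Lemma subrep1 M : subrep (1%:M : 'M[k]_(rdim M)).
Proof. by apply/subrepP; split=> ?; rewrite submx1. Qed.

Lemma dimv_rdim0 M i : rdim M = 0%N -> dv M i = 0%N.
Proof. by move=> M0; apply/eqP; rewrite -leqn0 -M0 dimv_rank rank_leq_row. Qed.

(** The representation and the graded space split off from each other, and a graded space splits
    into lines. So an indecomposable is either a representation or one line at a vertex. *)
Lemma decrep_indecP X : decrep_indecomposable X <->
  (indec (drep X) /\ forall i, ddec X i = 0%N) \/
  (rdim (drep X) = 0%N /\ exists i, forall j, ddec X j = (i == j)).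
Proof.
case: X => M V /=; split; last first.
  move=> /= [[[M0 nd] V0]|[M0 [i Vi]]]; split=> /=; [by left | | by right; exists i; rewrite /= Vi eqxx |].
    case=> U [U' [v1 [v2 [sU [sU' [sum [cap [vE [nz nz']]]]]]]]]; apply: nd.
    have v0 i : v1 i = 0%N /\ v2 i = 0%N by have := vE i; rewrite /= V0; lia.
    exists U, U'; split=> //; split.
      by case: nz => // -[i]; case: (v0 i).
    by case: nz' => // -[i]; case: (v0 i).
  case=> U [U' [v1 [v2 [sU [sU' [sum [cap [vE [nz nz']]]]]]]]]; rewrite /= in vE.
  case: nz => [|[a va]]; first by case; apply/eqP; rewrite -leqn0 -M0 rank_leq_row.
  case: nz' => [|[b vb]]; first by case; apply/eqP; rewrite -leqn0 -M0 rank_leq_row.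
  have := vE a; have := vE b; rewrite !Vi; case: (i =P a) => [ia|]; case: (i =P b) => [ib|]; try lia.
  by rewrite -ia in va *; rewrite -ib in vb *; lia.
case=> /= nz nd; have [M0|M0] := eqVneq (rdim M) 0%N.
  right; split=> //; case: nz => // -[i /= Vi]; exists i => j.
  have [//|ne] := eqVneq (V j) (i == j); case: nd.
  (* One line at i is split off; the complement is nonzero because V is not that line. *)
  exists 0, 0, (fun j => (i == j) : nat), (fun j => (V j - (i == j))%N) => /=.
  split; first exact: subrep0.
  split; first exact: subrep0.
  split; first by apply/andP; split; apply/row_subP=> p; exfalso; case: p => p; rewrite M0.
  split; first by apply/eqP; rewrite -leqn0 -M0 rank_leq_row.
  split; first by move=> j'; case: eqP => [<-|_] /=; lia.
  split; right; first by exists i; rewrite eqxx.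
  by exists j; move/eqP: ne; case: (i =P j) => [<-|_] /=; lia.
left; have V0 i : V i = 0%N.
  apply: contrapT => Vi; apply: nd; exists 1%:M, 0, (fun=> 0%N), V => /=.
  split; first exact: subrep1.
  split; first exact: subrep0.
  split; first by apply/andP; rewrite submx1 addsmxSl.
  split; first by rewrite capmx0 mxrank0.
  split=> //; split; last by right; exists i.
  by left; rewrite mxrank1; apply/eqP.
split=> //; split; first exact/eqP.
case=> U [U' [sU sU' sum cap [rU rU']]]; apply: nd; exists U, U', (fun=> 0%N), (fun=> 0%N).
by do 5!(split=> //); split; left.
Qed.

Definition pos_dec M : decrep s t k := DecRep M (fun=> 0%N).
Definition neg_dec i : decrep s t k := DecRep (zero_rep s t k) (fun j => (i == j) : nat).

Lemma pos_dec_indec M : indec M -> decrep_indecomposable (pos_dec M).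
Proof. by move=> iM; apply/decrep_indecP; left. Qed.

Lemma neg_dec_indec i : decrep_indecomposable (neg_dec i).
Proof. by apply/decrep_indecP; right; split=> //; exists i. Qed.

Lemma sdim_pos_dec M : sdim (pos_dec M) = dimvec M.
Proof. by apply/ffunP=> i; rewrite !ffunE subr0. Qed.

Lemma sdim_neg_dec i : sdim (neg_dec i) = - sr i.
Proof. by apply/ffunP=> j; rewrite !ffunE dimv_rdim0 // sub0r. Qed.

(** [compat_pair] ranges over all decorated indecomposables with a given signed dimension, so these
    must be identified up to isomorphism. A line is excluded by its negative coordinate. *)
Lemma sdim_pos X M : decrep_indecomposable X -> indec M -> sdim X = dimvec M ->
  rep_iso (drep X) M /\ forall i, ddec X i = 0%N.
Proof.
move=> /decrep_indecP [[iX X0]|[X0 [i Xi]]] iM /ffunP e.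
  split=> //; apply: (indec_iso (tits_pos dyn)) => // i.
  by have := e i; rewrite !ffunE X0 subr0 => -[].
by have := e i; rewrite !ffunE Xi eqxx dimv_rdim0.
Qed.

Lemma sdim_neg X i : decrep_indecomposable X -> sdim X = - sr i ->
  rdim (drep X) = 0%N /\ forall j, ddec X j = (i == j).
Proof.
move=> /decrep_indecP [[iX X0]|[X0 _]] /ffunP e.
  by have := e i; rewrite !ffunE X0 eqxx; lia.
split=> // j; have := e j; rewrite !ffunE dimv_rdim0 //.
by case: (i == j); lia.
Qed.

Lemma compat_pos_ext M N : indec M -> indec N -> compat_pair s t k (dimvec M) (dimvec N) ->
  dim_ext1 M N = 0%N.
Proof.
move=> iM iN H; have := H _ _ (pos_dec_indec iM) (pos_dec_indec iN) (sdim_pos_dec M) (sdim_pos_dec N).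
rewrite /dimE /=; lia.
Qed.

Lemma compat_pos_neg M i : indec M -> compat_pair s t k (dimvec M) (- sr i) -> dv M i = 0%N.
Proof.
move=> iM H; have := H _ _ (pos_dec_indec iM) (neg_dec_indec i) (sdim_pos_dec M) (sdim_neg_dec i).
rewrite /dimE /= (bigD1 i) //= eqxx muln1; lia.
Qed.

Lemma ext_compat_pos M N : indec M -> indec N -> dim_ext1 M N = 0%N -> dim_ext1 N M = 0%N ->
  compat_pair s t k (dimvec M) (dimvec N).
Proof.
move=> iM iN MN NM X Y iX iY hX hY.
have [i1 X0] := sdim_pos iX iM hX; have [i2 Y0] := sdim_pos iY iN hY.
rewrite /dimE (ext_iso_l _ i1) (ext_iso_r _ i2) MN (ext_iso_l _ i2) (ext_iso_r _ i1) NM.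
by rewrite !big1 // => i _; rewrite ?X0 ?Y0 ?muln0.
Qed.

Lemma zero_compat_pos_neg M i : indec M -> dv M i = 0%N ->
  compat_pair s t k (dimvec M) (- sr i) /\ compat_pair s t k (- sr i) (dimvec M).
Proof.
move=> iM Mi; split=> X Y iX iY hX hY.
  have [i1 X0] := sdim_pos iX iM hX; have [Y0 Yi] := sdim_neg iY hY.
  rewrite /dimE !ext_rdim0 ?Y0; try by [left | right].
  rewrite !big1 // => j _; rewrite ?X0 // Yi (dimv_iso _ i1).
  by case: eqP => [<-|]; rewrite ?Mi ?muln0.
have [i1 X0] := sdim_pos iY iM hY; have [Y0 Yi] := sdim_neg iX hX.
rewrite /dimE !ext_rdim0 ?Y0; try by [left | right].
rewrite !big1 // => j _; rewrite ?X0 ?muln0 // Yi (dimv_iso _ i1).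
by case: eqP => [<-|]; rewrite ?Mi ?muln0.
Qed.

Lemma compat_neg_neg i j : compat_pair s t k (- sr i) (- sr j).
Proof.
move=> X Y iX iY hX hY; have [X0 _] := sdim_neg iX hX; have [Y0 _] := sdim_neg iY hY.
rewrite /dimE !ext_rdim0 ?X0; try by left.
by rewrite !big1 // => l _; rewrite dimv_rdim0 ?muln0.
Qed.

Lemma indec_pos_root M : indec M -> is_pos_root s t (dimvec M).
Proof.
move=> iM; have p i : 0 <= dimvec M i by rewrite ffunE.
split=> //; apply: (norm2_pos_root (cform_pos dyn)) => //.
by apply/(cform_dims dyn)/(indec_unit_form (tits_pos dyn)).
Qed.

(** The existence part of Gabriel's theorem: norm 2 for the Cartan form is Tits form 1. *)
Lemma pos_root_indec v : is_pos_root s t v -> exists M, indec M /\ v = dimvec M.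
Proof.
case=> rv v0; have vE : v = [ffun i => (`|v i|%N)%:Z] by apply/ffunP=> i; rewrite ffunE gez0_abs.
have [M [iM dM]] : exists M, indec M /\ forall i, dv M i = `|v i|%N.
  apply: (@unit_form_indec _ _ _ _ k (tits_pos dyn) (fun i => `|v i|%N)); apply/(cform_dims dyn); rewrite -vE.
  exact: root_norm rv.
by exists M; split=> //; rewrite vE; apply/ffunP=> i; rewrite !ffunE dM.
Qed.

Lemma compatible_sub C D : compatible s t k C -> uniq D -> {subset D <= C} -> compatible s t k D.
Proof.
case=> _ [rC cC] uD sub; split=> //; split=> [c /sub|c d /sub cc /sub dd]; [exact: rC | exact: cC].
Qed.

Lemma sum_undup_count (T : eqType) (l : seq T) (F : T -> int) :
  \sum_(c <- undup l) (count_mem c l)%:Z * F c = \sum_(x <- l) F x.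
Proof.
have -> : \sum_(x <- l) F x = \sum_(x <- l) \sum_(c <- undup l) (x == c)%:Z * F c.
  rewrite big_seq [RHS]big_seq; apply: eq_bigr => x xl.
  rewrite (bigD1_seq x) ?undup_uniq ?mem_undup //= eqxx mul1r big1 ?addr0 //.
  by move=> c; rewrite eq_sym => /negbTE ->; rewrite mul0r.
rewrite exchange_big /=; apply: eq_bigr => c _; rewrite -mulr_suml; congr (_ * _).
rewrite -sum1_count big_mkcond /= (big_morph Posz PoszD (erefl _)).
by apply: eq_bigr => x _; case: eqP.
Qed.

Lemma in_mem_map (T : Type) (X : eqType) (f : T -> X) (l : seq T) c :
  c \in map f l <-> exists2 x, List.In x l & c = f x.
Proof.
elim: l => [|y l IH] /=; first by split=> // -[].
rewrite in_cons; split=> [/orP[/eqP->|/IH[x xl ->]]|[x [<-|xl] cE]].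
- by exists y; [left |].
- by exists x; [right |].
- by rewrite cE eqxx.
- by apply/orP; right; apply/IH; exists x.
Qed.

Theorem integral_completeness (v : {ffun I -> int}) :
  exists C (m : {ffun I -> int} -> int), [/\ compatible s t k C,
    forall c, c \in C -> 0 <= m c & forall i, v i = \sum_(c <- C) m c * c i].
Proof.
pose d i := if 0 <= v i then `|v i|%N else 0%N.
have [l [[il rl] dl]] := @rigid_decomposition _ _ s t k (tits_pos dyn) d.
pose P := undup (map dimvec l); pose Ng := [seq - sr i | i <- enum I & v i < 0].
(* On dimension vectors the coefficient is the multiplicity. For c = -alpha_i the second branch
   evaluates to -v_i, without recovering i from c. *)
pose m c := if c \in P then (count_mem c (map dimvec l))%:Z else \sum_j c j * v j.
have memP c : c \in P -> exists2 M, List.In M l & c = dimvec M.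
  by rewrite mem_undup => /in_mem_map.
have memN c : c \in Ng -> exists2 i, v i < 0 & c = - sr i.
  by case/mapP=> i; rewrite mem_filter => /andP[vi _] ->; exists i.
have disj i : - sr i \notin P.
  by apply/negP => /memP[M _ /ffunP/(_ i)]; rewrite !ffunE eqxx.
have sr_inj : injective (fun i => - sr i).
  by move=> i j /ffunP/(_ i); rewrite !ffunE eqxx; case: eqP.
have mN i : m (- sr i) = - v i.
  rewrite /m (negbTE (disj i)) (bigD1 i) //= !ffunE eqxx mulN1r big1 ?addr0 //.
  by move=> j; rewrite eq_sym !ffunE => /negbTE ->; rewrite oppr0 mul0r.
(* The summands add up to the positive part of v, so each vanishes where v is negative; this is
   compatibility with the negative simple roots used. *)
have dv0 M i : List.In M l -> v i < 0 -> dv M i = 0%N.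
  move=> Ml vi; have := dl i; rewrite /d leNgt vi /= => H.
  elim: (l) Ml H => //= N r IH [->|/IH{}IH]; rewrite big_cons; first lia.
  by move=> H; apply: IH; lia.
exists (P ++ Ng), m; split; last 1 first.
- move=> i; rewrite big_cat /=.
  have -> : \sum_(c <- P) m c * c i = (d i)%:Z.
    rewrite big_seq; under eq_bigr => c cP do rewrite /m cP.
    rewrite -big_seq (sum_undup_count _ (fun c : {ffun I -> int} => c i)) big_map -dl.
    by rewrite (big_morph Posz PoszD (erefl _)); apply: eq_bigr => M _; rewrite ffunE.
  rewrite big_map big_filter big_enum_cond /=; under eq_bigr do rewrite mN !ffunE mulrNN.
  rewrite /d; have [vi|vi] := leP 0 (v i).
    rewrite gez0_abs // big1 ?addr0 // => j vj; case: eqP => [ji|_]; last by rewrite mulr0.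
    by rewrite ji ltNge vi in vj.
  rewrite add0r (bigD1 i) //= eqxx mulr1 big1 ?addr0 // => j /andP[_ /negbTE ->].
  by rewrite mulr0.
- split; first rewrite cat_uniq undup_uniq /=.
    apply/andP; split; last by rewrite map_inj_uniq // filter_uniq // enum_uniq.
    by apply/hasPn => c /memN[i _ ->]; exact: disj.
  split=> [c|c c'].
    rewrite mem_cat => /orP[/memP[M Ml ->]|/memN[i _ ->]]; last by right; exists i.
    by left; apply: indec_pos_root; exact: il.
  rewrite !mem_cat => /orP[/memP[M Ml ->]|/memN[i vi ->]] /orP[/memP[N Nl ->]|/memN[j vj ->]].
  - by apply: ext_compat_pos; [exact: il | exact: il | exact: rl | exact: rl].
  - exact: (zero_compat_pos_neg (il _ Ml) (dv0 _ _ Ml vj)).1.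
  - exact: (zero_compat_pos_neg (il _ Nl) (dv0 _ _ Nl vi)).2.
  - exact: compat_neg_neg.
move=> c; rewrite mem_cat => /orP[cP|/memN[i vi ->]]; first by rewrite /m cP.
by rewrite mN oppr_ge0 ltW.
Qed.

(** Positive roots compatible with -alpha_i vanish at i, so coordinate i of the first sum is
    negative. The second sum can be negative there only if -alpha_i occurs in it. *)
Lemma compatible_no_neg C C' (m m' : {ffun I -> int} -> int) i :
  compatible s t k C -> compatible s t k C' ->
  (forall c, c \in C -> 0 < m c) -> (forall c, c \in C' -> 0 < m' c) ->
  (forall i, \sum_(c <- C) m c * c i = \sum_(c <- C') m' c * c i) ->
  - sr i \in C -> - sr i \in C'.
Proof.
move=> [uC [rC cC]] [uC' [rC' cC']] mp mp' e iC; apply: contraT => niC'; exfalso.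
have lt0 : \sum_(c <- C) m c * c i < 0.
  rewrite (bigD1_seq (- sr i)) //= !ffunE eqxx mulrN1.
  suff H : \sum_(c <- C | c != - sr i) m c * c i <= 0.
    by rewrite -[ltRHS]addr0; apply: ltr_leD H; rewrite oppr_lt0; exact: mp.
  rewrite big_seq_cond; apply: sumr_le0 => c /andP[cIn _]; apply: mulr_ge0_le0; first exact/ltW/mp.
  case: (rC _ cIn) => [/pos_root_indec[M [iM cE]]|[j ->]]; last by rewrite !ffunE; case: eqP.
  by have := cC _ _ cIn iC; rewrite cE => /(compat_pos_neg iM) H; rewrite ffunE H.
have : 0 <= \sum_(c <- C') m' c * c i; last by rewrite -e; lia.
rewrite big_seq; apply: sumr_ge0 => c cIn; apply: mulr_ge0; first exact/ltW/mp'.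
case: (rC' _ cIn) => [[_ //]|[j cE]]; rewrite cE !ffunE; case: eqP => // ji.
by rewrite -ji -cE cIn in niC'.
Qed.

Section Expand.
Variables (F : {ffun I -> int} -> rp) (m : {ffun I -> int} -> int).

Definition expand (C : seq {ffun I -> int}) : seq rp :=
  flatten [seq nseq `|m c|%N (F c) | c <- C].

Lemma in_expand C L : List.In L (expand C) -> exists2 c, c \in C & L = F c.
Proof.
elim: C => //= c C IH /List.in_app_iff[|/IH[c' c'C ->]]; last first.
  by exists c'; rewrite // inE c'C orbT.
by elim: `|m c|%N => //= n IHn [<-|/IHn //]; exists c; rewrite // mem_head.
Qed.

Lemma expand_in C c : c \in C -> 0 < m c -> List.In (F c) (expand C).
Proof.
elim: C => //= c' C IH; rewrite in_cons => /orP[/eqP->|/IH{}IH] mc; apply/List.in_app_iff.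
  by left; case: (m c') mc => // -[|n] // _; left.
by right; apply: IH.
Qed.

Lemma dimv_expand C i : (forall c, c \in C -> 0 < m c /\ c = dimvec (F c)) ->
  (\sum_(L <- expand C) dv L i)%N%:Z = \sum_(c <- C) m c * c i.
Proof.
elim: C => [|c C IH] H; first by rewrite !big_nil.
rewrite big_cons -IH; last by move=> c' c'C; apply: H; rewrite inE c'C orbT.
rewrite /expand /= big_cat PoszD /=; congr (_ + _).
have [mc cE] := H c (mem_head _ _); rewrite big_nseq -Monoid.iteropE /=.
have -> : iterop `|m c|%N addn (dv (F c) i) 0%N = (`|m c| * dv (F c) i)%N.
  by rewrite Monoid.iteropE; elim: `|m c|%N => //= n ->; rewrite mulSn.
have ci : c i = (dv (F c) i)%:Z by rewrite {1}cE ffunE.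
by rewrite PoszM gez0_abs ?ltW // ci.
Qed.
End Expand.

(** Disjointness rules out negative simple roots. Both sides then expand to rigid sums of the same
    dimension; a summand of one has the dimension of a summand of the other, and this gives a common
    element unless C is empty. *)
Theorem integral_uniqueness C C' (m m' : {ffun I -> int} -> int) :
  compatible s t k C -> compatible s t k C' ->
  (forall c, c \in C -> 0 < m c) -> (forall c, c \in C' -> 0 < m' c) ->
  (forall i, \sum_(c <- C) m c * c i = \sum_(c <- C') m' c * c i) ->
  (forall c, c \in C -> c \in C' -> False) -> C = [::].
Proof.
move=> cC cC' mp mp' e disj.
have pos : forall c, c \in C -> is_pos_root s t c.
  move=> c cIn; case: (cC.2.1 _ cIn) => // -[i cE]; rewrite cE in cIn.
  by case: (disj _ cIn); exact: compatible_no_neg cC cC' mp mp' e cIn.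
have pos' : forall c, c \in C' -> is_pos_root s t c.
  move=> c cIn; case: (cC'.2.1 _ cIn) => // -[i cE]; rewrite cE in cIn.
  by case: (disj (- sr i)) => //; exact: compatible_no_neg cC' cC mp' mp (fun i => esym (e i)) cIn.
have [F HF] : exists F : {ffun I -> int} -> rp, forall c, is_pos_root s t c -> indec (F c) /\ c = dimvec (F c).
  suff /choice[F HF] : forall c, exists M, is_pos_root s t c -> indec M /\ c = dimvec M by exists F.
  move=> c.
  have [/pos_root_indec[M HM]|nc] := EM (is_pos_root s t c); first by exists M.
  by exists (zero_rep s t k) => /nc.
have rl D n : compatible s t k D -> (forall c, c \in D -> is_pos_root s t c) -> rigid_list (expand F n D).
  move=> cD pD; split=> [M /in_expand[c cD' ->]|M N /in_expand[c cD' ->] /in_expand[c' cD'' ->]].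
    by have [] := HF _ (pD _ cD').
  have [i1 e1] := HF _ (pD _ cD'); have [i2 e2] := HF _ (pD _ cD'').
  by apply: compat_pos_ext => //; rewrite -e1 -e2; exact: cD.2.2.
have dims i : (\sum_(L <- expand F m C) dv L i = \sum_(L <- expand F m' C') dv L i)%N.
  have : (\sum_(L <- expand F m C) dv L i)%N%:Z = (\sum_(L <- expand F m' C') dv L i)%N%:Z.
    rewrite !dimv_expand // => c cIn; split; try by [exact: mp' | exact: mp].
      exact: (HF _ (pos' _ cIn)).2.
    exact: (HF _ (pos _ cIn)).2.
  by case.
case: C cC mp e disj pos dims => // c C cC mp e disj pos dims.
have cIn := mem_head c C.
have [N /in_expand[c' c'C' ->] dN] :=
  rigid_list_summand (tits_pos dyn) (rl _ m cC pos) (rl _ m' cC' pos') dims (expand_in F cIn (mp _ cIn)).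
case: (disj c) => //; have [_ e1] := HF _ (pos _ cIn); have [_ e2] := HF _ (pos' _ c'C').
suff -> : c = c' by [].
by rewrite e1 e2; apply/ffunP=> i; rewrite !ffunE dN.
Qed.
End Bridge.

(** * Cones and the fan *)

Section RealApprox.
Variable R : realType.

Lemma uniform_eps (T : eqType) (P : T -> R -> Prop) (l : seq T) :
  (forall x e e', P x e -> e' <= e -> P x e') ->
  (forall x, exists2 e, 0 < e & P x e) -> exists2 e, 0 < e & forall x, x \in l -> P x e.
Proof.
move=> mono ex; elim: l => [|x l [e e0 he]]; first by exists 1.
have [e' e'0 he'] := ex x; exists (Num.min e e'); first by rewrite lt_min e0.
move=> y; rewrite inE => /orP[/eqP->|/he H].
  by apply: mono he' _; rewrite ge_min lexx orbT.
by apply: mono H _; rewrite ge_min lexx.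
Qed.

Lemma linear_continuous (J : finType) (u y : J -> R) (d : R) : 0 < d ->
  exists2 e, 0 < e & forall y', (forall j, `|y' j - y j| < e) ->
    `|\sum_j y' j * u j - \sum_j y j * u j| < d.
Proof.
move=> d0; pose S := \sum_j `|u j|.
have S0 : 0 <= S by apply: sumr_ge0.
have S1 : 0 < 1 + S by lra.
exists (d / (1 + S)); first exact: divr_gt0.
move=> y' hy; rewrite -sumrB; apply: le_lt_trans (ler_norm_sum _ _ _) _.
have h : \sum_j `|y' j * u j - y j * u j| <= d / (1 + S) * S.
  rewrite mulr_sumr; apply: ler_sum => j _; rewrite -mulrBl normrM.
  by apply: ler_wpM2r => //; exact/ltW/hy.
apply: le_lt_trans h _; rewrite mulrAC ltr_pdivrMr // ltr_pM2l //; lra.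
Qed.

Lemma rational_approx (J : finType) (y : J -> R) (e : R) : 0 < e ->
  exists q : J -> rat, forall j, `|ratr (q j) - y j| < e.
Proof.
move=> e0; have /choice[q hq] : forall j, exists q : rat, `|ratr q - y j| < e.
  move=> j; have [|q] := @rat_in_itvoo R (y j - e) (y j + e); first by lra.
  rewrite in_itv /= => /andP[h1 h2]; exists q; rewrite ltr_norml; apply/andP; split; lra.
by exists q.
Qed.

Lemma common_denominator (J : finType) (q : J -> rat) :
  exists (N : int) (n : J -> int), 0 < N /\ forall j, (n j)%:~R = N%:~R * q j.
Proof.
exists (\prod_j denq (q j)), (fun j => numq (q j) * \prod_(l | l != j) denq (q l)); split.
  by apply: prodr_gt0 => j _; exact: denq_gt0.
move=> j; have -> : \prod_l denq (q l) = denq (q j) * \prod_(l | l != j) denq (q l) by exact: bigD1.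
by rewrite !intrM numqE; ring.
Qed.

(* The real solution space is spanned by rational vectors, so a positive solution can be
   perturbed to a rational, then scaled to an integral one. *)
Lemma positive_integral_solution (I : finType) (X : eqType) (D : seq X) (a : X -> I -> int)
    (lam : X -> R) : uniq D -> (forall c, c \in D -> 0 < lam c) ->
  (forall i, \sum_(c <- D) lam c * (a c i)%:~R = 0) ->
  exists n : X -> int, (forall c, c \in D -> 0 < n c) /\
    forall i, \sum_(c <- D) n c * a c i = 0.
Proof.
case: D => [|x0 D']; first by exists (fun=> 1); split=> // i; rewrite big_nil.
set D := x0 :: D' => uD lam0 sol; pose p := size D.
pose Zq : 'M[rat]_(p, #|I|) := \matrix_(j, i) (a (nth x0 D j) (enum_val i))%:~R.
pose x : 'rV[R]_p := \row_j lam (nth x0 D j).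
have : (x <= map_mx ratr (kermx Zq))%MS.
  rewrite map_kermx sub_kermx; apply/eqP/rowP=> i; rewrite !mxE.
  rewrite -[RHS](sol (enum_val i)) (big_nth x0) big_mkord; apply: eq_bigr => j _.
  by rewrite !mxE /= ratr_int.
case/submxP=> y xE; set K := kermx Zq in xE.
have [e e0 he] : exists2 e, 0 < e & forall j : 'I_p, j \in enum 'I_p -> forall y' : 'I_p -> R,
    (forall l, `|y' l - y 0 l| < e) -> 0 < \sum_l y' l * ratr (K l j).
  apply: (@uniform_eps _ (fun (j : 'I_p) e => forall y' : 'I_p -> R,
    (forall l, `|y' l - y 0 l| < e) -> 0 < \sum_l y' l * ratr (K l j))).
    by move=> j e e' H le y' hy; apply: H => l; apply: lt_le_trans le.
  move=> j; have xj : x 0 j = \sum_l y 0 l * ratr (K l j).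
    by rewrite {1}xE mxE; apply: eq_bigr => l _; rewrite mxE.
  have x0j : 0 < x 0 j by rewrite mxE; apply: lam0; exact: mem_nth.
  have [e e0 he] := @linear_continuous _ (fun l => ratr (K l j)) (y 0) _ x0j.
  by exists e => // y' /he; rewrite -xj ltr_norml => /andP[h _]; lra.
have [q hq] := rational_approx (y 0) e0.
pose z : 'rV[rat]_p := (\row_l q l) *m K.
have zpos j : 0 < z 0 j.
  rewrite -(ltr0q R) mxE; have -> : ratr (\sum_l (\row_l q l) 0 l * K l j) = \sum_l ratr (q l) * ratr (K l j) :> R.
    by rewrite rmorph_sum; apply: eq_bigr => l _; rewrite mxE /= rmorphM.
  exact: he (mem_enum _ _) _ hq.
have zZ : z *m Zq = 0 by rewrite -mulmxA mulmx_ker mulmx0.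
have [N [n [N0 nE]]] := common_denominator (fun j => z 0 j).
have npos j : 0 < n j.
  by rewrite -(ltr0z rat) nE mulr_gt0 // ltr0z.
exists (fun c => if insub (index c D) is Some j then n j else 1); split.
  by move=> c _; case: insubP.
move=> i; rewrite (big_nth x0) big_mkord.
transitivity (\sum_j n j * a (nth x0 D j) i).
  apply: eq_bigr => j _; rewrite (_ : index (nth x0 D j) D = j); last by apply: (index_uniq x0 (ltn_ord j) uD).
  by rewrite valK.
apply/eqP; rewrite -(intr_eq0 rat) rmorph_sum /=; apply/eqP.
have /rowP/(_ (enum_rank i)) := zZ; rewrite !mxE => /(congr1 (fun w => N%:~R * w)).
rewrite mulr0 mulr_sumr => {2}<-; apply: eq_bigr => j _.
by rewrite intrM nE !mxE enum_rankK mulrA.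
Qed.
End RealApprox.

(** * Simplicial cones, their faces and closedness *)

Section Cones.
Variables (I : finType) (R : realType).
Implicit Types (C D : seq {ffun I -> int}) (lam : {ffun I -> int} -> R) (x : I -> R).

Lemma sum_sub_count (T : eqType) (C D : seq T) (F : T -> R) : uniq C -> {subset D <= C} ->
  \sum_(d <- D) F d = \sum_(c <- C) (count_mem c D)%:R * F c.
Proof.
move=> uC sub.
have -> : \sum_(x <- D) F x = \sum_(x <- D) \sum_(c <- C) (x == c)%:R * F c.
  rewrite big_seq [RHS]big_seq; apply: eq_bigr => x xl.
  rewrite (bigD1_seq x) ?sub //= eqxx mul1r big1 ?addr0 //.
  by move=> c; rewrite eq_sym => /negbTE ->; rewrite mul0r.
rewrite exchange_big /=; apply: eq_bigr => c _; rewrite -mulr_suml; congr (_ * _).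
rewrite -sum1_count natr_sum [RHS]big_mkcond /=.
by apply: eq_bigr => x _; case: eqP.
Qed.

(** Faces are described by coefficients on C vanishing off D. The list D may repeat entries, and
    repeated ones merge into a multiple; this explains the multiplication and division by
    [count_mem]. *)
Lemma cone_subP C D x : uniq C -> {subset D <= C} ->
  cone R D x <-> exists lam, [/\ forall c, c \in C -> 0 <= lam c,
    forall c, c \in C -> c \notin D -> lam c = 0 &
    forall i, x i = \sum_(c <- C) lam c * (c i)%:~R].
Proof.
move=> uC sub; split=> [[lam [l0 xE]]|[lam [l0 lD xE]]].
  exists (fun c => (count_mem c D)%:R * lam c); split=> [c cC|c _|i].
  - have [cD|/count_memPn->] := boolP (c \in D); last by rewrite mul0r.
    by rewrite mulr_ge0 // l0.
  - by move/count_memPn->; rewrite mul0r.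
  - by rewrite xE (sum_sub_count _ uC sub); apply: eq_bigr => c _; rewrite mulrA.
exists (fun c => lam c / (count_mem c D)%:R); split=> [c cD|i].
  by rewrite divr_ge0 // l0 // sub.
rewrite xE (sum_sub_count _ uC sub) big_seq [RHS]big_seq; apply: eq_bigr => c cC.
have [cD|cD] := boolP (c \in D); last by rewrite (lD _ cC cD) !mul0r mulr0.
rewrite mulrA mulrCA divff ?mulr1 // pnatr_eq0 -lt0n.
by rewrite -has_count has_pred1.
Qed.

Lemma cone_sub C D x : uniq C -> {subset D <= C} -> cone R D x -> cone R C x.
Proof. by move=> uC sub /(cone_subP _ uC sub)[lam [l0 _ xE]]; exists lam. Qed.

Lemma dual_basis C : uniq C -> lin_indep_R R C ->
  exists e : {ffun I -> int} -> I -> R, forall c d, c \in C -> d \in C ->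
    \sum_i e c i * (d i)%:~R = (c == d)%:R.
Proof.
move=> uC li; pose Dm : 'M[R]_(size C, #|I|) := \matrix_(j, i) ((nth 0 C j) (enum_val i))%:~R.
have fr : row_free Dm.
  rewrite -kermx_eq0; apply/eqP/row_matrixP=> r; rewrite row0.
  have := row_sub r (kermx Dm); move: (row r _) => v /sub_kermxP vD.
  pose lam c := if insub (index c C) is Some j then v 0 j else 0.
  have lamE (j : 'I_(size C)) : lam (nth 0 C j) = v 0 j.
    by rewrite /lam index_uniq // valK.
  apply/rowP=> j; rewrite mxE -lamE; apply: li; last exact: mem_nth.
  move=> i; have /rowP/(_ (enum_rank i)) := vD; rewrite !mxE => H.
  rewrite (big_nth 0) big_mkord -[RHS]H; apply: eq_bigr => j' _.
  by rewrite lamE mxE enum_rankK.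
exists (fun c i => if insub (index c C) is Some j then pinvmx Dm (enum_rank i) j else 0).
move=> c d cC dC; have lc : (index c C < size C)%N by rewrite index_mem.
have ld : (index d C < size C)%N by rewrite index_mem.
under eq_bigr do rewrite insubT /=.
have /matrixP/(_ (Ordinal ld) (Ordinal lc)) := mulmxVp fr; rewrite mxE [RHS]mxE => H.
rewrite (_ : (c == d) = (Ordinal ld == Ordinal lc)).
  rewrite -H (reindex (@enum_val I predT)) /=; last exact/onW_bij/enum_val_bij.
  by apply: eq_bigr => i _; rewrite [Dm _ _]mxE enum_valK /= nth_index // mulrC.
rewrite -val_eqE /= eq_sym; apply/eqP/eqP => [-> //|e].
by rewrite -(nth_index 0 cC) -(nth_index 0 dC) e.
Qed.

Lemma lin_indep_functional C (g : {ffun I -> int} -> R) : uniq C -> lin_indep_R R C ->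
  exists ell : I -> R, forall c, c \in C -> \sum_i ell i * (c i)%:~R = g c.
Proof.
move=> uC li; have [e he] := dual_basis uC li.
exists (fun i => \sum_(d <- C) g d * e d i) => c cC.
under eq_bigr do rewrite mulr_suml; rewrite exchange_big /=.
rewrite (bigD1_seq c) //= [X in _ + X]big_seq_cond [X in _ + X]big1 ?addr0 => [|d /andP[dC dc]].
  by under eq_bigr do rewrite -mulrA; rewrite -mulr_sumr he // eqxx mulr1.
by under eq_bigr do rewrite -mulrA; rewrite -mulr_sumr he // (negbTE dc) mulr0.
Qed.

Lemma functional_sum C (ell : I -> R) lam x :
  (forall i, x i = \sum_(c <- C) lam c * (c i)%:~R) ->
  \sum_i ell i * x i = \sum_(c <- C) lam c * \sum_i ell i * (c i)%:~R.
Proof.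
move=> xE; under eq_bigr do rewrite xE mulr_sumr.
rewrite exchange_big; apply: eq_bigr => c _; rewrite mulr_sumr.
by apply: eq_bigr => i _; rewrite mulrCA.
Qed.

Lemma face_simplicial C (F : (I -> R) -> Prop) : uniq C -> lin_indep_R R C ->
  is_face R (cone R C) F <-> exists D, {subset D <= C} /\ forall x, F x <-> cone R D x.
Proof.
move=> uC li; split=> [[ell [ell0 HF]]|[D [sub HF]]].
  have e0 c : c \in C -> 0 <= \sum_i ell i * (c i)%:~R.
    move=> cC; apply: (ell0 (fun i => (c i)%:~R)); exists (fun d => (d == c)%:R).
    split=> [d _|i]; first by rewrite ler0n.
    rewrite (bigD1_seq c) //= eqxx mul1r big1 ?addr0 //.
    by move=> d /negbTE ->; rewrite mul0r.
  pose D := [seq c <- C | \sum_i ell i * ((c : {ffun I -> int}) i)%:~R == 0].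
  have sub : {subset D <= C} by move=> c; rewrite mem_filter => /andP[].
  exists D; split=> // x; rewrite HF (cone_subP _ uC sub); split=> [[[lam [l0 xE]]]|[lam [l0 lD xE]]].
    rewrite (functional_sum _ xE) big_seq => s0; exists lam; split=> // c cC.
    rewrite mem_filter cC andbT => nz; apply/eqP; move: s0 => /eqP.
    rewrite psumr_eq0 => [/allP /(_ c cC)|d dC]; last by rewrite mulr_ge0 ?l0 ?e0.
    by rewrite cC /= mulf_eq0 (negbTE nz) orbF.
  split; first by exists lam.
  rewrite (functional_sum _ xE) big_seq big1 // => c cC.
  have [cD|cD] := boolP (c \in D); last by rewrite (lD _ cC cD) mul0r.
  by move: cD; rewrite mem_filter => /andP[/eqP-> _]; rewrite mulr0.
(* A supporting functional for the face: 0 on the generators in D, 1 on the other generators. *)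
have [ell hell] := lin_indep_functional (fun c => (c \notin D)%:R) uC li.
exists ell; split=> [x [lam [l0 xE]]|x].
  rewrite (functional_sum _ xE) big_seq; apply: sumr_ge0 => c cC.
  by rewrite hell // mulr_ge0 ?l0 ?ler0n.
rewrite HF (cone_subP _ uC sub); split=> [[lam [l0 lD xE]]|[[lam [l0 xE]]]].
  split; first by exists lam.
  rewrite (functional_sum _ xE) big_seq big1 // => c cC; rewrite hell //.
  have [cD|cD] := boolP (c \in D); first by rewrite mulr0.
  by rewrite (lD _ cC cD) mul0r.
rewrite (functional_sum _ xE) big_seq => s0; exists lam; split=> // c cC nD.
move: s0 => /eqP; rewrite psumr_eq0 => [/allP /(_ c cC)|d dC]; last by rewrite hell // mulr_ge0 ?l0 ?ler0n.
by rewrite cC /= hell // nD mulr1 => /eqP.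
Qed.

(** A point outside the cone either has a negative dual coordinate or lies off the span of C. Each
    alternative is a strict inequality on a linear functional, hence persists nearby. *)
Lemma simplicial_cone_closed C x : uniq C -> lin_indep_R R C -> ~ cone R C x ->
  exists2 e, 0 < e & forall y, (forall i, `|y i - x i| < e) -> ~ cone R C y.
Proof.
move=> uC li nx; have [e he] := dual_basis uC li.
have coord y lam c : c \in C -> (forall i, y i = \sum_(c <- C) lam c * (c i)%:~R) ->
    \sum_i y i * e c i = lam c.
  move=> cC yE; under eq_bigr do rewrite mulrC; rewrite (functional_sum _ yE).
  rewrite (bigD1_seq c) //= he // eqxx mulr1 big_seq_cond big1 ?addr0 //.
  by move=> d /andP[dC dc]; rewrite he // eq_sym (negbTE dc) mulr0.
have [[c [cC neg]]|npos] := EM (exists c, c \in C /\ \sum_i x i * e c i < 0).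
  have [|d d0 hd] := @linear_continuous R _ (e c) x (- \sum_i x i * e c i); first by lra.
  exists d => // y /hd hy [lam [l0 yE]]; move: hy; rewrite (coord _ _ _ cC yE) ltr_norml.
  by move=> /andP[_ h]; have := l0 _ cC; lra.
(* The functional g_i takes y to coordinate i of the difference between y and its projection on the
   span of C, so it vanishes on the cone. *)
pose g i j := (j == i)%:R - \sum_(c <- C) e c j * (c i)%:~R.
have gE y i : \sum_j y j * g i j = y i - \sum_(c <- C) (\sum_j y j * e c j) * (c i)%:~R.
  under eq_bigr do rewrite mulrBr mulr_sumr; rewrite sumrB; congr (_ - _).
    rewrite (bigD1 i) //= eqxx mulr1 big1 ?addr0 // => j /negbTE ->; exact: mulr0.
  rewrite exchange_big /=; apply: eq_bigr => c _; rewrite mulr_suml.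
  by apply: eq_bigr => j _; rewrite mulrA.
have [i nz] : exists i, \sum_j x j * g i j != 0.
  apply: contrapT => H; apply: nx; exists (fun c => \sum_i x i * e c i); split=> [c cC|i].
    by rewrite leNgt; apply/negP => lt; apply: npos; exists c.
  apply/eqP; rewrite -subr_eq0 -gE; apply: contraT => nz; by case: H; exists i.
have [|d d0 hd] := @linear_continuous R _ (g i) x `|\sum_j x j * g i j|; first by rewrite normr_gt0.
exists d => // y /hd hy [lam [l0 yE]]; move: hy; rewrite gE.
have -> : y i - \sum_(c <- C) (\sum_j y j * e c j) * (c i)%:~R = 0.
  apply/eqP; rewrite subr_eq0 yE big_seq [X in _ == X]big_seq; apply/eqP.
  by apply: eq_bigr => c cC; rewrite (coord _ _ _ cC yE).
by rewrite sub0r normrN ltxx.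
Qed.
End Cones.

(** * The fan of compatible cones: uniqueness, completeness and lattice bases *)

Section Fan.
Variables (I A : finType) (s t : A -> I) (k : closedFieldType) (R : realType).
Implicit Types (C D : seq {ffun I -> int}) (lam mu : {ffun I -> int} -> R) (x : I -> R).
Notation compat := (compatible s t k).
Hypothesis dyn : dynkin_quiver s t.

Lemma real_uniqueness_disjoint C C' lam mu : compat C -> compat C' ->
  (forall c, c \in C -> 0 < lam c) -> (forall c, c \in C' -> 0 < mu c) ->
  (forall i, \sum_(c <- C) lam c * (c i)%:~R = \sum_(c <- C') mu c * (c i)%:~R) ->
  (forall c, c \in C -> c \in C' -> False) -> C = [::].
Proof.
move=> cC cC' lp mp e disj.
(* Changing signs on C' turns the equality of two positive combinations into one relation with
   positive coefficients, to which [positive_integral_solution] applies. *)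
pose a c i : int := if c \in C then c i else - c i.
pose nu c := if c \in C then lam c else mu c.
have nC' c : c \in C' -> (c \in C) = false.
  by move=> cIn; apply/negP => cC0; exact: disj cC0 cIn.
have uD : uniq (C ++ C').
  rewrite cat_uniq cC.1 cC'.1 andbT /=; apply/hasPn => c cIn /=; by rewrite nC'.
have split_sum (T : zmodType) (f : {ffun I -> int} -> int -> T) i :
   (forall c z, f c (- z) = - f c z) ->
   \sum_(c <- C ++ C') f c (a c i) = \sum_(c <- C) f c (c i) - \sum_(c <- C') f c (c i).
  move=> fN; rewrite big_cat /= -sumrN; congr (_ + _).
    by rewrite big_seq [RHS]big_seq; apply: eq_bigr => c cIn; rewrite /a cIn.
  by rewrite big_seq [RHS]big_seq; apply: eq_bigr => c cIn; rewrite /a nC' // fN.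
have [||n [np nE]] := @positive_integral_solution R I _ (C ++ C') a nu uD.
- move=> c; rewrite /nu mem_cat; case: ifP => [cIn _|_ /= cIn]; [exact: lp | exact: mp].
- move=> i; rewrite (split_sum _ (fun c z => nu c * z%:~R)) => [|c z]; last by rewrite mulrNz mulrN.
  apply/eqP; rewrite subr_eq0; apply/eqP.
  transitivity (\sum_(c <- C) lam c * (c i)%:~R).
    by rewrite big_seq [RHS]big_seq; apply: eq_bigr => c cIn; rewrite /nu cIn.
  by rewrite e big_seq [RHS]big_seq; apply: eq_bigr => c cIn; rewrite /nu nC'.
apply: (@integral_uniqueness _ _ s t k dyn C C' n n) => //.
- by move=> c cIn; apply: np; rewrite mem_cat cIn.
- by move=> c cIn; apply: np; rewrite mem_cat cIn orbT.
move=> i; apply/eqP; rewrite -subr_eq0 -(split_sum _ (fun c z => n c * z)) ?nE //.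
by move=> c z; rewrite mulrN.
Qed.

Definition coef lam C c := if c \in C then lam c else 0.

Lemma sum_coef lam C U i : uniq C -> uniq U -> {subset C <= U} ->
  \sum_(c <- C) lam c * (c i)%:~R = \sum_(c <- U) coef lam C c * (c i)%:~R.
Proof.
move=> uC uU sub; rewrite (sum_sub_count _ uU sub); apply: eq_bigr => c _.
rewrite count_uniq_mem // /coef; case: ifP => _; rewrite ?mul1r ?mul0r //.
Qed.

(** Cancelling the minimum of the two coefficients everywhere leaves positive combinations on
    disjoint subsets of C and C'; the left one must be empty. *)
Lemma real_uniqueness_le C C' lam mu : compat C -> compat C' ->
  (forall c, c \in C -> 0 <= lam c) -> (forall c, c \in C' -> 0 <= mu c) ->
  (forall i, \sum_(c <- C) lam c * (c i)%:~R = \sum_(c <- C') mu c * (c i)%:~R) ->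
  forall c, coef lam C c <= coef mu C' c.
Proof.
move=> cC cC' l0 m0 e; pose U := undup (C ++ C').
have uU : uniq U by exact: undup_uniq.
have subC : {subset C <= U} by move=> c cIn; rewrite mem_undup mem_cat cIn.
have subC' : {subset C' <= U} by move=> c cIn; rewrite mem_undup mem_cat cIn orbT.
pose l := coef lam C; pose m := coef mu C'.
have lg c : 0 <= l c by rewrite /l /coef; case: ifP => // /l0.
have mg c : 0 <= m c by rewrite /m /coef; case: ifP => // /m0.
pose C1 := [seq c <- U | m c < l c]; pose C2 := [seq c <- U | l c < m c].
have C1E : C1 = [::].
  apply: (@real_uniqueness_disjoint C1 C2 (fun c => l c - m c) (fun c => m c - l c)).
  - apply: compatible_sub cC (filter_uniq _ uU) _ => c; rewrite mem_filter => /andP[lt _].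
    by move: lt; rewrite /l /coef; case: ifP => // _; rewrite ltNge mg.
  - apply: compatible_sub cC' (filter_uniq _ uU) _ => c; rewrite mem_filter => /andP[lt _].
    by move: lt; rewrite /m /coef; case: ifP => // _; rewrite ltNge lg.
  - by move=> c; rewrite mem_filter subr_gt0 => /andP[].
  - by move=> c; rewrite mem_filter subr_gt0 => /andP[].
  - move=> i; apply/eqP; rewrite -subr_eq0 !big_filter [X in X - _]big_mkcond [X in _ - X]big_mkcond /= -sumrB.
    have := e i; rewrite (sum_coef lam i cC.1 uU subC) (sum_coef mu i cC'.1 uU subC') => /eqP.
    rewrite -subr_eq0 -sumrB => /eqP e0; apply/eqP; rewrite -[RHS]e0; apply: eq_bigr => c _.
    rewrite -/(l c) -/(m c) -mulrBl; case: ltgtP => [lt|lt|->]; rewrite ?subr0 ?sub0r ?subrr ?mul0r //.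
    by rewrite -mulNr opprB.
  - move=> c; rewrite !mem_filter => /andP[lt _] /andP[lt' _].
    by have := lt_trans lt lt'; rewrite ltxx.
move=> c; have [cU|ncU] := boolP (c \in U).
  rewrite leNgt; apply/negP => lt; have : c \in C1 by rewrite mem_filter cU andbT.
  by rewrite C1E.
move: ncU; rewrite mem_undup mem_cat negb_or => /andP[h1 h2].
by rewrite /coef (negbTE h1) (negbTE h2).
Qed.

Lemma real_uniqueness C C' lam mu : compat C -> compat C' ->
  (forall c, c \in C -> 0 <= lam c) -> (forall c, c \in C' -> 0 <= mu c) ->
  (forall i, \sum_(c <- C) lam c * (c i)%:~R = \sum_(c <- C') mu c * (c i)%:~R) ->
  forall c, coef lam C c = coef mu C' c.
Proof.
move=> cC cC' l0 m0 e c; apply/eqP; rewrite eq_le !real_uniqueness_le //.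
Qed.

(** The positive and the negative parts of a linear relation are two nonnegative combinations of C
    with the same sum, so they agree, and both are zero. *)
Lemma compatible_lin_indep C : compat C -> lin_indep_R R C.
Proof.
move=> cC lam e c cIn.
have := @real_uniqueness C C (fun c => Num.max (lam c) 0) (fun c => Num.max (- lam c) 0) cC cC _ _ _ c.
rewrite /coef cIn => H; have : Num.max (lam c) 0 = Num.max (- lam c) 0.
  apply: H => [d _|d _|i]; try by rewrite le_max lexx orbT.
  apply/eqP; rewrite -subr_eq0 -sumrB -[X in _ == X](e i); apply/eqP.
  apply: eq_bigr => d _; rewrite -mulrBl; congr (_ * _).
  by rewrite /Num.max; case: ifP; case: ifP; lra.
by rewrite /Num.max; case: ifP; case: ifP; lra.
Qed.

(** Compatible sets consist of roots, so only finitely many cones occur; each is closed, and a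
    single radius serves for all of them. *)
Lemma cone_locally_closed x : exists2 e, 0 < e &
  forall D y, compat D -> (forall i, `|y i - x i| < e) -> cone R D y -> cone R D x.
Proof.
have [Phi0 hPhi] := finitely_many_roots (cform_pos dyn).
pose Phi := undup Phi0.
pose P (b : (size Phi).-tuple bool) (e : R) := compat (mask b Phi) ->
  forall y, (forall i, `|y i - x i| < e) -> cone R (mask b Phi) y -> cone R (mask b Phi) x.
have [e e0 he] : exists2 e, 0 < e & forall b, b \in enum {: (size Phi).-tuple bool} -> P b e.
  apply: uniform_eps => [b e e' H le cb y hy|b].
    by apply: H => // i; apply: lt_le_trans le.
  have [cb|ncb] := EM (compat (mask b Phi)); last by exists 1.
  have [cx|ncx] := EM (cone R (mask b Phi) x); first by exists 1 => //.
  have [e e0 he] := simplicial_cone_closed cb.1 (compatible_lin_indep cb) ncx.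
  by exists e => // _ y /he.
exists e => // D y cD hy cDy.
(* The list D, in whatever order, is replaced by a mask of the fixed list of roots, so that it falls
   among finitely many cases. *)
pose b : (size Phi).-tuple bool := [tuple of map (mem D) (in_tuple Phi)].
have bE : mask b Phi = filter (mem D) Phi by rewrite filter_mask.
have sub : mask b Phi =i D.
  move=> c; rewrite bE mem_filter /=; apply: andb_idr => cIn; rewrite mem_undup; apply: hPhi.
  by case: (cD.2.1 _ cIn) => [[]//|[i ->]]; exact: opp_simple_root.
have ub : uniq (mask b Phi) by rewrite bE filter_uniq // undup_uniq.
have cb : compat (mask b Phi) by apply: compatible_sub cD ub _ => c; rewrite sub.
have := he b (mem_enum _ _) cb y hy.
move=> H; apply: (@cone_sub _ _ D (mask b Phi)); [exact: cD.1 | by move=> c; rewrite sub |].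
by apply: H; apply: (@cone_sub _ _ (mask b Phi) D) cDy => // c; rewrite sub.
Qed.

Lemma cone_scaled_integral C (m : {ffun I -> int} -> int) (N : int) x : 0 < N ->
  (forall c, c \in C -> 0 <= m c) ->
  (forall i, N%:~R * x i = (\sum_(c <- C) m c * c i)%:~R) -> cone R C x.
Proof.
move=> N0 m0 xE; have NR : 0 < N%:~R :> R by rewrite ltr0z.
exists (fun c => (m c)%:~R / N%:~R); split=> [c cC|i].
  by rewrite divr_ge0 ?ler0z ?m0 // ltW.
apply: (mulfI (lt0r_neq0 NR)); rewrite xE rmorph_sum mulr_sumr; apply: eq_bigr => c _ /=.
by rewrite intrM mulrA [_ * (_ / _)]mulrC divfK // lt0r_neq0.
Qed.

Lemma fan_complete x : exists C, compat C /\ cone R C x.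
Proof.
have [e e0 he] := cone_locally_closed x.
have [q hq] := rational_approx x e0.
have [N [n [N0 nE]]] := common_denominator q.
have [C [m [cC m0 vE]]] := integral_completeness k dyn [ffun i => n i].
exists C; split=> //; apply: (he C (fun i => ratr (q i))) => //.
apply: (@cone_scaled_integral C m N) => // i; rewrite -vE ffunE.
by rewrite -(ratr_int R N) -rmorphM -nE /= ratr_int.
Qed.

(* If u is the sum of C and N is large, a cone containing N u + v also contains u, so that its
   generators include C and, by maximality, are C; hence v is an integral combination of C. *)
Lemma cluster_Z_spans C : cluster s t k C -> Z_spans C.
Proof.
move=> [cC maxC] v; pose u : I -> R := fun i => \sum_(c <- C) 1 * (c i)%:~R.
have [e e0 he] := cone_locally_closed u.
have [N [N0 hN]] : exists N : int, 0 < N /\ forall i, `|(v i)%:~R| < e * N%:~R :> R.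
  pose S : R := \sum_i `|(v i)%:~R|.
  have := archi_boundP (_ : 0 <= S / e); set b := Num.bound _ => hb.
  exists b.+1; split=> // i; have : S / e < b.+1%:R.
    apply: lt_le_trans (hb _) _; last by rewrite ler_nat.
    by apply: divr_ge0; [exact: sumr_ge0 | exact: ltW].
  rewrite ltr_pdivrMr // mulrC => lt; apply: le_lt_trans lt.
  by rewrite /S (bigD1 i) //= lerDl sumr_ge0.
have NR : 0 < N%:~R :> R by rewrite ltr0z.
pose w : {ffun I -> int} := [ffun i => N * (\sum_(c <- C) c i) + v i].
have [C' [m [cC' m0 wE]]] := integral_completeness k dyn w.
have uE i : u i = (\sum_(c <- C) c i)%:~R.
  by rewrite rmorph_sum; apply: eq_bigr => c _; rewrite mul1r.
have [mu [mu0 muE]] : cone R C' u.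
  apply: (he C' (fun i => u i + (v i)%:~R / N%:~R)) => // [i|].
    by rewrite addrAC subrr add0r normrM normfV (gtr0_norm NR) ltr_pdivrMr.
  apply: (@cone_scaled_integral C' m N) => // i.
  by rewrite -wE ffunE uE mulrDr intrD intrM mulrCA divff ?mulr1 // lt0r_neq0.
have co := @real_uniqueness C C' (fun=> 1) mu cC cC' (fun _ _ => ler01) mu0 muE.
have sub : {subset C <= C'}.
  move=> c cIn; have := co c; rewrite /coef cIn; case: ifP => // _ /eqP.
  by rewrite oner_eq0.
have sub' := maxC _ cC' sub.
have pC : perm_eq C' C by apply: uniq_perm; [exact: cC'.1 | exact: cC.1 | move=> c; apply/idP/idP; [exact: sub' | exact: sub]].
(* The vector w is v plus N times the sum of C, so N is subtracted from each coefficient. *)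
exists (fun c => m c - N) => i; under eq_bigr do rewrite mulrBl.
rewrite sumrB -mulr_sumr -(perm_big _ pC) /= -wE ffunE; ring.
Qed.
End Fan.

Theorem mainTheorem5 (I A : finType) (s t : A -> I) (k : closedFieldType)
    (R : realType) :
  dynkin_quiver s t ->
  (* each cone is simplicial with generators C *)
  (forall C, compatible s t k C -> lin_indep_R R C) /\
  (* the faces of the cone of C are the cones of subsets of C *)
  (forall C, compatible s t k C -> forall F : (I -> R) -> Prop,
      is_face R (cone R C) F <->
      exists D, {subset D <= C} /\ forall x, F x <-> cone R D x) /\
  (* any two cones intersect in a common face *)
  (forall C C', compatible s t k C -> compatible s t k C' ->
      is_face R (cone R C) (fun x => cone R C x /\ cone R C' x) /\
      is_face R (cone R C') (fun x => cone R C x /\ cone R C' x)) /\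
  (* every maximal cone is generated by a Z-basis of Q *)
  (forall C, cluster s t k C -> lin_indep_R R C /\ Z_spans C) /\
  (* the union of all the cones is Q_R *)
  (forall x : I -> R, exists C, compatible s t k C /\ cone R C x).
Proof.
move=> dyn; have li C : compatible s t k C -> lin_indep_R R C by exact: compatible_lin_indep.
split; first exact: li.
split; first by move=> C cC F; exact: face_simplicial cC.1 (li _ cC).
split; last first.
  split; last exact: fan_complete.
  by move=> C cl; split; [exact: li cl.1 | exact: cluster_Z_spans cl].
move=> C C' cC cC'; pose D := [seq c <- C | c \in C'].
have DC : {subset D <= C} by move=> c; rewrite mem_filter => /andP[].
have DC' : {subset D <= C'} by move=> c; rewrite mem_filter => /andP[].
have inter x : cone R C x /\ cone R C' x <-> cone R D x.
  split=> [[[lam [l0 xE]] [mu [m0 xE']]]|cDx]; last first.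
    by split; [exact: cone_sub cC.1 DC cDx | exact: cone_sub cC'.1 DC' cDx].
  (* The two expressions of a common point have the same coefficients, so those on generators
     outside C' vanish. *)
  apply/(cone_subP _ cC.1 DC); exists lam; split=> // c cIn; rewrite mem_filter cIn andbT => nC'.
  have := real_uniqueness dyn cC cC' l0 m0 (fun i => etrans (esym (xE i)) (xE' i)) c.
  by rewrite /coef cIn (negbTE nC').
by split; [apply/(face_simplicial _ cC.1 (li _ cC)) | apply/(face_simplicial _ cC'.1 (li _ cC'))];
  exists D.
Qed.
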